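(* Let $n,s\in\mathbb{N}$ and $\rho>1$, and let $$L_{n,s}(\mathcal{E}_\rho)=\frac1{2\pi}\oint_{\mathcal{E}_\rho}|K_{n,s}(z)|\,|dz| .$$ Then $$L_{n,s}(\mathcal{E}_\rho)\le \frac{\sqrt{\pi}}{2^s\rho^{(2s+1)n}}\sqrt{\sum_{k=0}^s\binom{2s+1}{k}^2\rho^{4nk}\,I_0+2\sum_{l=1}^s\rho^{2nl}\sum_{i=0}^{s-l}\binom{2s+1}{i}\binom{2s+1}{i+l}\rho^{4ni}\,I_l}\,,$$ where, for $0\le l\le s$, $$I_l=\int_0^\pi\frac{\cos(2nl\theta)\,d\theta}{(a_{2n}+\cos 2n\theta)^{2s}}=(-1)^l(2\rho^{2n})^{2s}\,\frac{\pi\sum_{m=0}^{2s-1}\binom{2s+l-1}{m}\binom{4s-m-2}{2s-1}(\rho^{4n}-1)^m}{\rho^{2nl}(\rho^{4n}-1)^{4s-1}},\qquad a_{2n}=\tfrac12(\rho^{2n}+\rho^{-2n}).$$ Consequently, if $f$ is analytic in the interior $\mathcal{D}$ of $\mathcal{E}_\rho$ and continuous on $\overline{\mathcal{D}}$, then $$|R_{n,s}(f)|\le \frac{\sqrt{\pi}}{2^s\rho^{(2s+1)n}}\sqrt{\sum_{k=0}^s\binom{2s+1}{k}^2\rho^{4nk}\,I_0+2\sum_{l=1}^s\rho^{2nl}\sum_{i=0}^{s-l}\binom{2s+1}{i}\binom{2s+1}{i+l}\rho^{4ni}\,I_l}\;\cdot\max_{z\in\mathcal{E}_\rho}|f(z)|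 .$$
   Context: $\mathbb{N}=\{1,2,\dots\}$. $T_n$ is the Chebyshev polynomial of the first kind of degree $n$, $T_n(\cos\theta)=\cos n\theta$, with zeros $\xi_1,\dots,\xi_n\in(-1,1)$. The remainder $R_{n,s}(f)$ is defined by the quadrature formula $$\int_{-1}^1 f(t)T_n(t)\frac{dt}{\sqrt{1-t^2}}=\sum_{\nu=1}^n\sum_{i=0}^{2s-1}A_{i,\nu}f^{(i)}(\xi_\nu)+R_{n,s}(f),\qquad A_{i,\nu}=\int_{-1}^1 \ell_{i,\nu}(t)T_n(t)\frac{dt}{\sqrt{1-t^2}},$$ where $\ell_{i,\nu}$ are the fundamental polynomials of Hermite interpolation at $\xi_1,\dots,\xi_n$, each with multiplicity $2s$: $\ell_{i,\nu}$ is the polynomial of degree at most $2sn-1$ with $\ell_{i,\nu}^{(j)}(\xi_\mu)=1$ if $(j,\mu)=(i,\nu)$ and $0$ otherwise, for $0\le j\le 2s-1$, $1\le\mu\le n$. The ellipse is $\mathcal{E}_\rho=\{z\in\mathbb{C}: z=\tfrac12(u+u^{-1}),\ u=\rho e^{i\theta},\ 0\le\theta\le2\pi\}$. For $z\in\mathbb{C}\setminus[-1,1]$ the kernel is $$K_{n,s}(z)=\frac{\rho_{n,s}(z)}{T_n(z)^{2s}},\qquad \rho_{n,s}(z)=\int_{-1}^1\frac{T_n(t)^{2s+1}}{z-t}\,\frac{dt}{\sqrt{1-t^2}} .$$ *)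

(* Defs.v *)
From Stdlib Require Import Reals Lra Lia.
From Coquelicot Require Import Coquelicot.
Open Scope R_scope.

(** * Chebyshev polynomials of the first kind, on the reals and on C *)

Fixpoint chebT (n : nat) (x : R) : R :=
  match n with
  | O => 1
  | S O => x
  | S ((S k) as m) => 2 * x * chebT m x - chebT k x
  end.

Fixpoint chebTC (n : nat) (z : C) : C :=
  match n with
  | O => RtoC 1
  | S O => z
  | S ((S k) as m) => (RtoC 2 * z * chebTC m z - chebTC k z)%C
  end.

Lemma chebT_cos (n : nat) (theta : R) :
  chebT n (cos theta) = cos (INR n * theta).
Proof.
assert (H : chebT n (cos theta) = cos (INR n * theta) /\
            chebT (S n) (cos theta) = cos (INR (S n) * theta)).
{ induction n as [|n [IH1 IH2]].
  - simpl. rewrite Rmult_0_l, cos_0, Rmult_1_l. split; reflexivity.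
  - split; [exact IH2|].
    change (chebT (S (S n)) (cos theta))
      with (2 * cos theta * chebT (S n) (cos theta) - chebT n (cos theta)).
    rewrite IH1, IH2.
    replace (INR (S (S n)) * theta) with (INR (S n) * theta + theta)
      by (rewrite (S_INR (S n)); ring).
    replace (INR n * theta) with (INR (S n) * theta - theta)
      by (rewrite (S_INR n); ring).
    rewrite cos_plus, cos_minus. ring. }
exact (proj1 H).
Qed.

Lemma chebTC_RtoC (n : nat) (x : R) : chebTC n (RtoC x) = RtoC (chebT n x).
Proof.
assert (H : chebTC n (RtoC x) = RtoC (chebT n x) /\
            chebTC (S n) (RtoC x) = RtoC (chebT (S n) x)).
{ induction n as [|n [IH1 IH2]].
  - split; reflexivity.
  - split; [exact IH2|].
    change (chebT (S (S n)) x) with (2 * x * chebT (S n) x - chebT n x).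
    rewrite RtoC_minus, !RtoC_mult, <- IH1, <- IH2. reflexivity. }
exact (proj1 H).
Qed.

(** * Integrals against the weight 1 / sqrt (1 - t^2) on (-1, 1)

    The weight is unbounded at both endpoints, so these are improper Riemann
    integrals. *)

Definition wint (g : R -> R) : R :=
  RInt_gen (fun t => g t / sqrt (1 - t ^ 2)) (at_right (-1)) (at_left 1).

Definition wintC (g : R -> C) : C :=
  @RInt_gen C_R_CompleteNormedModule
    (fun t => (g t / RtoC (sqrt (1 - t ^ 2)))%C) (at_right (-1)) (at_left 1).

(** * The ellipse *)

Definition ellipse_point (rho theta : R) : C :=
  let u := (RtoC rho * (cos theta, sin theta))%C in
  (RtoC (/ 2) * (u + / u))%C.

Definition ellipse (rho : R) (z : C) : Prop :=
  exists theta, 0 <= theta <= 2 * PI /\ z = ellipse_point rho theta.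

(* Left-hand side of the Cartesian equation: the semi-axes are
   (rho + 1/rho)/2 and (rho - 1/rho)/2. *)
Definition ellipse_form (rho : R) (z : C) : R :=
  (Re z / ((rho + / rho) / 2)) ^ 2 + (Im z / ((rho - / rho) / 2)) ^ 2.

Definition ellipse_interior (rho : R) (z : C) : Prop :=
  ellipse_form rho z < 1.

Lemma ellipse_point_eq (rho theta : R) : 0 < rho ->
  ellipse_point rho theta =
  ((rho + / rho) / 2 * cos theta, (rho - / rho) / 2 * sin theta).
Proof.
intros Hr.
assert (E : cos theta * cos theta + sin theta * sin theta = 1).
{ generalize (sin2_cos2 theta). unfold Rsqr. lra. }
assert (Hinv : (/ (RtoC rho * (cos theta, sin theta)))%C
               = (/ rho * cos theta, - (/ rho * sin theta))).
{ unfold Cinv, Cmult, RtoC; simpl.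
  replace ((rho * cos theta - 0 * sin theta) * ((rho * cos theta - 0 * sin theta) * 1)
     + (rho * sin theta + 0 * cos theta) * ((rho * sin theta + 0 * cos theta) * 1))
    with (rho * rho * (cos theta * cos theta + sin theta * sin theta)) by ring.
  rewrite E. f_equal; field; lra. }
unfold ellipse_point. rewrite Hinv.
unfold Cplus, Cmult, RtoC; simpl. f_equal; field; lra.
Qed.

Lemma ellipse_cartesian (rho : R) (z : C) : 1 < rho ->
  ellipse rho z <-> ellipse_form rho z = 1.
Proof.
intros Hr.
assert (Hi : 0 < / rho < 1).
{ split; [apply Rinv_0_lt_compat; lra|].
  rewrite <- Rinv_1. apply Rinv_lt_contravar; lra. }
unfold ellipse, ellipse_form.
set (a := (rho + / rho) / 2). set (b := (rho - / rho) / 2).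
assert (Ha : 0 < a) by (unfold a; lra).
assert (Hb : 0 < b) by (unfold b; lra).
split.
- intros [theta [_ ->]]. rewrite ellipse_point_eq by lra. fold a b. simpl.
  replace (a * cos theta / a) with (cos theta) by (field; lra).
  replace (b * sin theta / b) with (sin theta) by (field; lra).
  generalize (sin2_cos2 theta). unfold Rsqr. lra.
- intros H. destruct z as [x y]. simpl in H.
  set (c := x / a) in *. set (d := y / b) in *.
  assert (Hx : x = a * c) by (unfold c; field; lra).
  assert (Hy : y = b * d) by (unfold d; field; lra).
  assert (Hc : -1 <= c <= 1) by nra.
  assert (Hs : sin (acos c) * sin (acos c) = d * d).
  { generalize (sin2_cos2 (acos c)). unfold Rsqr. rewrite cos_acos by lra. lra. }
  assert (B := acos_bound c).
  assert (Hp : 0 <= sin (acos c)) by (apply sin_ge_0; lra).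
  destruct (Rle_dec 0 d) as [Hd|Hd].
  + exists (acos c). split; [lra|].
    rewrite ellipse_point_eq by lra. fold a b. rewrite cos_acos by lra.
    replace (sin (acos c)) with d by nra. congruence.
  + exists (2 * PI - acos c). split; [lra|].
    rewrite ellipse_point_eq by lra. fold a b.
    rewrite cos_minus, sin_minus, cos_2PI, sin_2PI, cos_acos by lra.
    replace (sin (acos c)) with (- d) by nra.
    rewrite Hx, Hy. f_equal; ring.
Qed.

(** * The kernel and its L^1 norm on the ellipse *)

Definition rho_ns (n s : nat) (z : C) : C :=
  wintC (fun t => (RtoC (chebT n t) ^ (2 * s + 1) / (z - RtoC t))%C).

Definition kernel (n s : nat) (z : C) : C :=
  (rho_ns n s z / chebTC n z ^ (2 * s))%C.

(* Integral of g with respect to arc length |dz| along gamma on [a, b]. *)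
Definition arclength_int (gamma : R -> C) (a b : R) (g : C -> R) : R :=
  RInt (fun t => g (gamma t) *
          Cmod (Derive (fun x => Re (gamma x)) t, Derive (fun x => Im (gamma x)) t))
       a b.

Definition L_ns (n s : nat) (rho : R) : R :=
  / (2 * PI) *
  arclength_int (ellipse_point rho) 0 (2 * PI) (fun z => Cmod (kernel n s z)).

(** * The explicit bound *)

Definition a_coef (rho : R) (j : nat) : R := / 2 * (rho ^ j + / rho ^ j).

Definition I_int (n s : nat) (rho : R) (l : nat) : R :=
  RInt (fun theta => cos (2 * INR n * INR l * theta) /
                     (a_coef rho (2 * n) + cos (2 * INR n * theta)) ^ (2 * s))
       0 PI.

(* [Binomial.C] is the binomial coefficient; unqualified [C] is the complex
   numbers. [Binomial.C n k] is meaningful only for k <= n, which holds at every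
   use here. *)
Definition I_closed (n s : nat) (rho : R) (l : nat) : R :=
  (-1) ^ l * (2 * rho ^ (2 * n)) ^ (2 * s) *
  (PI * sum_n_m (fun m => Binomial.C (2 * s + l - 1) m *
                          Binomial.C (4 * s - m - 2) (2 * s - 1) *
                          (rho ^ (4 * n) - 1) ^ m) 0 (2 * s - 1) /
   (rho ^ (2 * n * l) * (rho ^ (4 * n) - 1) ^ (4 * s - 1))).

Definition err_bound (n s : nat) (rho : R) : R :=
  sqrt PI / (2 ^ s * rho ^ ((2 * s + 1) * n)) *
  sqrt (sum_n_m (fun k => Binomial.C (2 * s + 1) k ^ 2 *
                          rho ^ (4 * n * k) * I_int n s rho 0) 0 s
        + 2 * sum_n_m (fun l => rho ^ (2 * n * l) *
                sum_n_m (fun i => Binomial.C (2 * s + 1) i *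
                                  Binomial.C (2 * s + 1) (i + l) *
                                  rho ^ (4 * n * i) * I_int n s rho l)
                        0 (s - l)) 1 s).

(** * The quadrature formula and its remainder *)

(* xi 1, ..., xi n enumerate the n zeros of T_n. *)
Definition cheb_zeros (n : nat) (xi : nat -> R) : Prop :=
  (forall nu, (1 <= nu <= n)%nat -> -1 < xi nu < 1 /\ chebT n (xi nu) = 0) /\
  (forall nu mu, (1 <= nu <= n)%nat -> (1 <= mu <= n)%nat ->
     xi nu = xi mu -> nu = mu).

Definition is_poly_le (d : nat) (p : R -> R) : Prop :=
  exists a : nat -> R, forall t, p t = sum_n (fun k => a k * t ^ k) d.

(* ell i nu are the fundamental polynomials of Hermite interpolation at
   xi 1, ..., xi n, each node having multiplicity 2s. *)
Definition hermite_fundamental (n s : nat) (xi : nat -> R)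
    (ell : nat -> nat -> R -> R) : Prop :=
  forall i nu, (i <= 2 * s - 1)%nat -> (1 <= nu <= n)%nat ->
    is_poly_le (2 * s * n - 1) (ell i nu) /\
    forall j mu, (j <= 2 * s - 1)%nat -> (1 <= mu <= n)%nat ->
      Derive_n (ell i nu) j (xi mu) =
      if andb (Nat.eqb j i) (Nat.eqb mu nu) then 1 else 0.

Definition quad_coef (n : nat) (ell : nat -> nat -> R -> R) (i nu : nat) : R :=
  wint (fun t => ell i nu t * chebT n t).

(* [C_derive] is total; it is the complex derivative wherever the function is
   complex differentiable, in particular at every order where f is analytic. *)
Definition C_derive_n (f : C -> C) (i : nat) : C -> C := Nat.iter i C_derive f.

Definition remainder (n s : nat) (xi : nat -> R) (ell : nat -> nat -> R -> R)
    (f : C -> C) : C :=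
  (wintC (fun t => f (RtoC t) * RtoC (chebT n t)) -
   sum_n_m (fun nu =>
     sum_n_m (fun i =>
       RtoC (quad_coef n ell i nu) * C_derive_n f i (RtoC (xi nu)))
     0 (2 * s - 1)) 1 n)%C.

(** * Regularity of the integrand *)

Definition analytic_on (D : C -> Prop) (f : C -> C) : Prop :=
  forall z0, D z0 -> exists (a : nat -> C) (r : R), 0 < r /\
    forall z, Cmod (z - z0) < r ->
      @is_pseries C_AbsRing C_NormedModule a (z - z0)%C (f z).

Definition closure (D : C -> Prop) (z : C) : Prop :=
  forall P : C -> Prop, locally z P -> exists w, P w /\ D w.

Definition is_max_on (E : C -> Prop) (g : C -> R) (M : R) : Prop :=
  (exists z, E z /\ g z = M) /\ (forall z, E z -> g z <= M).

(* Main.v *)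
Require Import Defs.
From Stdlib Require Import Reals Lra Lia Factorial.
From Stdlib Require Import Classical ClassicalEpsilon FunctionalExtensionality.
From Coquelicot Require Import Coquelicot.
Open Scope R_scope.

(** Put z = (u + 1/u)/2, so that the ellipse is the image of the circle |u| = rho.

    The integrals of cos(m x)/(z - cos x) over [0, pi] satisfy the three-term
    recurrence of T_m, whose characteristic roots are u and 1/u; being bounded in m they
    are constant multiples of u^(-m).  Expanding cos^(2s+1) this gives
    K_{n,s}(z) = 2 pi / (4^s (u - 1/u)) * P(u) / T_n(z)^(2s) with
    P(u) = sum_{k <= s} binom(2s+1, k) u^(-(2s+1-2k)n), and the bound on L_{n,s} is the
    Cauchy-Schwarz inequality.  The closed form of I_l follows by induction on the
    exponent of the denominator from an integration by parts.

    For the remainder let H be the Hermite interpolant of f.  Then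
    g = (f - H)/T_n^(2s) is holomorphic inside the ellipse, and R_{n,s}(f), the weighted
    integral of T_n^(2s+1) g over [-1, 1], is a multiple of the mean of P(u) g(z) over
    |u| = 1.  Means over circles of holomorphic functions do not depend on the radius, so
    the circle can be enlarged to |u| = r < rho; there the contribution of H vanishes, as
    is seen by letting its radius tend to infinity, and what remains of f is estimated
    as r tends to rho. *)

(** * Continuity and holomorphy of complex functions *)

(** The obstacle is the segment [-1, 1]: the weight 1/sqrt(1 - t^2) is unbounded at its ends, and
    f/T_n^(2s) and H/T_n^(2s), taken separately, may have poles on it. In the variable u the weight
    becomes the angle on |u| = 1, and since z is the same at u and 1/u, the interior of the ellipse
    pulls back to the annulus 1/rho < |u| < rho, which has the unit circle inside it. A function
    holomorphic inside the ellipse thus has equal means over |u| = 1 and |u| = r, with no contour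
    around the segment. Only after that move, at r > 1, where T_n has no zero, is g split into f and
    H. On |u| = 1 the cosines could be traded for u^m or u^(-m). The negative powers keep P bounded
    at infinity, so that H, of degree below 2sn, is beaten by T_n^(2s). The remainder is controlled
    by L_{n,s} because |dz| = |u - 1/u|/2 dtheta cancels the factor u - 1/u of the kernel: the same
    weight P(u)/T_n(z)^(2s), with the same constant 1/(2 4^s), appears in both integrals. *)

Notation R2 := (prod_UniformSpace R_UniformSpace R_UniformSpace).
Notation continuousC := (@continuous _ C_UniformSpace).
Notation CcontinuousC := (@continuous C_UniformSpace C_UniformSpace).
Notation R2continuousC := (@continuous R2 C_UniformSpace).
Notation Clocally := (@locally C_UniformSpace).
Notation Cseries := (@is_series C_AbsRing C_NormedModule).
Notation Cpseries := (@is_pseries C_AbsRing C_NormedModule).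
Notation Csum_n := (@sum_n C_AbelianGroup).
Notation Csum_n_m := (@sum_n_m C_AbelianGroup).

(* [ring] and [field] do not see through the canonical structures in which Coquelicot
   states equalities on [C] and [R]. *)
Ltac C_eq := match goal with |- @eq _ ?a ?b => change (@eq C a b) end.
Ltac R_eq := match goal with |- @eq _ ?a ?b => change (@eq R a b) end.

Lemma RtoC_neq_0 (x : R) : x <> 0 -> RtoC x <> 0.
Proof. intros H E. apply H. exact (RtoC_inj _ _ E). Qed.

Lemma continuous_C_pair {T : UniformSpace} (f : T -> C) (x : T) :
  continuous (fun y => Re (f y)) x -> continuous (fun y => Im (f y)) x ->
  continuousC f x.
Proof.
intros H1 H2.
apply filterlim_ext with (f := fun y => (Re (f y), Im (f y))).
{ intros y. destruct (f y). reflexivity. }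
intros P [d Hd].
generalize (H1 _ (locally_ball (Re (f x)) d)) (H2 _ (locally_ball (Im (f x)) d)).
unfold filtermap. intros A B.
generalize (filter_and _ _ A B). apply filter_imp.
intros y [Ha Hb]. apply Hd. split; assumption.
Qed.

Lemma continuous_Re {T : UniformSpace} (f : T -> C) (x : T) :
  continuousC f x -> continuous (fun y => Re (f y)) x.
Proof.
intros H P [d Hd].
generalize (H _ (locally_ball (f x) d)). unfold filtermap. apply filter_imp.
intros y [Ha _]. apply Hd. exact Ha.
Qed.

Lemma continuous_Im {T : UniformSpace} (f : T -> C) (x : T) :
  continuousC f x -> continuous (fun y => Im (f y)) x.
Proof.
intros H P [d Hd].
generalize (H _ (locally_ball (f x) d)). unfold filtermap. apply filter_imp.
intros y [_ Ha]. apply Hd. exact Ha.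
Qed.

Lemma continuous_RtoC {T : UniformSpace} (f : T -> R) (x : T) :
  continuous f x -> continuousC (fun y => RtoC (f y)) x.
Proof.
intros H. apply continuous_C_pair; [exact H|apply continuous_const].
Qed.

Lemma continuous_Cplus {T : UniformSpace} (f g : T -> C) (x : T) :
  continuousC f x -> continuousC g x ->
  continuousC (fun y => (f y + g y)%C) x.
Proof.
intros Hf Hg. apply continuous_C_pair.
- apply (continuous_plus (V := R_NormedModule) (fun y => Re (f y)) (fun y => Re (g y)));
  now apply continuous_Re.
- apply (continuous_plus (V := R_NormedModule) (fun y => Im (f y)) (fun y => Im (g y)));
  now apply continuous_Im.
Qed.

Lemma continuous_Copp {T : UniformSpace} (f : T -> C) (x : T) :
  continuousC f x ->
  continuousC (fun y => (- f y)%C) x.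
Proof.
intros Hf. apply continuous_C_pair.
- apply (continuous_opp (V := R_NormedModule) (fun y => Re (f y)));
  now apply continuous_Re.
- apply (continuous_opp (V := R_NormedModule) (fun y => Im (f y)));
  now apply continuous_Im.
Qed.

Lemma continuous_Cminus {T : UniformSpace} (f g : T -> C) (x : T) :
  continuousC f x -> continuousC g x ->
  continuousC (fun y => (f y - g y)%C) x.
Proof.
intros Hf Hg. apply continuous_Cplus; [exact Hf|now apply continuous_Copp].
Qed.

Lemma continuous_Cmult {T : UniformSpace} (f g : T -> C) (x : T) :
  continuousC f x -> continuousC g x ->
  continuousC (fun y => (f y * g y)%C) x.
Proof.
intros Hf Hg.
assert (Hf1 := continuous_Re _ _ Hf). assert (Hf2 := continuous_Im _ _ Hf).
assert (Hg1 := continuous_Re _ _ Hg). assert (Hg2 := continuous_Im _ _ Hg).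
apply continuous_C_pair.
- apply (continuous_minus (V := R_NormedModule)
   (fun y => Re (f y) * Re (g y)) (fun y => Im (f y) * Im (g y)));
  apply (continuous_mult (K := R_AbsRing)); assumption.
- apply (continuous_plus (V := R_NormedModule)
   (fun y => Re (f y) * Im (g y)) (fun y => Im (f y) * Re (g y)));
  apply (continuous_mult (K := R_AbsRing)); assumption.
Qed.

Lemma Cmod_sqr_neq_0 (z : C) : z <> 0 -> Re z ^ 2 + Im z ^ 2 <> 0.
Proof.
intros H E. apply H. destruct z as [a b]. simpl in E.
unfold RtoC. f_equal; nra.
Qed.

Lemma continuous_Cinv {T : UniformSpace} (f : T -> C) (x : T) :
  continuousC f x -> f x <> 0 ->
  continuousC (fun y => (/ f y)%C) x.
Proof.
intros Hf H0.
assert (Hf1 := continuous_Re _ _ Hf). assert (Hf2 := continuous_Im _ _ Hf).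
assert (Hd : continuous (fun y => / (Re (f y) ^ 2 + Im (f y) ^ 2)) x).
{ apply (continuous_comp (fun y => Re (f y) ^ 2 + Im (f y) ^ 2) Rinv);
    [|now apply continuous_Rinv, Cmod_sqr_neq_0].
  apply (continuous_plus (V := R_NormedModule)
     (fun y => Re (f y) ^ 2) (fun y => Im (f y) ^ 2)).
  - apply continuous_ext with (f := fun y => Re (f y) * Re (f y)); [intros; simpl; ring|].
    apply (continuous_mult (K := R_AbsRing)); assumption.
  - apply continuous_ext with (f := fun y => Im (f y) * Im (f y)); [intros; simpl; ring|].
    apply (continuous_mult (K := R_AbsRing)); assumption. }
apply continuous_C_pair.
- apply (continuous_mult (K := R_AbsRing)
    (fun y => Re (f y)) (fun y => / (Re (f y) ^ 2 + Im (f y) ^ 2))); assumption.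
- apply (continuous_mult (K := R_AbsRing)
    (fun y => - Im (f y)) (fun y => / (Re (f y) ^ 2 + Im (f y) ^ 2))); [|assumption].
  apply (continuous_opp (V := R_NormedModule) (fun y => Im (f y))). assumption.
Qed.

Lemma continuous_Cdiv {T : UniformSpace} (f g : T -> C) (x : T) :
  continuousC f x -> continuousC g x ->
  g x <> 0 ->
  continuousC (fun y => (f y / g y)%C) x.
Proof.
intros Hf Hg H0. apply continuous_Cmult; [exact Hf|now apply continuous_Cinv].
Qed.

Lemma continuous_Cpow {T : UniformSpace} (f : T -> C) (n : nat) (x : T) :
  continuousC f x ->
  continuousC (fun y => (f y ^ n)%C) x.
Proof.
intros Hf. induction n as [|n IH]; [apply continuous_const|].
apply (continuous_Cmult f (fun y => (f y ^ n)%C)); assumption.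
Qed.

Lemma continuous_Cmod {T : UniformSpace} (f : T -> C) (x : T) :
  continuousC f x -> continuous (fun y => Cmod (f y)) x.
Proof.
intros Hf. apply (continuous_comp f Cmod); [exact Hf|].
exact (filterlim_norm (V := C_NormedModule) (f x)).
Qed.

Lemma continuous_C_eps (f : C -> C) (u : C) :
  (forall eps : posreal, exists delta : posreal,
     forall w, Cmod (w - u) < delta -> Cmod (f w - f u) < eps) ->
  CcontinuousC f u.
Proof.
intros H P HP. apply (locally_norm_le_locally (V := C_NormedModule)) in HP.
destruct HP as [eps He]. destruct (H eps) as [d Hd].
apply (locally_le_locally_norm (V := C_NormedModule) u).
exists d. intros w Hw. apply He, Hd. exact Hw.
Qed.

(** Neighbourhoods in [C] are built from the product structure, that is from squares, whereas power
    series live on discs; this passes between the two. *)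
Lemma locally_Cmod (u : C) (P : C -> Prop) :
  Clocally u P <->
  exists delta : posreal, forall w, Cmod (w - u) < delta -> P w.
Proof.
split; intros H.
- apply (locally_norm_le_locally (V := C_NormedModule) u) in H.
  destruct H as [d Hd]. exists d. intros w Hw. apply Hd. exact Hw.
- apply (locally_le_locally_norm (V := C_NormedModule) u).
  destruct H as [d Hd]. exists d. intros w Hw. apply Hd. exact Hw.
Qed.

Lemma locally_Cmod_ball (z0 u : C) (r : R) :
  Cmod (u - z0) < r -> Clocally u (fun w => Cmod (w - z0) < r).
Proof.
intros H. apply locally_Cmod.
assert (Hp : 0 < r - Cmod (u - z0)) by lra.
exists (mkposreal _ Hp). simpl. intros w Hw.
replace (w - z0)%C with ((w - u) + (u - z0))%C by ring.
generalize (Cmod_triangle (w - u) (u - z0)). lra.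
Qed.

Lemma continuous_C_neq0 (f : C -> C) (u : C) :
  CcontinuousC f u -> f u <> 0 ->
  Clocally u (fun w => f w <> 0).
Proof.
intros Hf H0. apply (Hf (fun z => z <> RtoC 0)). apply locally_Cmod.
exists (mkposreal _ (proj1 (Cmod_gt_0 _) H0)). simpl. intros w Hw E. subst w.
replace (0 - f u)%C with (- f u)%C in Hw by ring. rewrite Cmod_opp in Hw. lra.
Qed.

(* Complex differentiability in Caratheodory's form: the product, quotient and
   chain rules become algebraic identities between continuous functions. *)
Definition cdiff (F : C -> C) (l u : C) : Prop :=
  exists Q : C -> C,
    CcontinuousC Q u /\ Q u = l /\
    Clocally u (fun w => F w = F u + (w - u) * Q w)%C.

Lemma cdiff_continuous (F : C -> C) (l u : C) :
  cdiff F l u -> CcontinuousC F u.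
Proof.
intros (Q & HQ & _ & HF).
apply continuous_ext_loc with (g := fun w => (F u + (w - u) * Q w)%C).
- revert HF. apply filter_imp. intros w ->. reflexivity.
- apply continuous_Cplus; [apply continuous_const|].
  apply continuous_Cmult; [|exact HQ].
  apply continuous_Cminus; [apply continuous_id|apply continuous_const].
Qed.

Lemma cdiff_ext_loc (F G : C -> C) (l u : C) :
  Clocally u (fun w => F w = G w) -> cdiff F l u -> cdiff G l u.
Proof.
intros H (Q & HQ & El & HF). exists Q. repeat split; try assumption.
assert (E := locally_singleton _ _ H).
generalize (filter_and _ _ H HF). apply filter_imp. intros w [<- Hw]. rewrite <- E. exact Hw.
Qed.

(** [C_lim] takes the limit along the horizontal line through [u] only, so it suffices to restrict
    [Q] to that line, where it agrees with the difference quotient away from [u]. *)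
Lemma cdiff_C_derive (F : C -> C) (l u : C) : cdiff F l u -> C_derive F u = l.
Proof.
intros (Q & HQ & El & HF).
unfold C_derive, C_lim.
assert (Hc : continuousC (fun x : R => Q (x, snd u)) (fst u)).
{ apply (continuous_comp (fun x : R => (x, snd u) : C) Q).
  - apply continuous_C_pair; [apply continuous_id|apply continuous_const].
  - destruct u; exact HQ. }
assert (Hl : locally' (fst u) (fun x : R =>
   Q (x, snd u) = ((F (x, snd u) - F u) / ((x, snd u) - u))%C)).
{ destruct HF as [d Hd]. exists d. intros x Hx Hn.
  assert (K : forall w : C, (w - u)%C <> 0 -> (F w = F u + (w - u) * Q w)%C ->
     (Q w = (F w - F u) / (w - u))%C) by (intros w N ->; now field).
  apply K.
  - intros E. apply Hn. apply (f_equal fst) in E. simpl in E. lra.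
  - apply Hd. split; [exact Hx|apply ball_center]. }
rewrite (surjective_pairing l). f_equal.
- apply f_equal with (f := real) (y := Finite (fst l)), is_lim_unique.
  apply is_lim_ext_loc with (f := fun x => Re (Q (x, snd u))).
  + revert Hl. unfold Rbar_locally'. apply filter_imp. intros x ->. reflexivity.
  + replace (fst l) with (Re (Q (fst u, snd u))) by (rewrite <- surjective_pairing, El; reflexivity).
    apply is_lim_continuity, continuity_pt_filterlim.
    exact (continuous_Re (fun x : R => Q (x, snd u)) (fst u) Hc).
- apply f_equal with (f := real) (y := Finite (snd l)), is_lim_unique.
  apply is_lim_ext_loc with (f := fun x => Im (Q (x, snd u))).
  + revert Hl. unfold Rbar_locally'. apply filter_imp. intros x ->. reflexivity.
  + replace (snd l) with (Im (Q (fst u, snd u))) by (rewrite <- surjective_pairing, El; reflexivity).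
    apply is_lim_continuity, continuity_pt_filterlim.
    exact (continuous_Im (fun x : R => Q (x, snd u)) (fst u) Hc).
Qed.

Lemma cdiff_const (c u : C) : cdiff (fun _ => c) 0 u.
Proof.
exists (fun _ => RtoC 0). repeat split.
- apply continuous_const.
- apply filter_forall. intros w. ring.
Qed.

Lemma cdiff_id (u : C) : cdiff (fun w => w) 1 u.
Proof.
exists (fun _ => RtoC 1). repeat split.
- apply continuous_const.
- assert (K : forall a : C, (a = u + (a - u) * 1)%C) by (intros; ring).
  apply filter_forall. exact K.
Qed.

Lemma cdiff_plus (F G : C -> C) (a b u : C) :
  cdiff F a u -> cdiff G b u -> cdiff (fun w => F w + G w)%C (a + b)%C u.
Proof.
intros (Q & HQ & Ea & HF) (S & HS & Eb & HG).
exists (fun w => Q w + S w)%C. split; [now apply continuous_Cplus|].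
split; [now rewrite Ea, Eb|].
generalize (filter_and _ _ HF HG). apply filter_imp. intros w [-> ->]. ring.
Qed.

Lemma cdiff_mult (F G : C -> C) (a b u : C) :
  cdiff F a u -> cdiff G b u ->
  cdiff (fun w => F w * G w)%C (a * G u + F u * b)%C u.
Proof.
intros HF0 HG0. assert (CG := cdiff_continuous _ _ _ HG0).
destruct HF0 as (Q & HQ & Ea & HF), HG0 as (S & HS & Eb & HG).
exists (fun w => Q w * G w + F u * S w)%C. split; [|split].
- apply continuous_Cplus; apply continuous_Cmult; try assumption. apply continuous_const.
- now rewrite Ea, Eb.
- generalize (filter_and _ _ HF HG). apply filter_imp. intros w [-> E].
  rewrite E. ring.
Qed.

Lemma cdiff_inv (F : C -> C) (a u : C) :
  cdiff F a u -> F u <> 0 -> cdiff (fun w => / F w)%C (- a / (F u * F u))%C u.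
Proof.
intros HF0 H0. assert (CF := cdiff_continuous _ _ _ HF0).
assert (N := continuous_C_neq0 _ _ CF H0).
destruct HF0 as (Q & HQ & Ea & HF).
exists (fun w => - Q w / (F u * F w))%C. split; [|split].
- apply continuous_Cdiv.
  + now apply continuous_Copp.
  + apply continuous_Cmult; [apply continuous_const|assumption].
  + now apply Cmult_neq_0.
- now rewrite Ea.
- generalize (filter_and _ _ HF N). apply filter_imp. intros w [E Hw].
  assert (E2 : ((w - u) * Q w = F w - F u)%C) by (rewrite E; ring).
  replace ((w - u) * (- Q w / (F u * F w)))%C with (- ((w - u) * Q w) / (F u * F w))%C
    by (field; split; assumption).
  rewrite E2. field. split; assumption.
Qed.

Lemma cdiff_comp (F G : C -> C) (a b u : C) :
  cdiff F a (G u) -> cdiff G b u -> cdiff (fun w => F (G w)) (b * a)%C u.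
Proof.
intros (Q & HQ & Ea & HF) HG0. assert (CG := cdiff_continuous _ _ _ HG0).
destruct HG0 as (S & HS & Eb & HG).
exists (fun w => S w * Q (G w))%C. split; [|split].
- apply continuous_Cmult; [exact HS|].
  apply (continuous_comp G Q); assumption.
- now rewrite Ea, Eb.
- generalize (filter_and _ _ HG (CG _ HF)). apply filter_imp. intros w [E1 E2].
  rewrite E2. rewrite E1 at 1. ring.
Qed.

(** Continuity of the derivative is built in: it is what allows a circle mean to be differentiated
    under the integral sign. For power series it comes from differentiating twice. *)
Definition hol (F : C -> C) (u : C) : Prop :=
  Clocally u (fun w => cdiff F (C_derive F w) w) /\
  CcontinuousC (C_derive F) u.

Lemma hol_intro (F F1 : C -> C) (u : C) :
  Clocally u (fun w => cdiff F (F1 w) w) ->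
  CcontinuousC F1 u -> hol F u.
Proof.
intros H H1. split.
- revert H. apply filter_imp. intros w Hw. now rewrite (cdiff_C_derive _ _ _ Hw).
- apply continuous_ext_loc with (2 := H1).
  revert H. apply filter_imp. intros w Hw. symmetry. now apply cdiff_C_derive.
Qed.

Lemma hol_cdiff (F : C -> C) (u : C) : hol F u -> cdiff F (C_derive F u) u.
Proof. intros [H _]. exact (locally_singleton _ _ H). Qed.

Lemma hol_continuous (F : C -> C) (u : C) :
  hol F u -> CcontinuousC F u.
Proof. intros H. exact (cdiff_continuous _ _ _ (hol_cdiff _ _ H)). Qed.

Lemma hol_ext_loc (F G : C -> C) (u : C) :
  Clocally u (fun w => F w = G w) -> hol F u -> hol G u.
Proof.
intros E [H1 H2]. apply hol_intro with (C_derive F); [|exact H2].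
generalize (filter_and _ _ (locally_locally _ _ E) H1). apply filter_imp.
intros w [Ew Hw]. now apply cdiff_ext_loc with F.
Qed.

Lemma hol_const (c u : C) : hol (fun _ => c) u.
Proof.
apply hol_intro with (fun _ => RtoC 0); [|apply continuous_const].
apply filter_forall. intros w. apply cdiff_const.
Qed.

Lemma hol_id (u : C) : hol (fun w => w) u.
Proof.
apply hol_intro with (fun _ => RtoC 1); [|apply continuous_const].
apply filter_forall. intros w. apply cdiff_id.
Qed.

Lemma hol_plus (F G : C -> C) (u : C) :
  hol F u -> hol G u -> hol (fun w => F w + G w)%C u.
Proof.
intros [F1 F2] [G1 G2].
apply hol_intro with (fun w => C_derive F w + C_derive G w)%C.
- generalize (filter_and _ _ F1 G1). apply filter_imp. intros w [A B]. now apply cdiff_plus.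
- now apply continuous_Cplus.
Qed.

Lemma hol_mult (F G : C -> C) (u : C) :
  hol F u -> hol G u -> hol (fun w => F w * G w)%C u.
Proof.
intros HF HG. assert (CF := hol_continuous _ _ HF). assert (CG := hol_continuous _ _ HG).
destruct HF as [F1 F2], HG as [G1 G2].
apply hol_intro with (fun w => C_derive F w * G w + F w * C_derive G w)%C.
- generalize (filter_and _ _ F1 G1). apply filter_imp. intros w [A B]. now apply cdiff_mult.
- apply continuous_Cplus; now apply continuous_Cmult.
Qed.

Lemma hol_opp (F : C -> C) (u : C) : hol F u -> hol (fun w => - F w)%C u.
Proof.
intros H. apply hol_ext_loc with (fun w => - RtoC 1 * F w)%C.
- apply filter_forall. intros w. ring.
- apply hol_mult; [apply hol_const|exact H].
Qed.

Lemma hol_minus (F G : C -> C) (u : C) :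
  hol F u -> hol G u -> hol (fun w => F w - G w)%C u.
Proof. intros HF HG. apply hol_plus; [exact HF|now apply hol_opp]. Qed.

Lemma hol_inv (F : C -> C) (u : C) : hol F u -> F u <> 0 -> hol (fun w => / F w)%C u.
Proof.
intros HF H0. assert (CF := hol_continuous _ _ HF). destruct HF as [F1 F2].
apply hol_intro with (fun w => - C_derive F w / (F w * F w))%C.
- generalize (filter_and _ _ F1 (continuous_C_neq0 _ _ CF H0)). apply filter_imp.
  intros w [A B]. now apply cdiff_inv.
- apply continuous_Cdiv.
  + now apply continuous_Copp.
  + now apply continuous_Cmult.
  + now apply Cmult_neq_0.
Qed.

Lemma hol_div (F G : C -> C) (u : C) :
  hol F u -> hol G u -> G u <> 0 -> hol (fun w => F w / G w)%C u.
Proof. intros HF HG H0. apply hol_mult; [exact HF|now apply hol_inv]. Qed.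

Lemma hol_comp (F G : C -> C) (u : C) :
  hol F (G u) -> hol G u -> hol (fun w => F (G w)) u.
Proof.
intros [F1 F2] HG. assert (CG := hol_continuous _ _ HG). destruct HG as [G1 G2].
apply hol_intro with (fun w => C_derive G w * C_derive F (G w))%C.
- assert (F3 := CG _ F1). unfold filtermap in F3.
  generalize (filter_and _ _ F3 G1). apply filter_imp.
  intros w [A B]. now apply cdiff_comp.
- apply continuous_Cmult; [exact G2|]. now apply (continuous_comp G (C_derive F)).
Qed.

Lemma hol_pow (F : C -> C) (n : nat) (u : C) : hol F u -> hol (fun w => F w ^ n)%C u.
Proof.
intros H. induction n as [|n IH]; [exact (hol_const 1 u)|].
apply (hol_mult F (fun w => F w ^ n)%C); assumption.
Qed.

(** * Complex power series *)

Lemma pow_n_Cpow (z : C) (k : nat) : @pow_n C_Ring z k = (z ^ k)%C.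
Proof. induction k as [|k IH]; [reflexivity|]. simpl. now rewrite IH. Qed.

Lemma C_scal_pow_n (z : C) (k : nat) (a : C) :
  @scal C_AbsRing C_NormedModule (@pow_n C_Ring z k) a = (z ^ k * a)%C.
Proof. now rewrite pow_n_Cpow. Qed.

Lemma C_series_bounded (a : nat -> C) (l : C) :
  Cseries a l ->
  exists M, forall n, Cmod (a n) <= M.
Proof.
intros H. destruct (filterlim_bounded (V := C_NormedModule) (sum_n a)) as [M HM].
{ exists l. exact H. }
exists (M + M). intros [|n].
- generalize (HM O). rewrite sum_O. change (norm (a O)) with (Cmod (a O)).
  generalize (Cmod_ge_0 (a O)). lra.
- replace (a (S n)) with (sum_n (G := C_NormedModule) a (S n) - sum_n (G := C_NormedModule) a n)%C.
  2: { rewrite sum_Sn. change (@plus C_NormedModule) with Cplus. ring. }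
  eapply Rle_trans; [apply Cmod_triangle|]. rewrite Cmod_opp.
  apply Rplus_le_compat; apply HM.
Qed.

Lemma C_series_Cmod_le (a : nat -> C) (b : nat -> R) (l : C) (B : R) :
  Cseries a l -> is_series b B ->
  (forall n, Cmod (a n) <= b n) -> Cmod l <= B.
Proof.
intros Ha Hb H.
apply (filterlim_le (F := eventually) (fun n => norm (sum_n (G := C_NormedModule) a n))
   (sum_n b) (norm (l : C_NormedModule)) B).
- apply filter_forall. intros n. unfold sum_n.
  eapply Rle_trans; [apply (norm_sum_n_m (V := C_NormedModule))|].
  apply sum_n_m_le. exact H.
- apply (filterlim_comp _ _ _ (sum_n (G := C_NormedModule) a) norm _ _ _ Ha).
  apply (filterlim_norm (V := C_NormedModule)).
- exact Hb.
Qed.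

(** Convergence at the midpoint of [x] and [r] bounds the terms there, so the series of moduli has
    at least that midpoint as its radius. *)
Lemma C_pseries_radius (a : nat -> C) (r x : R) :
  (forall h, Cmod h < r ->
     exists l, Cpseries a h l) ->
  0 <= x < r -> Rbar_lt (Rabs x) (CV_radius (fun k => Cmod (a k))).
Proof.
intros H Hx.
destruct (H (RtoC ((x + r) / 2))) as [l Hl].
{ rewrite Cmod_R, Rabs_pos_eq; lra. }
destruct (C_series_bounded _ _ Hl) as [M HM].
destruct (CV_radius_bounded (fun k => Cmod (a k))) as [U _].
apply Rbar_lt_le_trans with (Finite ((x + r) / 2)).
- simpl. rewrite Rabs_pos_eq; lra.
- apply (U ((x + r) / 2)). exists M. intros n. generalize (HM n).
  rewrite C_scal_pow_n, Cmod_mult, <- RtoC_pow, Cmod_R, Rabs_mult, (Rabs_pos_eq (Cmod _)) by apply Cmod_ge_0.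
  now rewrite Rmult_comm.
Qed.

(** The operator x d/dx multiplies the n-th coefficient by n and preserves the radius of
    convergence; it is applied twice. *)
Lemma ex_series_square_weight (A : nat -> R) (x : R) :
  0 <= x -> Rbar_lt (Rabs x) (CV_radius A) ->
  (forall n, 0 <= A n) ->
  ex_series (fun n => INR n ^ 2 * A n * x ^ n).
Proof.
intros Hx H HA.
rewrite <- CV_radius_derive, <- CV_radius_incr_1, <- CV_radius_derive, <- CV_radius_incr_1 in H.
apply CV_disk_inside in H. revert H. apply ex_series_ext. intros n.
destruct n as [|n]; simpl (PS_incr_1 _ _).
- simpl. change (@zero _) with 0. rewrite Rabs_pos_eq; lra.
- unfold PS_derive at 1. simpl (PS_incr_1 _ _). unfold PS_derive.
  rewrite Rabs_pos_eq; [match goal with |- @eq _ ?a ?b => change (@eq R a b) end; ring|].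
  repeat apply Rmult_le_pos; try apply pos_INR; try apply HA; try exact Hx. now apply pow_le.
Qed.

Lemma Cmod_pow_le (z : C) (x : R) (n : nat) : Cmod z <= x -> Cmod (z ^ n) <= x ^ n.
Proof.
intros H. rewrite Cmod_pow. apply pow_incr. split; [apply Cmod_ge_0|exact H].
Qed.

(** The Taylor remainder of a monomial, with m^2 in place of the sharp m(m-1)/2 and x^m / x^2 in
    place of x^(m-2): the bound is then a multiple of the summands of [ex_series_square_weight]. At
    m = 0 the exponent [pred 0] is harmless, being multiplied by [INR 0]. *)
Lemma pow_second_order (h k : C) (x : R) (m : nat) :
  0 < x -> Cmod h <= x -> Cmod k <= x ->
  Cmod (h ^ m - k ^ m - (h - k) * (INR m * k ^ pred m))
   <= INR m ^ 2 * x ^ m * (Cmod (h - k) ^ 2 / x ^ 2).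
Proof.
intros Hx Hh Hk.
set (D := Cmod (h - k) ^ 2 / x ^ 2).
assert (HD : 0 <= D).
{ apply Rmult_le_pos; [apply pow2_ge_0|]. left. apply Rinv_0_lt_compat, pow_lt, Hx. }
induction m as [|m IH].
- replace (h ^ 0 - k ^ 0 - (h - k) * (INR 0 * k ^ pred 0))%C with (RtoC 0) by (simpl; ring).
  rewrite Cmod_0. simpl. lra.
- replace (h ^ S m - k ^ S m - (h - k) * (INR (S m) * k ^ pred (S m)))%C
    with (h * (h ^ m - k ^ m - (h - k) * (INR m * k ^ pred m))
          + INR m * k ^ pred m * (h - k) ^ 2)%C.
  2: { rewrite S_INR, RtoC_plus. destruct m as [|m].
       - simpl. ring.
       - simpl pred. simpl (_ ^ _)%C. ring. }
  eapply Rle_trans; [apply Cmod_triangle|]. rewrite !Cmod_mult, (Cmod_pow (h - k)%C).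
  rewrite Cmod_R, (Rabs_pos_eq (INR m)) by apply pos_INR.
  assert (B1 : Cmod h * Cmod (h ^ m - k ^ m - (h - k) * (INR m * k ^ pred m))
     <= x * (INR m ^ 2 * x ^ m * D)).
  { apply Rmult_le_compat; try apply Cmod_ge_0; assumption. }
  assert (B2 : INR m * Cmod (k ^ pred m) * Cmod (h - k) ^ 2 <= INR m * (x * x ^ m) * D).
  { replace (Cmod (h - k) ^ 2) with (x ^ 2 * D) by (unfold D; field; lra).
    rewrite <- Rmult_assoc. apply Rmult_le_compat_r; [exact HD|].
    destruct m as [|m]; [simpl; lra|]. rewrite Rmult_assoc.
    apply Rmult_le_compat_l; [apply pos_INR|]. simpl pred.
    replace (x * x ^ S m) with (x ^ m * x ^ 2) by (simpl; ring).
    apply Rmult_le_compat_r; [apply pow2_ge_0|]. now apply Cmod_pow_le. }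
  eapply Rle_trans; [apply Rplus_le_compat; [exact B1|exact B2]|].
  rewrite S_INR. simpl (x ^ S m).
  assert (P : 0 <= x * x ^ m * D).
  { apply Rmult_le_pos; [|exact HD]. apply Rmult_le_pos; [lra|]. apply pow_le; lra. }
  assert (0 <= INR m) by apply pos_INR. nra.
Qed.

Definition PSC_derive (a : nat -> C) (k : nat) : C := (INR (S k) * a (S k))%C.

(** Summing [pow_second_order] over the terms bounds F w - F z - (w - z) l by a constant times |w -
    z|^2 on the disc of radius x, halfway between |z - z0| and r. The difference quotient, completed
    by l at z, is therefore continuous there and serves as the function demanded by [cdiff]. *)
Lemma C_pseries_cdiff (a : nat -> C) (r : R) (F : C -> C) (z0 z : C) :
  (forall w, Cmod (w - z0) < r ->
     Cpseries a (w - z0)%C (F w)) ->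
  Cmod (z - z0) < r ->
  exists l, Cpseries (PSC_derive a) (z - z0)%C l
    /\ cdiff F l z.
Proof.
intros HF Hz.
set (x := (Cmod (z - z0) + r) / 2).
assert (H0 := Cmod_ge_0 (z - z0)).
assert (Hx : 0 < x) by (unfold x; lra).
set (k := (z - z0)%C) in *.
assert (Hk : Cmod k < x) by (unfold x; lra).
set (A := fun m => Cmod (a m)).
assert (Sx : ex_series (fun m => INR m ^ 2 * A m * x ^ m)).
{ apply ex_series_square_weight.
  - lra.
  - apply C_pseries_radius with r; [|unfold x; lra].
    intros h Hh. exists (F (h + z0)%C).
    replace h with ((h + z0) - z0)%C at 1 by ring. apply HF.
    now replace ((h + z0) - z0)%C with h by ring.
  - intros n. apply Cmod_ge_0. }
(* The derived series is indexed from 0 with a vanishing first term, so that it lines up with the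
   series of F in the termwise estimate; the shift to [PSC_derive] is made afterwards. *)
assert (Sl : exists l : C, Cseries
   (fun m => (INR m * k ^ pred m * a m)%C) l).
{ apply (ex_series_le (K := C_AbsRing) (V := C_CompleteNormedModule)
   (fun m => (INR m * k ^ pred m * a m)%C) (fun m => / x * (INR m ^ 2 * A m * x ^ m))).
  2: { apply (ex_series_scal (V := R_NormedModule)). exact Sx. }
  intros m. change (Cmod (INR m * k ^ pred m * a m) <= / x * (INR m ^ 2 * A m * x ^ m)).
  rewrite !Cmod_mult, Cmod_R, Rabs_pos_eq by apply pos_INR. fold (A m).
  destruct m as [|m]; [simpl; lra|]. simpl pred.
  replace (/ x * (INR (S m) ^ 2 * A (S m) * x ^ S m))
    with (INR (S m) * (INR (S m) * x ^ m) * A (S m)) by (simpl; field; lra).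
  apply Rmult_le_compat_r; [apply Cmod_ge_0|].
  apply Rmult_le_compat_l; [apply pos_INR|].
  rewrite <- (Rmult_1_l (Cmod _)). apply Rmult_le_compat; try lra; try apply Cmod_ge_0.
  - rewrite S_INR. generalize (pos_INR m). lra.
  - apply Cmod_pow_le. lra. }
destruct Sl as [l Hl]. exists l. split.
- unfold is_pseries.
  apply (is_series_ext (V := C_NormedModule) (fun m => (INR (S m) * k ^ pred (S m) * a (S m))%C)).
  { intros m. simpl pred. unfold PSC_derive. rewrite C_scal_pow_n. C_eq. ring. }
  apply (is_series_incr_1 (V := C_NormedModule) (fun m => (INR m * k ^ pred m * a m)%C)).
  match goal with |- is_series _ ?y => replace y with l end; [exact Hl|].
  change (l = l + INR 0 * k ^ pred 0 * a O)%C. simpl. ring.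
- destruct Sx as [K HK].
  assert (HK0 : 0 <= K).
  { apply Rle_trans with (Cmod 0); [apply Cmod_ge_0|].
    apply C_series_Cmod_le with (a := fun _ => RtoC 0) (2 := HK).
    - apply (filterlim_ext (fun _ : nat => RtoC 0)); [|apply filterlim_const].
      intros n. induction n as [|n IH]; [now rewrite sum_O|].
      rewrite sum_Sn, <- IH. change (RtoC 0 = 0 + 0)%C. ring.
    - intros n. rewrite Cmod_0. apply Rmult_le_pos; [apply Rmult_le_pos|apply pow_le; lra].
      + apply pow2_ge_0. + apply Cmod_ge_0. }
  assert (E : forall w, Cmod (w - z0) <= x ->
     Cmod (F w - F z - (w - z) * l) <= K / x ^ 2 * Cmod (w - z) ^ 2).
  { intros w Hw.
    assert (Hw' : Cmod (w - z0) < r) by (unfold x in Hw; lra).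
    assert (S1 := is_series_minus (V := C_NormedModule) _ _ _ _ (HF w Hw') (HF z Hz)).
    assert (S2 := is_series_scal (V := C_NormedModule) ((w - z)%C : C_AbsRing) _ _ Hl).
    assert (S3 := is_series_minus (V := C_NormedModule) _ _ _ _ S1 S2).
    assert (S4 := is_series_scal (V := R_NormedModule) (Cmod (w - z) ^ 2 / x ^ 2) _ _ HK).
    replace (K / x ^ 2 * Cmod (w - z) ^ 2) with (Cmod (w - z) ^ 2 / x ^ 2 * K) by (field; lra).
    refine (C_series_Cmod_le _ _ _ _ S3 S4 _).
    intros m. rewrite (C_scal_pow_n (w - z0)), (C_scal_pow_n k).
    change (@scal C_AbsRing C_NormedModule) with Cmult.
    change (@plus C_NormedModule) with Cplus. change (@opp C_NormedModule) with Copp.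
    change (@scal R_AbsRing R_NormedModule) with Rmult.
    fold k. set (h := (w - z0)%C) in *.
    replace (w - z)%C with (h - k)%C by (unfold h, k; ring).
    match goal with |- Cmod ?y <= _ => replace y with
       ((h ^ m - k ^ m - (h - k) * (INR m * k ^ pred m)) * a m)%C by ring end.
    rewrite Cmod_mult. fold (A m).
    replace (Cmod (h - k) ^ 2 / x ^ 2 * (INR m ^ 2 * A m * x ^ m))
      with ((INR m ^ 2 * x ^ m * (Cmod (h - k) ^ 2 / x ^ 2)) * A m) by ring.
    apply Rmult_le_compat_r; [apply Cmod_ge_0|].
    apply pow_second_order; lra. }
  exists (fun w => if Ceq_dec w z then l else ((F w - F z) / (w - z))%C).
  assert (Qz : (if Ceq_dec z z then l else ((F z - F z) / (z - z))%C) = l).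
  { destruct (Ceq_dec z z) as [_|N]; [reflexivity|now contradict N]. }
  split; [|split; [exact Qz|]].
  + apply continuous_C_eps. rewrite Qz. intros eps.
    set (c := K / x ^ 2).
    assert (Hc : 0 <= c).
    { apply Rmult_le_pos; [exact HK0|]. left. apply Rinv_0_lt_compat, pow_lt, Hx. }
    assert (Hd : 0 < Rmin (x - Cmod k) (eps / (c + 1))).
    { apply Rmin_pos; [lra|]. apply Rdiv_lt_0_compat; [apply cond_pos|lra]. }
    exists (mkposreal _ Hd). simpl. intros w Hw.
    assert (Hw1 := Rlt_le_trans _ _ _ Hw (Rmin_l _ _)).
    assert (Hw2 := Rlt_le_trans _ _ _ Hw (Rmin_r _ _)).
    destruct (Ceq_dec w z) as [Ew|N].
    { replace (l - l)%C with (RtoC 0) by ring. rewrite Cmod_0. apply cond_pos. }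
    assert (N' : (w - z)%C <> 0) by (intros Q; apply N; now apply Ceq_minus).
    assert (P : 0 < Cmod (w - z)) by now apply Cmod_gt_0.
    replace ((F w - F z) / (w - z) - l)%C with ((F w - F z - (w - z) * l) / (w - z))%C
      by now field.
    rewrite Cmod_div by exact N'.
    assert (Hx0 : Cmod (w - z0) <= x).
    { replace (w - z0)%C with ((w - z) + k)%C by (unfold k; ring).
      generalize (Cmod_triangle (w - z) k). lra. }
    apply Rle_lt_trans with (c * Cmod (w - z)).
    * apply Rmult_le_reg_r with (Cmod (w - z)); [exact P|].
      unfold Rdiv. rewrite Rmult_assoc, Rinv_l, Rmult_1_r by lra.
      generalize (E w Hx0). fold c. simpl. lra.
    * apply Rle_lt_trans with (c * (eps / (c + 1))).
      { apply Rmult_le_compat_l; lra. }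
      apply Rmult_lt_reg_r with (c + 1); [lra|].
      replace (c * (eps / (c + 1)) * (c + 1)) with (c * eps) by (field; lra).
      generalize (cond_pos eps). nra.
  + apply filter_forall. intros w.
    destruct (Ceq_dec w z) as [->|N].
    * assert (K0 : forall p q : C, (p = p + (q - q) * l)%C) by (intros; ring). apply K0.
    * assert (N' : (w - z)%C <> 0) by (intros Q; apply N; now apply Ceq_minus).
      assert (K0 : forall p q d : C, d <> 0 -> (p = q + d * ((p - q) / d))%C)
        by (intros; now field).
      now apply K0.
Qed.

Lemma C_pseries_derive (a : nat -> C) (r : R) (F : C -> C) (z0 : C) :
  (forall w, Cmod (w - z0) < r ->
     Cpseries a (w - z0)%C (F w)) ->
  (forall w, Cmod (w - z0) < r -> cdiff F (C_derive F w) w) /\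
  (forall w, Cmod (w - z0) < r ->
     Cpseries (PSC_derive a) (w - z0)%C
       (C_derive F w)).
Proof.
intros H. split; intros w Hw; destruct (C_pseries_cdiff a r F z0 w H Hw) as (l & H1 & H2);
 now rewrite (cdiff_C_derive _ _ _ H2).
Qed.

Lemma C_pseries_hol (a : nat -> C) (r : R) (F : C -> C) (z0 z : C) :
  (forall w, Cmod (w - z0) < r ->
     Cpseries a (w - z0)%C (F w)) ->
  Cmod (z - z0) < r -> hol F z.
Proof.
intros H Hz. destruct (C_pseries_derive a r F z0 H) as [H1 H2].
destruct (C_pseries_derive _ r _ z0 H2) as [H3 _].
split.
- generalize (locally_Cmod_ball _ _ _ Hz). apply filter_imp. exact H1.
- apply cdiff_continuous with (1 := H3 z Hz).
Qed.

Lemma C_derive_n_pseries (a : nat -> C) (r : R) (F : C -> C) (z0 : C) (i : nat) :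
  (forall w, Cmod (w - z0) < r ->
     Cpseries a (w - z0)%C (F w)) ->
  forall w, Cmod (w - z0) < r ->
   Cpseries
     (fun k => (INR (fact (k + i)) / INR (fact k)) * a (k + i)%nat)%C (w - z0)%C
     (C_derive_n F i w).
Proof.
intros H. induction i as [|i IH]; intros w Hw.
- refine (is_pseries_ext _ _ _ _ _ (H w Hw)). intros k.
  rewrite Nat.add_0_r. C_eq. field. apply RtoC_neq_0, INR_fact_neq_0.
- destruct (C_pseries_derive _ r _ z0 IH) as [_ H2].
  refine (is_pseries_ext _ _ _ _ _ (H2 w Hw)). intros k. unfold PSC_derive.
  replace (k + S i)%nat with (S k + i)%nat by lia.
  change (fact (S k)) with (S k * fact k)%nat. rewrite mult_INR, RtoC_mult.
  C_eq. field. split; apply RtoC_neq_0; [apply INR_fact_neq_0|apply not_0_INR; lia].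
Qed.

Lemma C_pseries_at_center (a : nat -> C) (r : R) (F : C -> C) (z0 : C) :
  (forall w, Cmod (w - z0) < r ->
     Cpseries a (w - z0)%C (F w)) ->
  0 < r -> F z0 = a O.
Proof.
intros H Hr.
assert (Z : Cmod (z0 - z0) < r) by (replace (z0 - z0)%C with (RtoC 0) by ring; now rewrite Cmod_0).
specialize (H z0 Z).
replace (z0 - z0)%C with (@zero C_AbsRing) in H by (change (RtoC 0 = z0 - z0)%C; ring).
exact (filterlim_locally_unique _ _ _ H (is_pseries_0 (K := C_AbsRing) (V := C_NormedModule) a)).
Qed.

Lemma C_derive_n_center (a : nat -> C) (r : R) (F : C -> C) (z0 : C) (i : nat) :
  (forall w, Cmod (w - z0) < r ->
     Cpseries a (w - z0)%C (F w)) ->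
  0 < r -> C_derive_n F i z0 = (INR (fact i) * a i)%C.
Proof.
intros H Hr.
rewrite (C_pseries_at_center _ r _ z0 (C_derive_n_pseries a r F z0 i H) Hr).
simpl. field.
Qed.

(** * Circle means *)

Notation CRInt := (@RInt C_R_CompleteNormedModule).
Notation is_CRInt := (@is_RInt C_R_NormedModule).

Definition cis (t : R) : C := (cos t, sin t).
Definition polar (r t : R) : C := (r * cis t)%C.

Lemma polar_pair (r t : R) : polar r t = (r * cos t, r * sin t).
Proof. unfold polar, cis, Cmult, RtoC. simpl. f_equal; ring. Qed.

Lemma Cmod_cis (t : R) : Cmod (cis t) = 1.
Proof.
unfold Cmod, cis. simpl. transitivity (sqrt 1); [f_equal|apply sqrt_1].
generalize (sin2_cos2 t). unfold Rsqr. lra.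
Qed.

Lemma Cmod_polar (r t : R) : 0 <= r -> Cmod (polar r t) = r.
Proof. intros H. unfold polar. rewrite Cmod_mult, Cmod_cis, Cmod_R, Rabs_pos_eq; lra. Qed.

(** In Caratheodory's form the increment of F is a vanishing factor times a function that is only
    continuous, so the usual product rule does not apply. *)
Lemma is_derive_mult_vanish (a q : R -> R) (t a' : R) :
  is_derive a t a' -> a t = 0 -> continuous q t ->
  is_derive (fun s => a s * q s) t (a' * q t).
Proof.
intros Ha Ha0 Hq.
apply is_derive_Reals. apply is_derive_Reals in Ha.
assert (La : is_lim (fun h => (a (t + h) - a t) / h) 0 a').
{ apply is_lim_spec. intros eps. destruct (Ha eps (cond_pos eps)) as [d Hd].
  exists d. intros h Hh Hn. apply Hd; [exact Hn|].
  replace h with (minus h 0) by (unfold minus, plus, opp; simpl; ring). exact Hh. }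
assert (Lq : is_lim (fun h => q (t + h)) 0 (q t)).
{ apply (is_lim_ext (fun h => q (h + t))); [intros; f_equal; ring|].
  replace (q t) with (q (0 + t)) by (f_equal; ring).
  apply (is_lim_continuity (fun h => q (h + t))), continuity_pt_filterlim.
  apply (continuous_comp (fun h => h + t) q).
  - apply (continuous_plus (V := R_NormedModule)); [apply continuous_id|apply continuous_const].
  - now rewrite Rplus_0_l. }
assert (L := is_lim_mult _ _ _ _ _ La Lq). specialize (L I). simpl in L.
apply is_lim_spec in L. intros eps Heps. destruct (L (mkposreal eps Heps)) as [d Hd].
exists d. intros h Hn Hh.
assert (B : ball 0 d h).
{ change (Rabs (h - 0) < d). now rewrite Rminus_0_r. }
generalize (Hd h B Hn). simpl. rewrite Ha0.
replace ((a (t + h) * q (t + h) - 0 * q t) / h) with ((a (t + h) - 0) / h * q (t + h))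
  by (field; exact Hn).
exact (fun H => H).
Qed.

(** Real parts suffice: multiplying F by -i, that is by [(0, -1)], turns its imaginary part into a
    real part. *)
Lemma is_derive_Re_curve (F : C -> C) (g : R -> C) (t : R) (l g' : C) :
  cdiff F l (g t) ->
  is_derive (fun s => Re (g s)) t (Re g') -> is_derive (fun s => Im (g s)) t (Im g') ->
  is_derive (fun s => Re (F (g s))) t (Re (l * g')%C).
Proof.
intros (Q & HQ & El & HF) H1 H2.
assert (Cg : continuousC g t).
{ apply continuous_C_pair.
  - apply (ex_derive_continuous (V := R_NormedModule) (fun s => Re (g s))). eexists; exact H1.
  - apply (ex_derive_continuous (V := R_NormedModule) (fun s => Im (g s))). eexists; exact H2. }
assert (CQ : continuousC (fun s => Q (g s)) t)
  by now apply (continuous_comp g Q).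
apply is_derive_ext_loc with (f := fun s => Re (F (g t)) +
   ((Re (g s) - Re (g t)) * Re (Q (g s)) - (Im (g s) - Im (g t)) * Im (Q (g s)))).
{ assert (HF' := Cg _ HF). unfold filtermap in HF'. revert HF'. apply filter_imp.
  intros s ->. reflexivity. }
replace (Re (l * g')%C) with (0 + (Re g' * Re (Q (g t)) - Im g' * Im (Q (g t))))
  by (rewrite El; simpl; unfold Re, Im; ring).
apply (is_derive_plus (V := R_NormedModule)); [exact (is_derive_const (V := R_NormedModule) _ t)|].
apply (is_derive_minus (V := R_NormedModule)).
- apply (is_derive_mult_vanish (fun s => Re (g s) - Re (g t)) (fun s => Re (Q (g s)))).
  + replace (Re g') with (Re g' - 0) by ring.
    apply (is_derive_minus (V := R_NormedModule)); [exact H1|exact (is_derive_const (V := R_NormedModule) _ t)].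
  + ring.
  + now apply continuous_Re.
- apply (is_derive_mult_vanish (fun s => Im (g s) - Im (g t)) (fun s => Im (Q (g s)))).
  + replace (Im g') with (Im g' - 0) by ring.
    apply (is_derive_minus (V := R_NormedModule)); [exact H2|exact (is_derive_const (V := R_NormedModule) _ t)].
  + ring.
  + now apply continuous_Im.
Qed.

Lemma continuous_polar2 (r t : R) :
  R2continuousC
    (fun p => polar (fst p) (snd p)) (r, t).
Proof.
apply continuous_ext with (f := fun p => (fst p * cos (snd p), fst p * sin (snd p))).
{ intros p. now rewrite polar_pair. }
apply continuous_C_pair.
- apply (continuous_mult (K := R_AbsRing)
    (fun p : R * R => fst p) (fun p : R * R => cos (snd p))); [apply continuous_fst|].
  apply (continuous_comp snd cos); [apply continuous_snd|apply continuous_cos].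
- apply (continuous_mult (K := R_AbsRing)
    (fun p : R * R => fst p) (fun p : R * R => sin (snd p))); [apply continuous_fst|].
  apply (continuous_comp snd sin); [apply continuous_snd|apply continuous_sin].
Qed.

Lemma continuous_cis (t : R) : continuousC cis t.
Proof. apply continuous_C_pair; [apply continuous_cos|apply continuous_sin]. Qed.

Lemma continuous_polar (r t : R) : continuousC (polar r) t.
Proof.
apply continuous_Cmult; [apply continuous_const|apply continuous_cis].
Qed.

Lemma is_derive_radius (F : C -> C) (r t : R) (l : C) :
  cdiff F l (polar r t) ->
  is_derive (fun x => Re (F (polar x t))) r (Re (l * cis t)%C).
Proof.
intros H. apply (is_derive_Re_curve F (fun x => polar x t)); [exact H| |].
- apply is_derive_ext with (f := fun x => x * cos t).
  { intros x. now rewrite polar_pair. }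
  simpl. auto_derive; [easy|ring].
- apply is_derive_ext with (f := fun x => x * sin t).
  { intros x. now rewrite polar_pair. }
  simpl. auto_derive; [easy|ring].
Qed.

Lemma is_derive_angle (F : C -> C) (r t : R) (l : C) :
  cdiff F l (polar r t) ->
  is_derive (fun x => Re (F (polar r x))) t (Re (l * ((r * - sin t)%R, (r * cos t)%R))%C).
Proof.
intros H. apply (is_derive_Re_curve F (fun x => polar r x)); [exact H| |].
- apply is_derive_ext with (f := fun x => r * cos x).
  { intros x. now rewrite polar_pair. }
  simpl. auto_derive; [easy|ring].
- apply is_derive_ext with (f := fun x => r * sin x).
  { intros x. now rewrite polar_pair. }
  simpl. auto_derive; [easy|ring].
Qed.

(* By the polar Cauchy-Riemann equations the radial derivative of Re F is 1/r times
   the angular derivative of Im F, whose integral over a full turn vanishes. *)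
Lemma circle_mean_Re_const (F : C -> C) (a b : R) :
  0 <= a -> (forall u, a < Cmod u < b -> hol F u) ->
  forall r1 r2, a < r1 -> r1 < r2 -> r2 < b ->
  RInt (fun t => Re (F (polar r1 t))) 0 (2 * PI) =
  RInt (fun t => Re (F (polar r2 t))) 0 (2 * PI).
Proof.
intros Ha HF r1 r2 H1 H12 H2.
apply (eq_is_derive (fun r => RInt (fun t => Re (F (polar r t))) 0 (2 * PI)) r1 r2);
  [|exact H12].
intros r Hr.
assert (Hol : forall x t, a < x < b -> hol F (polar x t)).
{ intros x t Hx. apply HF. rewrite Cmod_polar; lra. }
assert (D : forall x t, a < x < b ->
   Derive (fun z => Re (F (polar z t))) x = Re (C_derive F (polar x t) * cis t)%C).
{ intros x t Hx. apply is_derive_unique, is_derive_radius, hol_cdiff, Hol, Hx. }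
assert (Loc : locally r (fun x => a < x < b)).
{ apply (open_and (fun x => a < x) (fun x => x < b)); [apply open_gt|apply open_lt|lra]. }
assert (CD : forall t, continuity_2d_pt (fun u v => Derive (fun z => Re (F (polar z v))) u) r t).
{ intros t.
  apply continuity_2d_pt_ext_loc with
    (f := fun u v => Re (C_derive F (polar u v) * cis v)%C).
  - apply locally_2d_locally.
    assert (Cf := continuous_fst (U := R_UniformSpace) (V := R_UniformSpace) r t).
    assert (L := Cf _ Loc). unfold filtermap in L. revert L. apply filter_imp.
    intros [u v] Huv. symmetry. apply D. exact Huv.
  - apply continuity_2d_pt_filterlim.
    apply (continuous_Re (T := R2)
      (fun z => C_derive F (polar (fst z) (snd z)) * cis (snd z))%C (r, t)).
    apply continuous_Cmult.
    + apply (continuous_comp (fun z => polar (fst z) (snd z)) (C_derive F)).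
      * apply continuous_polar2.
      * apply (proj2 (Hol r t ltac:(lra))).
    + apply (continuous_comp snd cis); [apply continuous_snd|apply continuous_cis]. }
evar_last.
- apply (is_derive_RInt_param (fun x t => Re (F (polar x t))) 0 (2 * PI) r).
  + revert Loc. apply filter_imp. intros x Hx t _.
    eexists. apply is_derive_radius, hol_cdiff, Hol, Hx.
  + intros t _. apply CD.
  + revert Loc. apply filter_imp. intros x Hx.
    apply (ex_RInt_continuous (V := R_CompleteNormedModule)). intros t _.
    apply continuous_Re. apply (continuous_comp (polar x) F); [apply continuous_polar|].
    apply hol_continuous, Hol, Hx.
- set (G := fun w => ((0, -1) * F w)%C).
  assert (DG : forall t, is_derive (fun v => Re (G (polar r v)) * / r) t
     (Derive (fun u => Re (F (polar u t))) r)).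
  { intros t. rewrite D by lra.
    assert (K : cdiff G (0 * F (polar r t) + (0, -1) * C_derive F (polar r t))%C (polar r t)).
    { apply (cdiff_mult (fun _ => (0, -1))); [apply cdiff_const|].
      apply hol_cdiff, Hol. lra. }
    apply is_derive_angle in K.
    evar_last; [apply (is_derive_scal_l _ _ _ (/ r) K)|].
    unfold scal; simpl; unfold mult; simpl.
    field. lra. }
  assert (Z : minus (Re (G (polar r (2 * PI))) * / r) (Re (G (polar r 0)) * / r) = zero).
  { rewrite !polar_pair, cos_2PI, sin_2PI, cos_0, sin_0.
    unfold minus, plus, opp, zero; simpl. ring. }
  refine (eq_trans (is_RInt_unique (V := R_CompleteNormedModule) _ _ _ _ _) Z).
  apply (is_RInt_derive (V := R_CompleteNormedModule) (fun v => Re (G (polar r v)) * / r)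
     (fun t => Derive (fun u => Re (F (polar u t))) r)).
  + intros t _. apply DG.
  + intros t _.
    apply (continuous_comp (fun v => (r, v) : R2)
      (fun z => Derive (fun u => Re (F (polar u (snd z)))) (fst z))).
    * intros P [d Hd]. exists d. intros v Hv. apply Hd.
      split; [apply ball_center|exact Hv].
    * exact (proj1 (continuity_2d_pt_filterlim
        (fun u v => Derive (fun z => Re (F (polar z v))) u) r t) (CD t)).
Qed.

(** * Integrals of complex functions of a real variable *)

Lemma is_CRInt_pair (g : R -> C) (a b x y : R) :
  is_RInt (fun t => Re (g t)) a b x -> is_RInt (fun t => Im (g t)) a b y ->
  is_CRInt g a b (x, y).
Proof. apply (is_RInt_fct_extend_pair (U := R_NormedModule) (V := R_NormedModule) g). Qed.

Lemma is_CRInt_Re (g : R -> C) (a b : R) (l : C) :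
  is_CRInt g a b l -> is_RInt (fun t => Re (g t)) a b (Re l).
Proof. apply (is_RInt_fct_extend_fst (U := R_NormedModule) (V := R_NormedModule) g). Qed.

Lemma is_CRInt_Im (g : R -> C) (a b : R) (l : C) :
  is_CRInt g a b l -> is_RInt (fun t => Im (g t)) a b (Im l).
Proof. apply (is_RInt_fct_extend_snd (U := R_NormedModule) (V := R_NormedModule) g). Qed.

Lemma is_CRInt_correct (g : R -> C) (a b : R) :
  (forall t, continuousC g t) -> is_CRInt g a b (CRInt g a b).
Proof.
intros H. apply (RInt_correct (V := C_R_CompleteNormedModule)).
apply (ex_RInt_continuous (V := C_R_CompleteNormedModule)). intros t _. apply H.
Qed.

Lemma is_CRInt_unique (g : R -> C) (a b : R) (l : C) : is_CRInt g a b l -> CRInt g a b = l.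
Proof. apply (is_RInt_unique (V := C_R_CompleteNormedModule)). Qed.

Lemma CRInt_ext (f g : R -> C) (a b : R) :
  (forall t, f t = g t) -> CRInt f a b = CRInt g a b.
Proof. intros H. apply (RInt_ext (V := C_R_CompleteNormedModule)). intros t _. apply H. Qed.

Lemma CRInt_pair (g : R -> C) (a b : R) :
  (forall t, continuousC g t) ->
  CRInt g a b = (RInt (fun t => Re (g t)) a b, RInt (fun t => Im (g t)) a b).
Proof.
intros H. apply is_CRInt_unique. assert (I := is_CRInt_correct g a b H).
apply is_CRInt_pair; apply (RInt_correct (V := R_CompleteNormedModule)); eexists.
- exact (is_CRInt_Re _ _ _ _ I).
- exact (is_CRInt_Im _ _ _ _ I).
Qed.

Lemma CRInt_RtoC (g : R -> R) (a b : R) :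
  (forall t, continuous g t) -> CRInt (fun t => RtoC (g t)) a b = RtoC (RInt g a b).
Proof.
intros H. rewrite CRInt_pair by (intros t; apply continuous_RtoC, H).
unfold RtoC. f_equal. simpl. rewrite RInt_const. unfold scal; simpl; unfold mult; simpl. ring.
Qed.

Lemma is_CRInt_Cmult (c : C) (g : R -> C) (a b : R) (l : C) :
  is_CRInt g a b l -> is_CRInt (fun t => c * g t)%C a b (c * l)%C.
Proof.
intros H. assert (H1 := is_CRInt_Re _ _ _ _ H). assert (H2 := is_CRInt_Im _ _ _ _ H).
apply is_CRInt_pair.
- apply (is_RInt_minus (V := R_NormedModule) (fun t => Re c * Re (g t)) (fun t => Im c * Im (g t)));
  apply (is_RInt_scal (V := R_NormedModule)); assumption.
- apply (is_RInt_plus (V := R_NormedModule) (fun t => Re c * Im (g t)) (fun t => Im c * Re (g t)));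
  apply (is_RInt_scal (V := R_NormedModule)); assumption.
Qed.

Lemma CRInt_Cmult (c : C) (g : R -> C) (a b : R) :
  (forall t, continuousC g t) ->
  CRInt (fun t => c * g t)%C a b = (c * CRInt g a b)%C.
Proof. intros H. now apply is_CRInt_unique, is_CRInt_Cmult, is_CRInt_correct. Qed.

Lemma CRInt_plus (f g : R -> C) (a b : R) :
  (forall t, continuousC f t) ->
  (forall t, continuousC g t) ->
  CRInt (fun t => f t + g t)%C a b = (CRInt f a b + CRInt g a b)%C.
Proof.
intros Hf Hg. apply is_CRInt_unique.
apply (is_RInt_plus (V := C_R_NormedModule)); now apply is_CRInt_correct.
Qed.

Lemma CRInt_minus (f g : R -> C) (a b : R) :
  (forall t, continuousC f t) ->
  (forall t, continuousC g t) ->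
  CRInt (fun t => f t - g t)%C a b = (CRInt f a b - CRInt g a b)%C.
Proof.
intros Hf Hg. apply is_CRInt_unique.
apply (is_RInt_minus (V := C_R_NormedModule)); now apply is_CRInt_correct.
Qed.

Lemma continuous_sum_n_C {T : UniformSpace} (f : nat -> T -> C) (n : nat) (x : T) :
  (forall k, continuousC (f k) x) ->
  continuousC (fun t => Csum_n (fun k => f k t) n) x.
Proof.
intros H. induction n as [|n IH].
- apply continuous_ext with (f O); [intros t; now rewrite sum_O|apply H].
- apply continuous_ext with (fun t => Csum_n (fun k => f k t) n + f (S n) t)%C.
  + intros t. now rewrite sum_Sn.
  + apply continuous_Cplus; [exact IH|apply H].
Qed.

Lemma CRInt_sum_n (f : nat -> R -> C) (n : nat) (a b : R) :
  (forall k t, continuousC (f k) t) ->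
  CRInt (fun t => Csum_n (fun k => f k t) n) a b =
  Csum_n (fun k => CRInt (f k) a b) n.
Proof.
intros H. induction n as [|n IH].
- rewrite sum_O. apply CRInt_ext. intros t. now rewrite sum_O.
- rewrite sum_Sn, <- IH, <- CRInt_plus.
  + apply CRInt_ext. intros t. now rewrite sum_Sn.
  + intros t. apply (continuous_sum_n_C f). intros k. apply H.
  + apply H.
Qed.

Lemma norm_C_R (z : C) : @norm R_AbsRing C_R_NormedModule z = Cmod z.
Proof.
unfold norm; simpl. unfold prod_norm, norm; simpl. unfold abs; simpl. unfold Cmod.
f_equal. destruct z as [x y]. simpl. rewrite !Rmult_1_r.
rewrite <- !Rabs_mult, !Rabs_pos_eq by apply Rle_0_sqr. reflexivity.
Qed.

Lemma Cmod_CRInt_le (g : R -> C) (a b : R) :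
  a <= b -> (forall t, continuousC g t) ->
  Cmod (CRInt g a b) <= RInt (fun t => Cmod (g t)) a b.
Proof.
intros Hab H.
rewrite <- norm_C_R. apply (norm_RInt_le (V := C_R_NormedModule) g (fun t => Cmod (g t)) a b).
- exact Hab.
- intros t _. apply Req_le, norm_C_R.
- now apply is_CRInt_correct.
- apply (RInt_correct (V := R_CompleteNormedModule)).
  apply (ex_RInt_continuous (V := R_CompleteNormedModule)).
  intros t _. apply continuous_Cmod, H.
Qed.

Lemma circle_mean_const (F : C -> C) (a b : R) :
  0 <= a -> (forall u, a < Cmod u < b -> hol F u) ->
  forall r1 r2, a < r1 -> r1 < r2 -> r2 < b ->
  CRInt (fun t => F (polar r1 t)) 0 (2 * PI) = CRInt (fun t => F (polar r2 t)) 0 (2 * PI).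
Proof.
intros Ha HF r1 r2 H1 H12 H2.
assert (HC : forall r t, a < r < b -> continuousC (fun t => F (polar r t)) t).
{ intros r t Hr. apply (continuous_comp (polar r) F); [apply continuous_polar|].
  apply hol_continuous, HF. rewrite Cmod_polar; lra. }
rewrite !CRInt_pair by (intros t; apply HC; lra).
f_equal; [now apply circle_mean_Re_const with a b|].
set (G := fun w => ((0, -1) * F w)%C).
assert (E : forall r, RInt (fun t => Im (F (polar r t))) 0 (2 * PI) =
   RInt (fun t => Re (G (polar r t))) 0 (2 * PI)).
{ intros r. apply RInt_ext. intros t _. unfold G. simpl. unfold Im. R_eq. ring. }
rewrite !E. apply circle_mean_Re_const with a b; try assumption.
intros u Hu. apply (hol_mult (fun _ => (0, -1))); [apply hol_const|now apply HF].
Qed.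

(** * Chebyshev-weighted integrals *)

Lemma acos_at_right : filterlim acos (at_right (-1)) (locally PI).
Proof.
intros P [d Hd]. assert (HPI := PI_RGT_0).
set (e := Rmin d PI).
assert (He : 0 < e) by (apply Rmin_pos; [apply cond_pos|lra]).
assert (He1 : e <= d) by apply Rmin_l. assert (He2 : e <= PI) by apply Rmin_r.
assert (Hc : 0 < cos (PI - e) - -1).
{ rewrite <- cos_PI. assert (cos PI < cos (PI - e)) by (apply cos_decreasing_1; lra). lra. }
exists (mkposreal _ Hc). intros x Hx Hx1. simpl in Hx.
apply Hd. change (Rabs (acos x - PI) < d).
assert (B := acos_bound x).
assert (Hx' : x - -1 < cos (PI - e) - -1) by exact (Rle_lt_trans _ _ _ (Rle_abs _) Hx).
assert (COS := COS_bound (PI - e)).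
assert (PI - e < acos x).
{ apply cos_decreasing_0; try lra. rewrite cos_acos; lra. }
rewrite Rabs_left1; lra.
Qed.

Lemma acos_at_left : filterlim acos (at_left 1) (locally 0).
Proof.
intros P [d Hd]. assert (HPI := PI_RGT_0).
set (e := Rmin d PI).
assert (He : 0 < e) by (apply Rmin_pos; [apply cond_pos|lra]).
assert (He1 : e <= d) by apply Rmin_l. assert (He2 : e <= PI) by apply Rmin_r.
assert (Hc : 0 < 1 - cos e).
{ rewrite <- cos_0 at 1. assert (cos e < cos 0) by (apply cos_decreasing_1; lra). lra. }
exists (mkposreal _ Hc). intros x Hx Hx1. simpl in Hx.
apply Hd. change (Rabs (acos x - 0) < d).
assert (B := acos_bound x).
assert (Hx' : 1 - x < 1 - cos e).
{ apply Rle_lt_trans with (2 := Hx). rewrite <- Rabs_Ropp.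
  eapply Rle_trans; [|apply Rle_abs]. apply Req_le. change (1 - x = - (x - 1)). ring. }
assert (COS := COS_bound e).
assert (acos x < e).
{ apply cos_decreasing_0; try lra. rewrite cos_acos; lra. }
rewrite Rabs_pos_eq; lra.
Qed.

Lemma is_derive_acos (x : R) : -1 < x < 1 -> is_derive acos x (- / sqrt (1 - x ^ 2)).
Proof.
intros Hx. apply is_derive_Reals.
replace (- / sqrt (1 - x ^ 2)) with (derive_pt acos x (derivable_pt_acos x Hx)).
- apply derive_pt_eq_1 with (derivable_pt_acos x Hx). reflexivity.
- rewrite derive_pt_acos. replace (1 - x ^ 2) with (1 - x²) by (unfold Rsqr; ring).
  unfold Rdiv. ring.
Qed.

Lemma continuous_weight (x : R) :
  -1 < x < 1 -> continuous (fun t => - / sqrt (1 - t ^ 2)) x.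
Proof.
intros Hx. apply (ex_derive_continuous (V := R_NormedModule)).
assert (0 < 1 - x ^ 2) by nra.
auto_derive. split; [|split; [|easy]].
- replace (1 + - (x * (x * 1))) with (1 - x ^ 2) by ring. lra.
- apply Rgt_not_eq, sqrt_lt_R0.
  replace (1 + - (x * (x * 1))) with (1 - x ^ 2) by ring. lra.
Qed.

(** The weight is minus the derivative of acos, so on compact subintervals of (-1, 1) this is the
    substitution p = acos t. The improper limit is the continuity of the transformed integral in
    both of its bounds at (pi, 0), and acos, being decreasing, swaps them. A general module covers
    [wint] and [wintC] at once. *)
Lemma is_RInt_gen_cheb_weight {V : CompleteNormedModule R_AbsRing} (g : R -> V) :
  (forall t, -1 <= t <= 1 -> continuous g t) ->
  is_RInt_gen (fun t => scal (/ sqrt (1 - t ^ 2)) (g t)) (at_right (-1)) (at_left 1)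
    (RInt (fun p => g (cos p)) 0 PI).
Proof.
intros Hg.
set (h := fun p => g (cos p)).
assert (Hh : forall p, continuous h p).
{ intros p. apply (continuous_comp cos g); [apply continuous_cos|apply Hg, COS_bound]. }
assert (Ih : forall a b, is_RInt h a b (RInt h a b)).
{ intros a b. apply (RInt_correct (V := V)), ex_RInt_continuous. intros p _. apply Hh. }
assert (Sub : forall a b, -1 < a < 1 -> -1 < b < 1 ->
  is_RInt (fun t => scal (/ sqrt (1 - t ^ 2)) (g t)) a b (opp (RInt h (acos a) (acos b)))).
{ intros a b Ha Hb.
  assert (Hab : forall x, Rmin a b <= x <= Rmax a b -> -1 < x < 1).
  { intros x. unfold Rmin, Rmax. destruct (Rle_dec a b); lra. }
  apply is_RInt_ext with (fun t => opp (scal (- / sqrt (1 - t ^ 2)) (h (acos t)))).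
  - intros x Hx. unfold h. rewrite cos_acos.
    + rewrite <- scal_opp_l. f_equal. unfold opp; simpl. ring.
    + assert (Hx' := Hab x). lra.
  - apply (is_RInt_opp (V := V)).
    apply (is_RInt_comp h acos (fun t => - / sqrt (1 - t ^ 2))).
    + intros x _. apply Hh.
    + intros x Hx. apply Hab in Hx. split; [now apply is_derive_acos|now apply continuous_weight]. }
assert (Lim : continuous (fun z : R * R => opp (RInt h (fst z) (snd z))) (PI, 0)).
{ apply (continuous_opp (V := V) (fun z : R * R => RInt h (fst z) (snd z))).
  apply (continuous_RInt h PI 0 (fun x y => RInt h x y)).
  apply filter_forall. intros z. apply Ih. }
intros P HP.
replace (RInt h 0 PI) with (opp (RInt h PI 0)) in HP
  by (apply (opp_RInt_swap (V := V)); eexists; apply Ih).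
destruct (Lim P HP) as [d Hd].
assert (HA := acos_at_right _ (locally_ball PI d)).
assert (HB := acos_at_left _ (locally_ball 0 d)).
apply Filter_prod with (Q := fun a => (-1 < a < 1) /\ ball PI d (acos a))
   (R := fun b => (-1 < b < 1) /\ ball 0 d (acos b)).
- apply filter_and; [|exact HA].
  exists (mkposreal 2 ltac:(lra)). intros y Hy Hy1. simpl in Hy.
  assert (y - -1 < 2) by exact (Rle_lt_trans _ _ _ (Rle_abs _) Hy). lra.
- apply filter_and; [|exact HB].
  exists (mkposreal 2 ltac:(lra)). intros y Hy Hy1. simpl in Hy.
  assert (- (y - 1) < 2).
  { apply Rle_lt_trans with (2 := Hy). eapply Rle_trans; [apply Rle_abs|].
    apply Req_le. rewrite Rabs_Ropp. reflexivity. }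
  lra.
- intros a b [Ha Ha'] [Hb Hb']. exists (opp (RInt h (acos a) (acos b))). split.
  + now apply Sub.
  + apply (Hd (acos a, acos b)). split; assumption.
Qed.

Lemma wint_cos (g : R -> R) :
  (forall t, -1 <= t <= 1 -> continuous g t) ->
  wint g = RInt (fun p => g (cos p)) 0 PI.
Proof.
intros Hg. apply is_RInt_gen_unique.
generalize (is_RInt_gen_cheb_weight (V := R_CompleteNormedModule) g Hg).
apply is_RInt_gen_ext. apply filter_forall. intros ab x _.
unfold scal; simpl; unfold mult; simpl. R_eq. unfold Rdiv. ring.
Qed.

Lemma wintC_cos (g : R -> C) :
  (forall t, -1 <= t <= 1 -> continuousC g t) ->
  wintC g = CRInt (fun p => g (cos p)) 0 PI.
Proof.
intros Hg. unfold wintC. apply (is_RInt_gen_unique (V := C_R_CompleteNormedModule)).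
generalize (is_RInt_gen_cheb_weight (V := C_R_CompleteNormedModule) g Hg).
apply (is_RInt_gen_ext (V := C_R_NormedModule)).
(* Unlike in the real case, the complex inverse of the weight has to be converted into a real one,
   which requires a nonzero square root; the bounds are therefore kept inside (-1, 1). *)
apply (Filter_prod _ _ _ (fun a => -1 < a < 1) (fun b => -1 < b < 1)).
- exists (mkposreal 2 ltac:(lra)). intros y Hy Hy1. simpl in Hy.
  assert (y - -1 < 2) by exact (Rle_lt_trans _ _ _ (Rle_abs _) Hy). lra.
- exists (mkposreal 2 ltac:(lra)). intros y Hy Hy1. simpl in Hy.
  assert (- (y - 1) < 2).
  { apply Rle_lt_trans with (2 := Hy). eapply Rle_trans; [apply Rle_abs|].
    apply Req_le. rewrite Rabs_Ropp. reflexivity. }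
  lra.
- intros a b Ha Hb x Hx. simpl in Hx.
  assert (Hx1 : -1 < x < 1).
  { revert Hx. unfold Rmin, Rmax. destruct (Rle_dec a b); lra. }
  assert (Hw : sqrt (1 - x ^ 2) <> 0) by (apply Rgt_not_eq, sqrt_lt_R0; nra).
  unfold Cdiv. rewrite <- RtoC_inv by exact Hw.
  destruct (g x) as [y z]. unfold scal; simpl. unfold prod_scal, scal; simpl.
  unfold mult, Cmult, RtoC; simpl. f_equal; ring.
Qed.

(** * The Chebyshev transform of the Cauchy kernel *)

Lemma sum_n_first (a : nat -> R) (n : nat) :
  sum_n a (S n) = a O + sum_n (fun k => a (S k)) n.
Proof.
unfold sum_n. rewrite sum_Sn_m by lia. rewrite <- sum_n_m_S. reflexivity.
Qed.

Lemma sum_n_Rplus (f g : nat -> R) (n : nat) :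
  sum_n (fun k => f k + g k) n = sum_n f n + sum_n g n.
Proof. apply (sum_n_plus (G := R_AbelianGroup)). Qed.

Lemma sum_n_Rmult_l (c : R) (f : nat -> R) (n : nat) :
  sum_n (fun k => c * f k) n = c * sum_n f n.
Proof. apply (sum_n_mult_l (K := R_Ring)). Qed.

Lemma sum_n_Rext (f g : nat -> R) (n : nat) :
  (forall k, (k <= n)%nat -> f k = g k) -> sum_n f n = sum_n g n.
Proof. apply (sum_n_ext_loc (G := R_AbelianGroup)). Qed.

Lemma sum_n_fold_odd (s : nat) : forall b : nat -> R,
  sum_n b (2 * s + 1) = sum_n (fun k => b k + b (2 * s + 1 - k)%nat) s.
Proof.
induction s as [|s IH]; intros b.
- simpl. rewrite sum_Sn, !sum_O. reflexivity.
- replace (2 * S s + 1)%nat with (S (S (2 * s + 1))) by lia.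
  rewrite sum_Sn, sum_n_first, IH, sum_n_first.
  rewrite (sum_n_ext_loc (fun k => b (S k) + b (S (S (2 * s + 1)) - S k)%nat)
     (fun k => b (S k) + b (S (2 * s + 1 - k))%nat)).
  + change plus with Rplus. rewrite Nat.sub_0_r. R_eq. ring.
  + intros k Hk. now replace (S (S (2 * s + 1)) - S k)%nat with (S (2 * s + 1 - k)) by lia.
Qed.

(** Pascal's rule cannot be applied to the last term directly, since [Binomial.C N (S N)] is 1/(N+1)
    and not 0. The partial sums up to j are compared instead: they differ by one boundary term,
    which at j = N is the missing last summand. *)
Lemma sum_n_pascal (N : nat) (a : nat -> R) :
  sum_n (fun k => Binomial.C (S N) k * a k) (S N) =
  sum_n (fun k => Binomial.C N k * (a k + a (S k))) N.
Proof.
assert (H : forall j, (j <= N)%nat ->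
  sum_n (fun k => Binomial.C (S N) k * a k) j + Binomial.C N j * a (S j) =
  sum_n (fun k => Binomial.C N k * (a k + a (S k))) j).
{ induction j as [|j IH]; intros Hj.
  - rewrite !sum_O, !C_n_0. ring.
  - rewrite !sum_Sn, <- IH by lia. change plus with Rplus.
    rewrite <- (pascal N j) by lia. ring. }
rewrite <- H by lia. rewrite sum_Sn. change plus with Rplus. now rewrite !C_n_n.
Qed.

Lemma cos_pow_sum (x : R) (N : nat) :
  2 ^ N * cos x ^ N = sum_n (fun k => Binomial.C N k * cos ((INR N - 2 * INR k) * x)) N.
Proof.
induction N as [|N IH].
- rewrite sum_O, C_n_0. simpl. replace ((0 - 2 * 0) * x) with 0 by ring. rewrite cos_0. ring.
- rewrite (sum_n_pascal N (fun k => cos ((INR (S N) - 2 * INR k) * x))).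
  simpl (_ ^ S _). replace (2 * 2 ^ N * (cos x * cos x ^ N))
    with (2 * cos x * (2 ^ N * cos x ^ N)) by ring.
  rewrite IH, <- (sum_n_mult_l (K := R_Ring)).
  apply sum_n_ext. intros k. change mult with Rmult. rewrite !S_INR.
  replace ((INR N + 1 - 2 * INR k) * x) with ((INR N - 2 * INR k) * x + x) by ring.
  replace ((INR N + 1 - 2 * (INR k + 1)) * x) with ((INR N - 2 * INR k) * x - x) by ring.
  rewrite cos_plus, cos_minus. R_eq. ring.
Qed.

Lemma cos_odd_pow_sum (x : R) (s : nat) :
  cos x ^ (2 * s + 1) =
  / 4 ^ s * sum_n (fun k => Binomial.C (2 * s + 1) k * cos (INR (2 * s + 1 - 2 * k) * x)) s.
Proof.
assert (H4 : 0 < 4 ^ s) by (apply pow_lt; lra).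
apply Rmult_eq_reg_l with (2 * 4 ^ s); [|lra].
replace (2 * 4 ^ s * cos x ^ (2 * s + 1)) with (2 ^ (2 * s + 1) * cos x ^ (2 * s + 1)).
2: { f_equal. rewrite pow_add, pow_mult. simpl (2 ^ 1). replace (2 ^ 2) with 4 by ring. ring. }
rewrite cos_pow_sum, sum_n_fold_odd.
replace (2 * 4 ^ s * (/ 4 ^ s *
   sum_n (fun k => Binomial.C (2 * s + 1) k * cos (INR (2 * s + 1 - 2 * k) * x)) s))
 with (2 * sum_n (fun k => Binomial.C (2 * s + 1) k * cos (INR (2 * s + 1 - 2 * k) * x)) s)
 by (field; lra).
rewrite <- (sum_n_mult_l (K := R_Ring)).
apply sum_n_ext_loc. intros k Hk. change mult with Rmult.
rewrite <- pascal_step1 by lia.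
rewrite !minus_INR, mult_INR by lia. change (INR 2) with 2.
replace ((INR (2 * s + 1) - 2 * (INR (2 * s + 1) - INR k)) * x)
  with (- ((INR (2 * s + 1) - 2 * INR k) * x)) by ring.
rewrite cos_neg. R_eq. ring.
Qed.

Lemma cheb_pow_sum (n s : nat) (p : R) :
  chebT n (cos p) ^ (2 * s + 1) =
  / 4 ^ s * sum_n (fun k => Binomial.C (2 * s + 1) k *
     cos (INR ((2 * s + 1 - 2 * k) * n) * p)) s.
Proof.
rewrite chebT_cos, cos_odd_pow_sum. f_equal. apply sum_n_ext. intros k.
now rewrite mult_INR, Rmult_assoc.
Qed.

Lemma RtoC_sum_n (a : nat -> R) (n : nat) :
  RtoC (sum_n a n) = Csum_n (fun k => RtoC (a k)) n.
Proof.
induction n as [|n IH]; [now rewrite !sum_O|]. rewrite !sum_Sn, <- IH.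
change (RtoC (sum_n a n + a (S n)) = RtoC (sum_n a n) + RtoC (a (S n)))%C.
apply RtoC_plus.
Qed.

Lemma sum_n_Cmult_l (c : C) (a : nat -> C) (n : nat) :
  Csum_n (fun k => c * a k)%C n = (c * Csum_n a n)%C.
Proof. apply (sum_n_mult_l (K := C_Ring)). Qed.

Lemma sum_n_Cext (a b : nat -> C) (n : nat) :
  (forall k, (k <= n)%nat -> a k = b k) ->
  Csum_n a n = Csum_n b n.
Proof. apply (sum_n_ext_loc (G := C_AbelianGroup)). Qed.

Lemma continuous_chebT (n : nat) (x : R) : continuous (chebT n) x.
Proof.
assert (H : continuous (chebT n) x /\ continuous (chebT (S n)) x).
{ induction n as [|n [IH1 IH2]].
  - split; [apply continuous_const|apply continuous_id].
  - split; [exact IH2|].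
    apply (continuous_minus (V := R_NormedModule) (fun y => 2 * y * chebT (S n) y) (chebT n));
      [|exact IH1].
    apply (continuous_mult (K := R_AbsRing) (fun y => 2 * y) (chebT (S n))); [|exact IH2].
    apply (continuous_mult (K := R_AbsRing) (fun _ => 2) (fun y => y));
      [apply continuous_const|apply continuous_id]. }
exact (proj1 H).
Qed.

Lemma hol_chebTC (n : nat) (z : C) : hol (chebTC n) z.
Proof.
assert (H : hol (chebTC n) z /\ hol (chebTC (S n)) z).
{ induction n as [|n [IH1 IH2]].
  - split; [exact (hol_const 1 z)|exact (hol_id z)].
  - split; [exact IH2|].
    apply (hol_minus (fun y => RtoC 2 * y * chebTC (S n) y)%C (chebTC n)); [|exact IH1].
    apply (hol_mult (fun y => RtoC 2 * y)%C (chebTC (S n))); [|exact IH2].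
    apply (hol_mult (fun _ => RtoC 2) (fun y => y)); [apply hol_const|apply hol_id]. }
exact (proj1 H).
Qed.

(** * The Joukowski map and the Cauchy transforms of Chebyshev polynomials *)

Definition joukowski (u : C) : C := (/ 2 * (u + / u))%C.

Lemma chebTC_joukowski (n : nat) (u : C) :
  u <> 0 -> chebTC n (joukowski u) = (/ 2 * (u ^ n + / u ^ n))%C.
Proof.
intros Hu.
assert (H : chebTC n (joukowski u) = (/ 2 * (u ^ n + / u ^ n))%C /\
  chebTC (S n) (joukowski u) = (/ 2 * (u ^ S n + / u ^ S n))%C).
{ induction n as [|n [IH1 IH2]].
  - split.
    + simpl. field.
    + simpl. unfold joukowski. field. exact Hu.
  - split; [exact IH2|].
    change (chebTC (S (S n)) (joukowski u))
     with (RtoC 2 * joukowski u * chebTC (S n) (joukowski u) - chebTC n (joukowski u))%C.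
    rewrite IH1, IH2. unfold joukowski. simpl (_ ^ S _)%C. field.
    split; [now apply Cpow_nz|exact Hu]. }
exact (proj1 H).
Qed.

Lemma Cmod_neq_1_sqr (u : C) : 1 < Cmod u -> (u * u - 1)%C <> 0.
Proof.
intros H E. apply Ceq_minus in E.
assert (M : Cmod u * Cmod u = 1) by (rewrite <- Cmod_mult, E; apply Cmod_1). nra.
Qed.

Lemma Cmod_gt_1_neq_0 (u : C) : 1 < Cmod u -> u <> 0.
Proof. intros H E. rewrite E, Cmod_0 in H. lra. Qed.

Lemma joukowski_cis (p : R) : joukowski (cis p) = RtoC (cos p).
Proof.
unfold joukowski, cis, Cinv, Cplus, Cmult, RtoC. simpl.
replace (cos p * (cos p * 1) + sin p * (sin p * 1)) with 1.
2: { generalize (sin2_cos2 p). unfold Rsqr. lra. }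
f_equal; field.
Qed.

Lemma cis_neq_0 (p : R) : cis p <> 0.
Proof. intros E. generalize (Cmod_cis p). rewrite E, Cmod_0. lra. Qed.

(** With v = e^(ip), the difference of the two values factors as (u - v)(uv - 1)/(2uv), and neither
    factor vanishes when |v| = 1 < |u|. *)
Lemma joukowski_minus_cos_neq_0 (u : C) (p : R) :
  1 < Cmod u -> (joukowski u - cos p)%C <> 0.
Proof.
intros Hu. rewrite <- joukowski_cis. assert (H0 := Cmod_gt_1_neq_0 u Hu).
assert (Hv := cis_neq_0 p). assert (Mv := Cmod_cis p). set (v := cis p) in *.
replace (joukowski u - joukowski v)%C with ((u - v) * (u * v - 1) / (2 * (u * v)))%C
  by (unfold joukowski; field; split; assumption).
assert (N1 : (u - v)%C <> 0).
{ intros E. apply Ceq_minus in E. rewrite E in Hu. lra. }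
assert (N2 : (u * v - 1)%C <> 0).
{ intros E. apply Ceq_minus in E.
  assert (M : Cmod u * Cmod v = 1) by (rewrite <- Cmod_mult, E; apply Cmod_1).
  rewrite Mv in M. lra. }
apply Cmult_neq_0; [now apply Cmult_neq_0|].
intros E. assert (F : (2 * (u * v) * / (2 * (u * v)))%C = 0) by (rewrite E; ring).
rewrite Cinv_r in F.
- apply (f_equal fst) in F. simpl in F. lra.
- apply Cmult_neq_0; [apply RtoC_neq_0; lra|now apply Cmult_neq_0].
Qed.

Definition cheb_cauchy (u : C) (m : nat) : C :=
  CRInt (fun p => RtoC (cos (INR m * p)) / (joukowski u - RtoC (cos p)))%C 0 PI.

Lemma continuous_cos_scal (c x : R) : continuous (fun p => cos (c * p)) x.
Proof.
apply (continuous_comp (fun p => c * p) cos); [|apply continuous_cos].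
apply (continuous_mult (K := R_AbsRing) (fun _ => c) (fun p => p));
 [apply continuous_const|apply continuous_id].
Qed.

Lemma continuous_cheb_cauchy (u : C) (m : nat) (x : R) :
  1 < Cmod u -> continuousC
   (fun p => RtoC (cos (INR m * p)) / (joukowski u - RtoC (cos p)))%C x.
Proof.
intros Hu. apply continuous_Cdiv.
- apply continuous_RtoC, continuous_cos_scal.
- apply continuous_Cminus; [apply continuous_const|apply continuous_RtoC, continuous_cos].
- now apply joukowski_minus_cos_neq_0.
Qed.

Lemma RInt_cos_INR (m : nat) : RInt (fun p => cos (INR (S m) * p)) 0 PI = 0.
Proof.
assert (Hm : INR (S m) <> 0) by (apply not_0_INR; lia).
transitivity (minus (/ INR (S m) * sin (INR (S m) * PI)) (/ INR (S m) * sin (INR (S m) * 0))).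
- apply is_RInt_unique. apply (is_RInt_derive (V := R_CompleteNormedModule)
   (fun p => / INR (S m) * sin (INR (S m) * p)) (fun p => cos (INR (S m) * p))).
  + intros x _. generalize (INR (S m)) Hm. intros k Hk. auto_derive; [easy|]. field. exact Hk.
  + intros x _. apply continuous_cos_scal.
- rewrite Rmult_0_r, sin_0. rewrite (sin_eq_0_1 (INR (S m) * PI)).
  + unfold minus, plus, opp; simpl. ring.
  + exists (Z.of_nat (S m)). now rewrite <- INR_IZR_INZ.
Qed.

(** In cos((m+2)x) + cos(mx) = 2 cos x cos((m+1)x) write cos x as z - (z - cos x): the second part
    cancels the denominator and leaves the integral of cos((m+1)x), which is 0. In [cheb_cauchy_1]
    the same cancellation leaves the integral of 1, whence the term [PI]. *)
Lemma cheb_cauchy_rec (u : C) (m : nat) : 1 < Cmod u ->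
  (cheb_cauchy u (S (S m)) + cheb_cauchy u m = 2 * joukowski u * cheb_cauchy u (S m))%C.
Proof.
intros Hu. unfold cheb_cauchy.
rewrite <- CRInt_plus by (intros t; now apply continuous_cheb_cauchy).
rewrite <- CRInt_Cmult by (intros t; now apply continuous_cheb_cauchy).
transitivity (CRInt (fun t => 2 * joukowski u *
   (cos (INR (S m) * t) / (joukowski u - cos t)) - 2 * RtoC (cos (INR (S m) * t)))%C 0 PI).
- apply CRInt_ext. intros t.
  assert (N := joukowski_minus_cos_neq_0 u t Hu).
  replace (INR (S (S m)) * t) with (INR (S m) * t + t) by (rewrite (S_INR (S m)); ring).
  replace (INR m * t) with (INR (S m) * t - t) by (rewrite (S_INR m); ring).
  rewrite cos_plus, cos_minus, !RtoC_minus, !RtoC_plus, !RtoC_mult.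
  field. exact N.
- assert (C1 : forall t, continuousC (fun t => RtoC (cos (INR (S m) * t))) t).
  { intros t. apply continuous_RtoC, continuous_cos_scal. }
  rewrite CRInt_minus.
  + rewrite (CRInt_Cmult 2) by exact C1. rewrite CRInt_RtoC by apply continuous_cos_scal.
    rewrite RInt_cos_INR. ring.
  + intros t. apply continuous_Cmult; [apply continuous_const|now apply continuous_cheb_cauchy].
  + intros t. apply continuous_Cmult; [apply continuous_const|apply C1].
Qed.

Lemma cheb_cauchy_1 (u : C) : 1 < Cmod u ->
  (cheb_cauchy u 1 = joukowski u * cheb_cauchy u 0 - PI)%C.
Proof.
intros Hu. unfold cheb_cauchy.
rewrite <- CRInt_Cmult by (intros t; now apply continuous_cheb_cauchy).
replace (RtoC PI) with (CRInt (fun _ => RtoC 1) 0 PI).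
2: { rewrite CRInt_RtoC by (intros t; apply continuous_const).
     rewrite RInt_const. f_equal. unfold scal; simpl; unfold mult; simpl. ring. }
rewrite <- CRInt_minus.
- apply CRInt_ext. intros t. assert (N := joukowski_minus_cos_neq_0 u t Hu).
  simpl INR. rewrite Rmult_0_l, cos_0, Rmult_1_l. field. exact N.
- intros t. apply continuous_Cmult; [apply continuous_const|now apply continuous_cheb_cauchy].
- intros t. apply continuous_const.
Qed.

(* The recurrence has characteristic roots u and 1/u; boundedness in m excludes u^m. *)
Lemma cheb_cauchy_value (u : C) (m : nat) : 1 < Cmod u ->
  cheb_cauchy u m = (2 * PI / (u - / u) * / u ^ m)%C.
Proof.
intros Hu. assert (H0 := Cmod_gt_1_neq_0 u Hu). assert (H1 := Cmod_neq_1_sqr u Hu).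
set (D := fun m => (cheb_cauchy u (S m) - cheb_cauchy u m / u)%C).
assert (HD : forall m, D m = (u ^ m * D O)%C).
{ induction m0 as [|k IH]; [simpl; ring|].
  simpl (_ ^ _)%C. rewrite <- Cmult_assoc, <- IH. unfold D.
  replace (cheb_cauchy u (S (S k))) with
    (2 * joukowski u * cheb_cauchy u (S k) - cheb_cauchy u k)%C
    by (rewrite <- cheb_cauchy_rec by exact Hu; ring).
  unfold joukowski. field. exact H0. }
set (B := RInt (fun p => Cmod (/ (joukowski u - RtoC (cos p)))) 0 PI).
assert (Cb : forall x, continuous (fun p => Cmod (/ (joukowski u - RtoC (cos p)))) x).
{ intros x. apply continuous_Cmod, continuous_Cinv.
  - apply continuous_Cminus; [apply continuous_const|apply continuous_RtoC, continuous_cos].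
  - now apply joukowski_minus_cos_neq_0. }
assert (HB : forall k, Cmod (cheb_cauchy u k) <= B).
{ intros k. eapply Rle_trans.
  - apply Cmod_CRInt_le; [left; apply PI_RGT_0|]. intros t. now apply continuous_cheb_cauchy.
  - apply RInt_le.
    + left; apply PI_RGT_0.
    + apply (ex_RInt_continuous (V := R_CompleteNormedModule)). intros t _.
      apply continuous_Cmod. now apply continuous_cheb_cauchy.
    + apply (ex_RInt_continuous (V := R_CompleteNormedModule)). intros t _. apply Cb.
    + intros x _. unfold Cdiv. rewrite Cmod_mult, Cmod_R.
      rewrite <- (Rmult_1_l (Cmod (/ _))) at 2.
      apply Rmult_le_compat_r; [apply Cmod_ge_0|].
      generalize (COS_bound (INR k * x)). intros [? ?]. now apply Rabs_le. }
assert (D0 : D O = 0).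
{ destruct (Ceq_dec (D O) 0) as [E|N]; [exact E|exfalso].
  assert (P := proj1 (Cmod_gt_0 _) N).
  assert (HDb : forall k, Cmod (D k) <= 2 * B).
  { intros k. unfold D. eapply Rle_trans; [apply Cmod_triangle|]. rewrite Cmod_opp.
    assert (Cmod (cheb_cauchy u k / u) <= B).
    { rewrite Cmod_div by exact H0. apply Rle_trans with (2 := HB k).
      rewrite <- (Rmult_1_r (Cmod (cheb_cauchy u k))) at 2.
      apply Rmult_le_compat_l; [apply Cmod_ge_0|].
      rewrite <- Rinv_1. apply Rinv_le_contravar; lra. }
    generalize (HB (S k)). lra. }
  destruct (Pow_x_infinity (Cmod u)) with (b := 2 * B / Cmod (D O) + 1) as [K HK].
  { rewrite Rabs_pos_eq; [lra|apply Cmod_ge_0]. }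
  specialize (HK K (le_n _)). specialize (HDb K).
  rewrite HD, Cmod_mult, Cmod_pow in HDb.
  rewrite Rabs_pos_eq in HK by (apply pow_le, Cmod_ge_0).
  apply Rge_le in HK. apply (Rmult_le_compat_r (Cmod (D O))) in HK; [|lra].
  replace ((2 * B / Cmod (D O) + 1) * Cmod (D O)) with (2 * B + Cmod (D O)) in HK by (field; lra).
  lra. }
assert (HW : forall k, cheb_cauchy u k = (cheb_cauchy u O * / u ^ k)%C).
{ induction k as [|k IH]; [simpl; field|].
  assert (E : D k = 0) by (rewrite HD, D0; ring). apply Ceq_minus in E. rewrite E, IH.
  simpl (_ ^ _)%C. field. split; [now apply Cpow_nz|exact H0]. }
rewrite HW. f_equal.
assert (E := cheb_cauchy_1 u Hu). rewrite HW in E. unfold joukowski in E.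
assert (Nu : (u - / u)%C <> 0).
{ replace (u - / u)%C with ((u * u - 1) * / u)%C by (field; exact H0).
  apply Cmult_neq_0; [exact H1|]. intros Q. apply (f_equal (Cmult u)) in Q.
  rewrite Cinv_r, Cmult_0_r in Q by exact H0. apply (f_equal fst) in Q. simpl in Q. lra. }
assert (E2 : (RtoC PI = / 2 * (u - / u) * cheb_cauchy u 0)%C).
{ simpl (_ ^ 1)%C in E. rewrite Cmult_1_r in E.
  replace (RtoC PI) with (/ 2 * (u + / u) * cheb_cauchy u 0 - cheb_cauchy u 0 * / u)%C
    by (rewrite E; ring).
  field. exact H0. }
rewrite E2. field. split; [exact H0|exact H1].
Qed.

(** * The closed form of the integrals I_l *)

Lemma binom_absorb (n k : nat) :
  (k <= n)%nat -> INR (S k) * Binomial.C (S n) (S k) = INR (S n) * Binomial.C n k.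
Proof.
intros H. unfold Binomial.C. replace (S n - S k)%nat with (n - k)%nat by lia.
rewrite !fact_simpl, !mult_INR. field.
repeat split; try apply INR_fact_neq_0; apply not_0_INR; lia.
Qed.

Lemma binom_absorb_low (n k : nat) :
  (k <= n)%nat -> INR (S n - k) * Binomial.C (S n) k = INR (S n) * Binomial.C n k.
Proof.
intros H. unfold Binomial.C. replace (S n - k)%nat with (S (n - k))%nat by lia.
rewrite !fact_simpl, !mult_INR. field.
repeat split; try apply INR_fact_neq_0; apply not_0_INR; lia.
Qed.

(** With r = 2s - 1 and x = rho^(4n) - 1 this is the sum in [I_closed]. The exponent of the
    denominator of the integral is r + 1, which is left free for the induction. *)
Definition I_poly (l r : nat) (x : R) : R :=
  sum_n (fun m => Binomial.C (r + l) m * Binomial.C (2 * r - m) r * x ^ m) r.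

(** This is [V_int_rec] transported to the closed form: x stands for q^2 - 1, so that x + 2 = q^2 +
    1 is 2qa with a = (q + 1/q)/2. *)
Lemma I_poly_rec (l r : nat) (x : R) :
  INR (S r) * I_poly l (S r) x =
  (x + 2) * INR (S r + l) * I_poly l r x - 2 * (INR (S l) - INR (S r)) * I_poly (S l) r x.
Proof.
set (N := (S r + l)%nat).
(* Both sides equal the sum of [e] up to r + 1 plus the sum of [d] up to r. On the right,
   multiplication by x raises the index by one and produces [e] by absorption, while all other terms
   merge into [d]. On the left, each coefficient below r + 1 splits by the identity [Q], and the top
   one is [e (S r)] alone. *)
set (e := fun m => INR m * Binomial.C N m * Binomial.C (2 * r + 1 - m) r * x ^ m).
set (d := fun m => 2 * INR (2 * r + 1 - m) * Binomial.C N m * Binomial.C (2 * r - m) r * x ^ m).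
assert (HR : (x + 2) * INR N * I_poly l r x - 2 * (INR (S l) - INR (S r)) * I_poly (S l) r x
   = sum_n e (S r) + sum_n d r).
{ rewrite sum_n_first. replace (e O) with 0 by (unfold e; simpl; ring). rewrite Rplus_0_l.
  unfold I_poly. rewrite <- sum_n_Rplus, <- !sum_n_Rmult_l.
  assert (G : forall f g h : nat -> R, (forall k, (k <= r)%nat -> f k - g k = h k) ->
    sum_n f r - sum_n g r = sum_n h r).
  { intros f g h Hk. transitivity (sum_n (fun k => f k + - (1) * g k) r).
    - rewrite sum_n_Rplus, sum_n_Rmult_l. ring.
    - apply sum_n_Rext. intros k Hkr. rewrite <- Hk by exact Hkr. ring. }
  apply G. intros m Hm. fold N.
  assert (A1 := binom_absorb (r + l) m ltac:(lia)).
  assert (A2 := binom_absorb_low (r + l) m ltac:(lia)).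
  replace (S (r + l)) with N in A1, A2 by (unfold N; lia).
  unfold e, d. replace (r + S l)%nat with N by (unfold N; lia).
  replace (2 * r + 1 - S m)%nat with (2 * r - m)%nat by lia.
  rewrite A1.
  replace (INR (2 * r + 1 - m)) with (INR (N - m) - (INR (S l) - INR (S r))).
  2: { unfold N. rewrite !minus_INR, !plus_INR, mult_INR, !S_INR by lia. simpl. ring. }
  set (b := Binomial.C (2 * r - m) r).
  replace (2 * (INR (N - m) - (INR (S l) - INR (S r))) * Binomial.C N m * b * x ^ m)
   with (2 * (INR (N - m) * Binomial.C N m) * b * x ^ m
         - 2 * (INR (S l) - INR (S r)) * (Binomial.C N m * b * x ^ m)) by ring.
  rewrite A2. simpl (x ^ S m). simpl (INR (S l)). ring. }
rewrite HR. unfold I_poly. rewrite <- sum_n_Rmult_l.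
rewrite !(sum_Sn _ r). change plus with Rplus.
fold N.
assert (HL : INR (S r) * (Binomial.C N (S r) * Binomial.C (2 * S r - S r) (S r) * x ^ S r) = e (S r)).
{ unfold e. replace (2 * S r - S r)%nat with (S r) by lia.
  replace (2 * r + 1 - S r)%nat with r by lia. rewrite !C_n_n. ring. }
rewrite HL.
assert (HS : sum_n (fun k => INR (S r) * (Binomial.C N k * Binomial.C (2 * S r - k) (S r) * x ^ k)) r
   = sum_n e r + sum_n d r).
{ rewrite <- sum_n_Rplus. apply sum_n_Rext. intros m Hm. unfold e, d.
  assert (Q : INR (S r) * Binomial.C (2 * S r - m) (S r) =
    INR m * Binomial.C (2 * r + 1 - m) r + 2 * INR (2 * r + 1 - m) * Binomial.C (2 * r - m) r).
  { set (M := (2 * r - m)%nat).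
    replace (2 * S r - m)%nat with (S (S M)) by (unfold M; lia).
    replace (2 * r + 1 - m)%nat with (S M) by (unfold M; lia).
    rewrite binom_absorb by (unfold M; lia).
    assert (A := binom_absorb_low M r ltac:(unfold M; lia)).
    replace (2 * INR (S M) * Binomial.C M r) with (2 * (INR (S M) * Binomial.C M r)) by ring.
    rewrite <- A.
    replace (INR (S (S M))) with (INR m + 2 * INR (S M - r)).
    - ring.
    - rewrite minus_INR by (unfold M; lia). rewrite !S_INR. unfold M.
      rewrite minus_INR, mult_INR by lia. simpl. ring. }
  replace (INR (S r) * (Binomial.C N m * Binomial.C (2 * S r - m) (S r) * x ^ m))
   with (INR (S r) * Binomial.C (2 * S r - m) (S r) * Binomial.C N m * x ^ m) by ring.
  rewrite Q. R_eq. ring. }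
rewrite HS. R_eq. ring.
Qed.

(** * Recurrences for the integrals of cos(lx) over powers of a + cos x *)

Definition V_int (a : R) (l p : nat) : R :=
  RInt (fun x => cos (INR l * x) / (a + cos x) ^ p) 0 PI.

Lemma den_pos (a x : R) : 1 < a -> 0 < a + cos x.
Proof. intros H. generalize (COS_bound x). lra. Qed.

Lemma continuous_V_den (a x : R) (p : nat) :
  1 < a -> continuous (fun x => / (a + cos x) ^ p) x.
Proof.
intros Ha. assert (P := pow_lt _ p (den_pos a x Ha)).
apply (continuous_comp (fun x => (a + cos x) ^ p) Rinv); [|apply continuous_Rinv; lra].
apply (ex_derive_continuous (V := R_NormedModule)). auto_derive. easy.
Qed.

Lemma continuous_V_int (a x : R) (l p : nat) :
  1 < a -> continuous (fun x => cos (INR l * x) / (a + cos x) ^ p) x.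
Proof.
intros Ha. apply (continuous_mult (K := R_AbsRing)).
- apply continuous_cos_scal.
- now apply continuous_V_den.
Qed.

Lemma is_RInt_V (a : R) (l p : nat) : 1 < a ->
  is_RInt (fun x => cos (INR l * x) / (a + cos x) ^ p) 0 PI (V_int a l p).
Proof.
intros Ha. apply (RInt_correct (V := R_CompleteNormedModule)).
apply (ex_RInt_continuous (V := R_CompleteNormedModule)). intros x _.
now apply continuous_V_int.
Qed.

Lemma sin_INR_PI (l : nat) : sin (INR l * PI) = 0.
Proof. apply sin_eq_0_1. exists (Z.of_nat l). now rewrite <- INR_IZR_INZ. Qed.

(** The integrand is the derivative of sin(lx)/(a + cos x)^p, which vanishes at 0 and at pi. *)
Lemma is_RInt_V_parts (a : R) (l p : nat) : 1 < a ->
  is_RInt (fun x => (INR l * cos (INR l * x) * (a + cos x) + INR p * sin (INR l * x) * sin x)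
     / (a + cos x) ^ S p) 0 PI 0.
Proof.
intros Ha.
assert (E : minus (sin (INR l * PI) / (a + cos PI) ^ p) (sin (INR l * 0) / (a + cos 0) ^ p) = 0).
{ rewrite sin_INR_PI, Rmult_0_r, sin_0. unfold minus, plus, opp; simpl. unfold Rdiv. ring. }
refine (eq_ind _ (fun v => is_RInt _ 0 PI v) _ _ E).
apply (is_RInt_derive (V := R_CompleteNormedModule) (fun x => sin (INR l * x) / (a + cos x) ^ p)).
- intros x _. assert (P := den_pos a x Ha).
  assert (Pp := pow_lt _ p P).
  generalize (INR l). intros k.
  auto_derive; [lra|].
  destruct p as [|p].
  + simpl. field. lra.
  + assert (Pp' := pow_lt _ p P).
    simpl pred. rewrite <- !tech_pow_Rmult. field. lra.
- intros x _. apply (continuous_mult (K := R_AbsRing)); [|now apply continuous_V_den].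
  apply (ex_derive_continuous (V := R_NormedModule)). generalize (INR l) (INR p). intros k k'.
  auto_derive. easy.
Qed.

(** Expand cos((l+1)x): its product of sines cancels the one in [is_RInt_V_parts], and what is left
    is cos(lx) times a factor a + cos x, which lowers the exponent. [V_int_down] does the same with
    cos(lx) expanded around (l+1)x. *)
Lemma V_int_up (a : R) (l p : nat) : 1 < a ->
  INR p * V_int a (S l) (S p) + INR p * a * V_int a l (S p) = (INR p + INR l) * V_int a l p.
Proof.
intros Ha.
assert (H1 := is_RInt_V a (S l) (S p) Ha). assert (H2 := is_RInt_V a l (S p) Ha).
assert (H3 := is_RInt_V a l p Ha). assert (H0 := is_RInt_V_parts a l p Ha).
apply (is_RInt_scal (V := R_NormedModule) _ _ _ (INR p)) in H1.
apply (is_RInt_scal (V := R_NormedModule) _ _ _ (INR p * a)) in H2.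
assert (H4 := is_RInt_plus (V := R_NormedModule) _ _ _ _ _ _
   (is_RInt_plus (V := R_NormedModule) _ _ _ _ _ _ H1 H2) H0).
apply (is_RInt_scal (V := R_NormedModule) _ _ _ (INR p + INR l)) in H3.
assert (H5 : is_RInt (fun x => scal (INR p + INR l) (cos (INR l * x) / (a + cos x) ^ p)) 0 PI
  (plus (plus (scal (INR p) (V_int a (S l) (S p))) (scal (INR p * a) (V_int a l (S p)))) 0)).
{ revert H4. apply is_RInt_ext. intros x _. assert (P := den_pos a x Ha). assert (Pp := pow_lt _ p P).
  unfold plus, scal; simpl; unfold mult; simpl.
  replace (match l with O => 1 | S _ => INR l + 1 end) with (INR (S l)) by reflexivity.
  replace (INR (S l) * x) with (INR l * x + x) by (rewrite S_INR; ring).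
  rewrite cos_plus. R_eq. field. lra. }
assert (U := eq_trans (eq_sym (is_RInt_unique _ _ _ _ H5)) (is_RInt_unique _ _ _ _ H3)).
unfold plus, scal in U; simpl in U; unfold mult in U; simpl in U. simpl. lra.
Qed.

Lemma V_int_down (a : R) (l p : nat) : 1 < a ->
  INR p * V_int a l (S p) + INR p * a * V_int a (S l) (S p) =
  (INR p - INR (S l)) * V_int a (S l) p.
Proof.
intros Ha.
assert (H1 := is_RInt_V a l (S p) Ha). assert (H2 := is_RInt_V a (S l) (S p) Ha).
assert (H3 := is_RInt_V a (S l) p Ha). assert (H0 := is_RInt_V_parts a (S l) p Ha).
apply (is_RInt_scal (V := R_NormedModule) _ _ _ (INR p)) in H1.
apply (is_RInt_scal (V := R_NormedModule) _ _ _ (INR p * a)) in H2.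
assert (H4 := is_RInt_minus (V := R_NormedModule) _ _ _ _ _ _
   (is_RInt_plus (V := R_NormedModule) _ _ _ _ _ _ H1 H2) H0).
apply (is_RInt_scal (V := R_NormedModule) _ _ _ (INR p - INR (S l))) in H3.
assert (H5 : is_RInt (fun x => scal (INR p - INR (S l)) (cos (INR (S l) * x) / (a + cos x) ^ p)) 0 PI
  (minus (plus (scal (INR p) (V_int a l (S p))) (scal (INR p * a) (V_int a (S l) (S p)))) 0)).
{ revert H4. apply is_RInt_ext. intros x _. assert (P := den_pos a x Ha). assert (Pp := pow_lt _ p P).
  unfold minus, plus, opp, scal; simpl; unfold mult; simpl.
  replace (match l with O => 1 | S _ => INR l + 1 end) with (INR (S l)) by reflexivity.
  replace (INR l * x) with (INR (S l) * x - x) by (rewrite S_INR; ring).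
  rewrite cos_minus. R_eq. field. lra. }
assert (U := eq_trans (eq_sym (is_RInt_unique _ _ _ _ H5)) (is_RInt_unique _ _ _ _ H3)).
unfold minus, plus, opp, scal in U; simpl in U; unfold mult in U; simpl in U. simpl. lra.
Qed.

(** The two preceding relations are linear in the two integrals of exponent p + 1; a times the first
    minus the second eliminates the one of index l + 1 and leaves the factor a^2 - 1. *)
Lemma V_int_rec (a : R) (l p : nat) : 1 < a ->
  INR p * (a ^ 2 - 1) * V_int a l (S p) =
  a * (INR p + INR l) * V_int a l p + (INR (S l) - INR p) * V_int a (S l) p.
Proof.
intros Ha. assert (U := V_int_up a l p Ha). assert (D := V_int_down a l p Ha).
replace (a * (INR p + INR l) * V_int a l p) with (a * ((INR p + INR l) * V_int a l p)) by ring.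
rewrite <- U.
replace ((INR (S l) - INR p) * V_int a (S l) p)
  with (- ((INR p - INR (S l)) * V_int a (S l) p)) by ring.
rewrite <- D. ring.
Qed.

Lemma half_sum_inv_gt_1 (q : R) : 1 < q -> 1 < / 2 * (q + / q).
Proof.
intros Hq. apply Rmult_lt_reg_r with (2 * q); [lra|].
replace (/ 2 * (q + / q) * (2 * q)) with (q * q + 1) by (field; lra). nra.
Qed.

(** Since -a is the image of -q under the Joukowski map, 1/(a + cos x) is minus the Cauchy kernel at
    u = -q, and [cheb_cauchy_value] applies; the sign (-1)^l is that of (-q)^l. *)
Lemma V_int_1 (q : R) (l : nat) : 1 < q ->
  V_int (/ 2 * (q + / q)) l 1 = (-1) ^ l * (2 * q) * PI / (q ^ l * (q ^ 2 - 1)).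
Proof.
intros Hq. set (a := / 2 * (q + / q)).
assert (Ha : 1 < a) by now apply half_sum_inv_gt_1.
assert (E := cheb_cauchy_value (RtoC (- q)) l).
rewrite Cmod_R, Rabs_left in E by lra. specialize (E ltac:(lra)).
assert (J : joukowski (RtoC (- q)) = RtoC (- a)).
{ unfold joukowski. rewrite <- (RtoC_inv (- q)), <- (RtoC_inv 2) by lra.
  rewrite <- RtoC_plus, <- RtoC_mult. f_equal. unfold a. field. lra. }
assert (W : cheb_cauchy (RtoC (- q)) l = RtoC (- V_int a l 1)).
{ unfold cheb_cauchy. rewrite J.
  rewrite (CRInt_ext _ (fun p => RtoC (- (cos (INR l * p) / (a + cos p) ^ 1)))).
  - rewrite CRInt_RtoC.
    + f_equal. apply is_RInt_unique. apply (is_RInt_opp (V := R_NormedModule)). now apply is_RInt_V.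
    + intros t. apply (continuous_opp (V := R_NormedModule)). now apply continuous_V_int.
  - intros p. assert (P := den_pos a p Ha).
    rewrite <- RtoC_minus. unfold Cdiv. rewrite <- RtoC_inv by lra.
    rewrite <- RtoC_mult. f_equal. simpl. field. lra. }
rewrite W in E.
assert (Q : - V_int a l 1 = 2 * PI / (- q - / - q) * / (- q) ^ l).
{ apply RtoC_inj. rewrite E.
  assert (N : - q - / - q <> 0).
  { replace (- q - / - q) with (- ((q * q - 1) / q)) by (field; lra).
    apply Ropp_neq_0_compat. apply Rgt_not_eq. apply Rdiv_lt_0_compat; nra. }
  unfold Cdiv, Rdiv. rewrite !RtoC_mult, RtoC_inv, RtoC_minus, RtoC_inv by lra.
  rewrite RtoC_inv, RtoC_pow by (apply pow_nonzero; lra). reflexivity. }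
assert (Hl := pow_lt q l ltac:(lra)).
apply Ropp_eq_compat in Q. rewrite Ropp_involutive in Q. rewrite Q.
replace ((- q) ^ l) with ((-1) ^ l * q ^ l) by (rewrite <- Rpow_mult_distr; f_equal; ring).
assert (M1 : (-1) ^ l * (-1) ^ l = 1).
{ rewrite <- Rpow_mult_distr. replace (-1 * -1) with 1 by ring. apply pow1. }
assert (M0 : (-1) ^ l <> 0) by (apply pow_nonzero; lra).
replace ((-1) ^ l * (2 * q) * PI / (q ^ l * (q ^ 2 - 1)))
  with (/ (-1) ^ l * (2 * q) * PI / (q ^ l * (q ^ 2 - 1))).
2: { replace (/ (-1) ^ l) with ((-1) ^ l); [reflexivity|].
     apply Rmult_eq_reg_l with ((-1) ^ l); [|exact M0]. rewrite M1. field. exact M0. }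
field. assert (q ^ 2 - 1 <> 0) by nra. repeat split; try lra; try assumption; nra.
Qed.

(** [l] stays quantified inside the induction on r because the recurrence for index l also calls the
    index l + 1 at the lower exponent. *)
Lemma V_int_closed (q : R) (r : nat) : 1 < q -> forall l,
  V_int (/ 2 * (q + / q)) l (S r) =
  (-1) ^ l * (2 * q) ^ S r * (PI * I_poly l r (q ^ 2 - 1) / (q ^ l * (q ^ 2 - 1) ^ (2 * r + 1))).
Proof.
intros Hq. assert (Ha := half_sum_inv_gt_1 q Hq).
assert (Hx : 0 < q ^ 2 - 1) by nra.
induction r as [|r IH]; intros l.
- rewrite V_int_1 by exact Hq. unfold I_poly. rewrite sum_O. rewrite !C_n_0.
  assert (Hl := pow_lt q l ltac:(lra)).
  simpl ((2 * q) ^ 1). simpl (2 * 0 + 1)%nat. rewrite pow_1, pow_O. field. lra.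
- assert (E := V_int_rec (/ 2 * (q + / q)) l (S r) Ha).
  rewrite !IH in E.
  assert (P := I_poly_rec l r (q ^ 2 - 1)).
  set (x := q ^ 2 - 1) in *.
  assert (Hp : 0 < INR (S r)) by (apply lt_0_INR; lia).
  assert (A2 : (/ 2 * (q + / q)) ^ 2 - 1 = x ^ 2 / (4 * q ^ 2)) by (unfold x; field; lra).
  assert (A1 : / 2 * (q + / q) = (x + 2) / (2 * q)) by (unfold x; field; lra).
  rewrite A2 in E.
  assert (K : INR (S r) * (x ^ 2 / (4 * q ^ 2)) <> 0).
  { apply Rgt_not_eq. apply Rmult_lt_0_compat; [exact Hp|]. apply Rdiv_lt_0_compat; nra. }
  apply Rmult_eq_reg_l with (2 := K). rewrite E. rewrite A1.
  assert (Hl := pow_lt q l ltac:(lra)). assert (Hr := pow_lt x (2 * r + 1) Hx).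
  replace (2 * S r + 1)%nat with (S (S (2 * r + 1))) by lia.
  rewrite <- (tech_pow_Rmult (-1) l), <- (tech_pow_Rmult q l), <- (tech_pow_Rmult (2 * q) (S r)).
  rewrite <- !(tech_pow_Rmult x).
  replace (INR (S r + l)) with (INR (S r) + INR l) in P by (now rewrite plus_INR).
  transitivity ((-1) ^ l * (2 * q) ^ S r * PI / (2 * q * q ^ l * x ^ (2 * r + 1)) *
    (INR (S r) * I_poly l (S r) x)).
  + rewrite P. field. lra.
  + field. lra.
Qed.

(** * Reduction of I_l to a single period *)

Lemma RInt_even_2PI (h : R -> R) :
  (forall x, continuous h x) -> (forall x, h (- x) = h x) ->
  (forall x, h (x + 2 * PI) = h x) -> RInt h 0 (2 * PI) = 2 * RInt h 0 PI.
Proof.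
intros Hc He Hp.
assert (Ih : forall a b, ex_RInt h a b).
{ intros a b. apply (ex_RInt_continuous (V := R_CompleteNormedModule)). intros x _. apply Hc. }
rewrite <- (RInt_Chasles h 0 PI (2 * PI)) by apply Ih.
assert (E : RInt h PI (2 * PI) = RInt h 0 PI).
{ assert (L := is_RInt_comp_lin h (-1) (2 * PI) PI 0 (RInt h PI (2 * PI))).
  replace (-1 * PI + 2 * PI) with PI in L by ring.
  replace (-1 * 0 + 2 * PI) with (2 * PI) in L by ring.
  specialize (L (RInt_correct (V := R_CompleteNormedModule) _ _ _ (Ih _ _))).
  apply (is_RInt_swap (V := R_NormedModule)), (is_RInt_opp (V := R_NormedModule)) in L.
  rewrite opp_opp in L. rewrite <- (is_RInt_unique _ _ _ _ L).
  apply RInt_ext. intros x _. rewrite Hp, <- He.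
  unfold opp, scal; simpl; unfold mult; simpl.
  replace (- (-1 * x)) with x by ring. ring. }
rewrite E. unfold plus; simpl. ring.
Qed.

(** The substitution x = 2nt sweeps n full periods, each worth two copies of [0, pi] by evenness;
    these 2n copies cancel the Jacobian 1/(2n). *)
Lemma RInt_even_periodic (h : R -> R) (n : nat) : (1 <= n)%nat ->
  (forall x, continuous h x) -> (forall x, h (- x) = h x) ->
  (forall x, h (x + 2 * PI) = h x) ->
  RInt (fun t => h (2 * INR n * t)) 0 PI = RInt h 0 PI.
Proof.
intros Hn Hc He Hp.
assert (Ih : forall a b, ex_RInt h a b).
{ intros a b. apply (ex_RInt_continuous (V := R_CompleteNormedModule)). intros x _. apply Hc. }
assert (Hper : forall x (k : nat), h (x + INR k * (2 * PI)) = h x).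
{ intros x k. induction k as [|k IH]; [simpl; f_equal; ring|].
  rewrite S_INR. replace (x + (INR k + 1) * (2 * PI)) with (x + INR k * (2 * PI) + 2 * PI) by ring.
  now rewrite Hp. }
assert (H2 := RInt_even_2PI h Hc He Hp).
assert (HN : forall k, RInt h 0 (INR k * (2 * PI)) = INR k * (2 * RInt h 0 PI)).
{ induction k as [|k IH].
  - simpl. rewrite Rmult_0_l, RInt_point. unfold zero; simpl. ring.
  - rewrite <- (RInt_Chasles h 0 (INR k * (2 * PI))) by apply Ih.
    rewrite IH. rewrite <- H2.
    assert (E : RInt h (INR k * (2 * PI)) (INR (S k) * (2 * PI)) = RInt h 0 (2 * PI)).
    { assert (L := is_RInt_comp_lin h 1 (INR k * (2 * PI)) 0 (2 * PI)
         (RInt h (INR k * (2 * PI)) (INR (S k) * (2 * PI)))).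
      replace (1 * 0 + INR k * (2 * PI)) with (INR k * (2 * PI)) in L by ring.
      replace (1 * (2 * PI) + INR k * (2 * PI)) with (INR (S k) * (2 * PI)) in L
        by (rewrite S_INR; ring).
      specialize (L (RInt_correct (V := R_CompleteNormedModule) _ _ _ (Ih _ _))).
      rewrite <- (is_RInt_unique _ _ _ _ L).
      apply RInt_ext. intros x _. rewrite Hper.
      unfold scal; simpl; unfold mult; simpl. now rewrite !Rmult_1_l. }
    rewrite E, S_INR. unfold plus; simpl. ring. }
assert (Hn0 : 0 < INR n) by (apply lt_0_INR; lia).
apply Rmult_eq_reg_l with (2 * INR n); [|lra].
assert (L := is_RInt_comp_lin h (2 * INR n) 0 0 PI (RInt h 0 (INR n * (2 * PI)))).
replace (2 * INR n * 0 + 0) with 0 in L by ring.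
replace (2 * INR n * PI + 0) with (INR n * (2 * PI)) in L by ring.
specialize (L (RInt_correct (V := R_CompleteNormedModule) _ _ _ (Ih _ _))).
apply (is_RInt_scal (V := R_NormedModule) _ _ _ (/ (2 * INR n))) in L.
rewrite HN in L. unfold scal in L; simpl in L; unfold mult in L; simpl in L.
rewrite (is_RInt_unique (V := R_CompleteNormedModule) (fun t => h (2 * INR n * t)) 0 PI
  (/ (2 * INR n) * (INR n * (2 * RInt h 0 PI)))).
- field. lra.
- revert L. apply is_RInt_ext. intros x _. rewrite Rplus_0_r. R_eq. field. lra.
Qed.

Lemma a_coef_gt_1 (rho : R) (j : nat) : 1 < rho -> (1 <= j)%nat -> 1 < a_coef rho j.
Proof.
intros Hr Hj. apply half_sum_inv_gt_1. destruct j as [|j]; [lia|]. now apply Rlt_pow_R1; [|lia].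
Qed.

Lemma cos_INR_periodic (l : nat) (x : R) : cos (INR l * (x + 2 * PI)) = cos (INR l * x).
Proof.
replace (INR l * (x + 2 * PI)) with (INR l * x + 2 * INR l * PI) by ring. apply cos_period.
Qed.

Lemma I_int_V (n s : nat) (rho : R) (l : nat) : (1 <= n)%nat -> 1 < rho ->
  I_int n s rho l = V_int (a_coef rho (2 * n)) l (2 * s).
Proof.
intros Hn Hr. assert (Ha := a_coef_gt_1 rho (2 * n) Hr ltac:(lia)).
unfold I_int, V_int.
rewrite <- (RInt_even_periodic
  (fun x => cos (INR l * x) / (a_coef rho (2 * n) + cos x) ^ (2 * s)) n Hn).
- apply RInt_ext. intros x _.
  now replace (2 * INR n * INR l * x) with (INR l * (2 * INR n * x)) by ring.
- intros x. now apply continuous_V_int.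
- intros x. rewrite Ropp_mult_distr_r_reverse, !cos_neg. reflexivity.
- intros x. rewrite cos_INR_periodic. f_equal. f_equal. f_equal.
  generalize (cos_INR_periodic 1 x). simpl. now rewrite !Rmult_1_l.
Qed.

Lemma I_int_closed (n s : nat) (rho : R) (l : nat) :
  (1 <= n)%nat -> (1 <= s)%nat -> 1 < rho -> I_int n s rho l = I_closed n s rho l.
Proof.
intros Hn Hs Hr. rewrite I_int_V by assumption. unfold a_coef, I_closed.
replace (2 * s)%nat with (S (2 * s - 1)) at 1 by lia.
rewrite V_int_closed.
2: { apply Rlt_pow_R1; [exact Hr|lia]. }
replace (S (2 * s - 1)) with (2 * s)%nat by lia.
replace ((rho ^ (2 * n)) ^ 2) with (rho ^ (4 * n)) by (rewrite <- pow_mult; f_equal; lia).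
replace ((rho ^ (2 * n)) ^ l) with (rho ^ (2 * n * l)) by (now rewrite <- pow_mult).
replace (2 * (2 * s - 1) + 1)%nat with (4 * s - 1)%nat by lia.
unfold I_poly. f_equal. f_equal. f_equal. apply sum_n_ext. intros m.
replace (2 * s - 1 + l)%nat with (2 * s + l - 1)%nat by lia.
replace (2 * (2 * s - 1) - m)%nat with (4 * s - m - 2)%nat by lia. reflexivity.
Qed.

(** * The L^1 norm of the kernel *)

Lemma ex_RInt_cont (f : R -> R) (a b : R) : (forall x, continuous f x) -> ex_RInt f a b.
Proof.
intros H. apply (ex_RInt_continuous (V := R_CompleteNormedModule)). intros x _. apply H.
Qed.

(** The integral of the square of f minus its mean value [y] over [a, b] is nonnegative. *)
Lemma RInt_cauchy_schwarz (f : R -> R) (a b : R) : a < b -> (forall x, continuous f x) ->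
  RInt f a b <= sqrt ((b - a) * RInt (fun x => f x ^ 2) a b).
Proof.
intros Hab Hf.
assert (Hf2 : forall x, continuous (fun x => f x ^ 2) x).
{ intros x. apply continuous_ext with (fun x => f x * f x); [intros; simpl; ring|].
  now apply (continuous_mult (K := R_AbsRing)). }
set (J := RInt (fun x => f x ^ 2) a b). set (I := RInt f a b).
assert (H1 : is_RInt f a b I) by now apply (RInt_correct (V := R_CompleteNormedModule)), ex_RInt_cont.
assert (H2 : is_RInt (fun x => f x ^ 2) a b J)
  by now apply (RInt_correct (V := R_CompleteNormedModule)), ex_RInt_cont.
set (y := I / (b - a)).
assert (H3 := is_RInt_plus (V := R_NormedModule) _ _ _ _ _ _
  (is_RInt_minus (V := R_NormedModule) _ _ _ _ _ _ H2
    (is_RInt_scal (V := R_NormedModule) _ _ _ (2 * y) _ H1))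
  (is_RInt_const (V := R_NormedModule) a b (y ^ 2))).
assert (P : 0 <= (J - 2 * y * I) + (b - a) * y ^ 2).
{ apply (is_RInt_ge_0 _ a b _ (Rlt_le _ _ Hab) H3). intros x _.
  unfold minus, plus, opp, scal; simpl; unfold mult; simpl.
  replace (f x * (f x * 1) + - (2 * y * f x) + y * (y * 1)) with ((f x - y) ^ 2) by ring.
  apply pow2_ge_0. }
assert (Q : I ^ 2 <= (b - a) * J).
{ replace (J - 2 * y * I + (b - a) * y ^ 2) with (J - I ^ 2 / (b - a)) in P
    by (unfold y; field; lra).
  apply (Rmult_le_compat_l (b - a)) in P; [|lra].
  replace ((b - a) * (J - I ^ 2 / (b - a))) with ((b - a) * J - I ^ 2) in P by (field; lra). lra. }
eapply Rle_trans; [apply Rle_abs|]. rewrite <- sqrt_Rsqr_abs. apply sqrt_le_1_alt.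
unfold Rsqr. lra.
Qed.

Lemma is_RInt_sum_n_m {V : NormedModule R_AbsRing} (f : nat -> R -> V) (I : nat -> V)
    (a b : R) (m n : nat) :
  (m <= n)%nat -> (forall k, (m <= k <= n)%nat -> is_RInt (f k) a b (I k)) ->
  is_RInt (fun t => sum_n_m (fun k => f k t) m n) a b (sum_n_m I m n).
Proof.
intros Hmn H. induction n as [|n IH].
- replace m with O by lia.
  rewrite sum_n_n. apply is_RInt_ext with (f O); [intros; now rewrite sum_n_n|]. apply H. lia.
- destruct (Nat.eq_dec m (S n)) as [->|N].
  + rewrite sum_n_n. apply is_RInt_ext with (f (S n)); [intros; now rewrite sum_n_n|].
    apply H. lia.
  + rewrite sum_n_Sm by lia.
    apply is_RInt_ext with (fun t => plus (sum_n_m (fun k => f k t) m n) (f (S n) t)).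
    { intros t _. now rewrite sum_n_Sm by lia. }
    apply (is_RInt_plus (V := V)); [apply IH; [lia|intros; apply H; lia]|apply H; lia].
Qed.

Lemma sum_n_rev (a : nat -> R) (n : nat) : sum_n a n = sum_n (fun k => a (n - k)%nat) n.
Proof.
revert a. induction n as [|n IH]; intros a; [now rewrite !sum_O|].
rewrite sum_n_first, IH, sum_Sn. replace (S n - S n)%nat with O by lia.
rewrite (sum_n_Rext (fun k => a (S n - k)%nat) (fun k => a (S (n - k)))).
- change plus with Rplus. R_eq. ring.
- intros k Hk. f_equal. lia.
Qed.

(** * The squared modulus of a trigonometric sum *)

Definition square_sum (c : nat -> R) (q psi : R) (s : nat) : R :=
  sum_n_m (fun k => c k ^ 2 * q ^ (2 * k)) 0 s +
  2 * sum_n_m (fun l => sum_n_m (fun i => c i * c (i + l)%nat * q ^ (2 * i + l)) 0 (s - l) *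
        cos (INR l * psi)) 1 s.

(** On the left stands the squared modulus of the sum of c_k q^k e^(ik psi). The products of the
    terms i and i + l with their conjugates contribute cos(l psi), so grouping by the difference l
    prepares the integration that turns each cosine into I_l. *)
Lemma square_sum_eq (c : nat -> R) (q psi : R) (s : nat) :
  sum_n (fun k => c k * q ^ k * cos (INR k * psi)) s ^ 2 +
  sum_n (fun k => c k * q ^ k * sin (INR k * psi)) s ^ 2 = square_sum c q psi s.
Proof.
unfold square_sum. induction s as [|s IH].
- rewrite !sum_O, sum_n_n, sum_n_m_zero by lia. unfold zero; simpl.
  rewrite Rmult_0_l, cos_0, sin_0. ring.
- rewrite !sum_Sn. change plus with Rplus.
  set (X := sum_n (fun k => c k * q ^ k * cos (INR k * psi)) s) in *.
  set (Y := sum_n (fun k => c k * q ^ k * sin (INR k * psi)) s) in *.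
  rewrite (sum_n_Sm _ 0 s) by lia. change plus with Rplus.
  set (E1 := sum_n_m _ 0 s) in *.
  (* The new index s + 1 pairs with i <= s at the difference l = s + 1 - i: every old class l gains
     one product, and the class l = s + 1 is new. Reversing the order of the last sum makes l its
     summation index. *)
  assert (Hcross : sum_n_m (fun l => sum_n_m (fun i => c i * c (i + l)%nat * q ^ (2 * i + l)) 0
      (S s - l) * cos (INR l * psi)) 1 (S s) =
    sum_n_m (fun l => sum_n_m (fun i => c i * c (i + l)%nat * q ^ (2 * i + l)) 0 (s - l) *
        cos (INR l * psi)) 1 s +
    sum_n (fun i => c i * c (S s) * q ^ (i + S s) * cos (INR (S s - i) * psi)) s).
  { rewrite (sum_n_rev (fun i => c i * c (S s) * q ^ (i + S s) * cos (INR (S s - i) * psi)) s).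
    assert (Hs : forall j, (j <= s)%nat ->
      sum_n_m (fun l => sum_n_m (fun i => c i * c (i + l)%nat * q ^ (2 * i + l)) 0
        (S s - l) * cos (INR l * psi)) 1 j =
      sum_n_m (fun l => sum_n_m (fun i => c i * c (i + l)%nat * q ^ (2 * i + l)) 0 (s - l) *
        cos (INR l * psi)) 1 j +
      sum_n_m (fun l => c (S s - l)%nat * c (S s) * q ^ (S s - l + S s) * cos (INR l * psi)) 1 j).
    { intros j Hj. change Rplus with (@plus R_AbelianGroup). rewrite <- sum_n_m_plus.
      apply sum_n_m_ext_loc. intros l Hl. replace (S s - l)%nat with (S (s - l)) by lia.
      rewrite sum_n_Sm by lia. change plus with Rplus.
      replace (S (s - l) + l)%nat with (S s) by lia.
      replace (2 * S (s - l) + l)%nat with (S (s - l) + S s)%nat by lia. R_eq. ring. }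
    rewrite (sum_n_Sm _ 1 s) by lia. rewrite Hs by lia.
    replace (S s - S s)%nat with O by lia. rewrite sum_n_n.
    unfold sum_n.
    rewrite (sum_n_m_ext_loc (fun k => c (s - k)%nat * c (S s) * q ^ (s - k + S s) *
        cos (INR (S s - (s - k)) * psi))
      (fun k => (fun l => c (S s - l)%nat * c (S s) * q ^ (S s - l + S s) * cos (INR l * psi)) (S k))).
    2: { intros k Hk. replace (S s - (s - k))%nat with (S k) by lia. reflexivity. }
    rewrite (sum_n_m_S (fun l => c (S s - l)%nat * c (S s) * q ^ (S s - l + S s) * cos (INR l * psi)) 0 s).
    rewrite (sum_n_Sm (fun l => c (S s - l)%nat * c (S s) * q ^ (S s - l + S s) * cos (INR l * psi)) 1 s) by lia.
    change plus with Rplus. replace (S s - S s)%nat with O by lia. simpl (0 + _)%nat.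
    simpl (2 * 0 + S s)%nat. R_eq. ring. }
  rewrite Hcross.
  replace (E1 + c (S s) ^ 2 * q ^ (2 * S s) + 2 * (sum_n_m (fun l => sum_n_m (fun i => c i * c (i + l)%nat * q ^ (2 * i + l)) 0 (s - l) *
        cos (INR l * psi)) 1 s + sum_n (fun i => c i * c (S s) * q ^ (i + S s) * cos (INR (S s - i) * psi)) s))
   with ((E1 + 2 * sum_n_m (fun l => sum_n_m (fun i => c i * c (i + l)%nat * q ^ (2 * i + l)) 0 (s - l) *
        cos (INR l * psi)) 1 s) + c (S s) ^ 2 * q ^ (2 * S s) +
        2 * sum_n (fun i => c i * c (S s) * q ^ (i + S s) * cos (INR (S s - i) * psi)) s) by ring.
  rewrite <- IH.
  assert (Hc : sum_n (fun i => c i * c (S s) * q ^ (i + S s) * cos (INR (S s - i) * psi)) s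
    = c (S s) * q ^ S s * cos (INR (S s) * psi) * X + c (S s) * q ^ S s * sin (INR (S s) * psi) * Y).
  { unfold X, Y. rewrite <- !sum_n_Rmult_l, <- sum_n_Rplus. apply sum_n_Rext. intros i Hi.
    rewrite minus_INR by lia.
    replace ((INR (S s) - INR i) * psi) with (INR (S s) * psi - INR i * psi) by ring.
    rewrite cos_minus, pow_add.
    generalize (INR (S s)) (q ^ S s) (c (S s)). intros r1 r2 r3. ring. }
  rewrite Hc. replace (q ^ (2 * S s)) with (q ^ S s * q ^ S s) by (rewrite <- pow_add; f_equal; lia).
  assert (T := sin2_cos2 (INR (S s) * psi)). unfold Rsqr in T.
  set (cc := cos (INR (S s) * psi)) in *. set (ss := sin (INR (S s) * psi)) in *.
  set (w := c (S s) * q ^ S s).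
  replace (c (S s) ^ 2 * (q ^ S s * q ^ S s)) with (w ^ 2 * (ss * ss + cc * cc)) by (rewrite T; unfold w; ring).
  ring.
Qed.

Lemma polar_mult (r1 r2 t1 t2 : R) : (polar r1 t1 * polar r2 t2)%C = polar (r1 * r2) (t1 + t2).
Proof.
rewrite !polar_pair. unfold Cmult; simpl. rewrite cos_plus, sin_plus. f_equal; ring.
Qed.

Lemma polar_0 : polar 1 0 = 1.
Proof. rewrite polar_pair, cos_0, sin_0. unfold RtoC. f_equal; ring. Qed.

Lemma polar_pow (r t : R) (k : nat) : (polar r t ^ k)%C = polar (r ^ k) (INR k * t).
Proof.
induction k as [|k IH].
- simpl. now rewrite Rmult_0_l, polar_0.
- rewrite Cpow_S, IH, polar_mult, S_INR, <- tech_pow_Rmult. f_equal. ring.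
Qed.

Lemma polar_neq_0 (r t : R) : r <> 0 -> polar r t <> 0.
Proof.
intros H. apply Cmult_neq_0; [now apply RtoC_neq_0|apply cis_neq_0].
Qed.

Lemma polar_inv (r t : R) : r <> 0 -> (/ polar r t)%C = polar (/ r) (- t).
Proof.
intros H. assert (N := polar_neq_0 r t H).
transitivity (/ polar r t * (polar r t * polar (/ r) (- t)))%C.
- rewrite polar_mult. replace (r * / r) with 1 by (field; exact H).
  rewrite Rplus_opp_r, polar_0. ring.
- field. exact N.
Qed.

Lemma ellipse_point_joukowski (rho t : R) : ellipse_point rho t = joukowski (polar rho t).
Proof.
unfold ellipse_point, joukowski. rewrite RtoC_inv by lra. reflexivity.
Qed.

(** The P of the overview. By [cheb_pow_sum], on |u| = 1 the power T_n^(2s+1) is 4^(-s) times the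
    mean of P(u) and P(1/u), so P collects its negative exponents, doubled. *)
Definition cheb_tail (n s : nat) (u : C) : C :=
  Csum_n
   (fun k => RtoC (Binomial.C (2 * s + 1) k) * / u ^ ((2 * s + 1 - 2 * k) * n))%C s.

Lemma rho_ns_joukowski (n s : nat) (u : C) : 1 < Cmod u ->
  rho_ns n s (joukowski u) = (RtoC (/ 4 ^ s) * (2 * PI / (u - / u)) * cheb_tail n s u)%C.
Proof.
intros Hu. unfold rho_ns. rewrite wintC_cos.
2: { intros t Ht. apply continuous_Cdiv.
     - apply continuous_Cpow, continuous_RtoC, continuous_chebT.
     - apply continuous_Cminus; [apply continuous_const|apply continuous_RtoC, continuous_id].
     - rewrite <- (cos_acos t) by exact Ht. now apply joukowski_minus_cos_neq_0. }
transitivity (CRInt (fun p => RtoC (/ 4 ^ s) * Csum_n (fun k =>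
   RtoC (Binomial.C (2 * s + 1) k) * (RtoC (cos (INR ((2 * s + 1 - 2 * k) * n) * p)) /
     (joukowski u - RtoC (cos p)))) s)%C 0 PI).
{ apply CRInt_ext. intros p. rewrite <- RtoC_pow, cheb_pow_sum, RtoC_mult, RtoC_sum_n.
  unfold Cdiv. rewrite <- Cmult_assoc. f_equal.
  rewrite Cmult_comm, <- sum_n_Cmult_l. apply sum_n_Cext. intros k _. rewrite RtoC_mult. ring. }
assert (Hc : forall (k : nat) t, continuousC (fun p =>
  RtoC (Binomial.C (2 * s + 1) k) * (RtoC (cos (INR ((2 * s + 1 - 2 * k) * n) * p)) /
     (joukowski u - RtoC (cos p))))%C t).
{ intros k t. apply continuous_Cmult; [apply continuous_const|now apply continuous_cheb_cauchy]. }
rewrite CRInt_Cmult.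
2: { intros t. apply (continuous_sum_n_C (fun k p => RtoC (Binomial.C (2 * s + 1) k) *
       (RtoC (cos (INR ((2 * s + 1 - 2 * k) * n) * p)) / (joukowski u - RtoC (cos p))))%C).
     intros k. apply Hc. }
rewrite <- Cmult_assoc. f_equal.
rewrite (CRInt_sum_n (fun k p => RtoC (Binomial.C (2 * s + 1) k) *
       (RtoC (cos (INR ((2 * s + 1 - 2 * k) * n) * p)) / (joukowski u - RtoC (cos p))))%C) by exact Hc.
unfold cheb_tail. rewrite <- sum_n_Cmult_l. apply sum_n_Cext. intros k _.
rewrite CRInt_Cmult by (intros t; now apply continuous_cheb_cauchy).
change (CRInt _ 0 PI) with (cheb_cauchy u ((2 * s + 1 - 2 * k) * n)).
rewrite cheb_cauchy_value by exact Hu. ring.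
Qed.

(** A zero would give u^(2n) = -1 and hence |u| = 1. *)
Lemma chebTC_joukowski_neq_0 (n : nat) (u : C) :
  (1 <= n)%nat -> 1 < Cmod u -> chebTC n (joukowski u) <> 0.
Proof.
intros Hn Hu E. assert (H0 := Cmod_gt_1_neq_0 u Hu). rewrite chebTC_joukowski in E by exact H0.
assert (N := Cpow_nz u n H0).
assert (E2 : (u ^ n * u ^ n = - (1))%C).
{ replace (u ^ n * u ^ n)%C with (2 * u ^ n * (/ 2 * (u ^ n + / u ^ n)) - 1)%C by (field; exact N).
  rewrite E. ring. }
apply (f_equal Cmod) in E2. rewrite Cmod_mult, Cmod_opp, Cmod_1, Cmod_pow in E2.
assert (1 < Cmod u ^ n) by (apply Rlt_pow_R1; [exact Hu|lia]). nra.
Qed.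

Lemma Cmod_sqr (z : C) : Cmod z ^ 2 = Re z ^ 2 + Im z ^ 2.
Proof. unfold Cmod. rewrite pow2_sqrt; [reflexivity|]. destruct z as [x y]. simpl. nra. Qed.

(** The source of the denominator of [I_int]: |u^n + u^(-n)|^2 = r^(2n) + r^(-2n) + 2 cos(2nt). *)
Lemma Cmod_chebTC_sqr (n : nat) (r t : R) : 0 < r ->
  Cmod (chebTC n (joukowski (polar r t))) ^ 2 =
  / 2 * (a_coef r (2 * n) + cos (2 * INR n * t)).
Proof.
intros Hr. assert (Hn := pow_lt r n Hr).
rewrite chebTC_joukowski by (apply polar_neq_0; lra).
rewrite polar_pow, polar_inv by lra. rewrite !polar_pair, cos_neg, sin_neg, Cmod_sqr.
unfold a_coef. replace (r ^ (2 * n)) with (r ^ n * r ^ n) by (rewrite <- pow_add; f_equal; lia).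
replace (2 * INR n * t) with (2 * (INR n * t)) by ring. rewrite cos_2a.
assert (T := sin2_cos2 (INR n * t)). unfold Rsqr in T.
rewrite <- RtoC_inv by lra. simpl.
set (x := cos (INR n * t)) in *. set (y := sin (INR n * t)) in *. set (q := r ^ n) in *.
apply Rmult_eq_reg_l with (4 * q ^ 2); [|nra].
replace (4 * q ^ 2 * (/ 2 * (/ 2 * (q * q + / (q * q)) + (x * x - y * y))))
  with ((q ^ 4 + 1) * (y * y + x * x) + 2 * q ^ 2 * (x * x - y * y)) by (rewrite T; field; lra).
field. lra.
Qed.

Lemma sum_n_C_pair (x y : nat -> R) (n : nat) :
  Csum_n (fun k => (x k, y k)) n = (sum_n x n, sum_n y n).
Proof.
induction n as [|n IH]; [now rewrite !sum_O|]. now rewrite !sum_Sn, IH.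
Qed.

(** The factor pulled out becomes the power of rho in front of the bound. What is left has only
    nonnegative powers of u^(2n), which is the sum treated by [square_sum_eq] with q = r^(2n) and
    psi = 2nt. *)
Lemma cheb_tail_factor (n s : nat) (u : C) : u <> 0 ->
  cheb_tail n s u = (/ u ^ ((2 * s + 1) * n) *
   Csum_n (fun k => RtoC (Binomial.C (2 * s + 1) k) * u ^ (2 * n * k)) s)%C.
Proof.
intros Hu. unfold cheb_tail. rewrite <- sum_n_Cmult_l. apply sum_n_Cext. intros k Hk.
replace ((2 * s + 1) * n)%nat with ((2 * s + 1 - 2 * k) * n + 2 * n * k)%nat by nia.
rewrite Cpow_add_r. field. split; now apply Cpow_nz.
Qed.

Lemma Cmod_cheb_tail_sqr (n s : nat) (r t : R) : 0 < r ->
  Cmod (cheb_tail n s (polar r t)) ^ 2 =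
  / (r ^ ((2 * s + 1) * n)) ^ 2 *
  square_sum (Binomial.C (2 * s + 1)) (r ^ (2 * n)) (2 * INR n * t) s.
Proof.
intros Hr. assert (Hu := polar_neq_0 r t (Rgt_not_eq _ _ Hr)).
rewrite cheb_tail_factor by exact Hu.
rewrite Cmod_mult, Cmod_inv by (now apply Cpow_nz).
rewrite Rpow_mult_distr, Cmod_pow, Cmod_polar by lra. f_equal.
{ field. apply pow_nonzero. lra. }
rewrite <- square_sum_eq.
rewrite (sum_n_Cext _ (fun k =>
  (Binomial.C (2 * s + 1) k * (r ^ (2 * n)) ^ k * cos (INR k * (2 * INR n * t)),
   Binomial.C (2 * s + 1) k * (r ^ (2 * n)) ^ k * sin (INR k * (2 * INR n * t))))).
- rewrite sum_n_C_pair, Cmod_sqr. reflexivity.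
- intros k _. rewrite polar_pow, polar_pair, pow_mult, !mult_INR. change (INR 2) with 2.
  replace (2 * INR n * INR k * t) with (INR k * (2 * INR n * t)) by ring.
  unfold Cmult, RtoC; simpl. f_equal; ring.
Qed.

Definition Phi (n s : nat) (r t : R) : R :=
  Cmod (cheb_tail n s (polar r t) / chebTC n (joukowski (polar r t)) ^ (2 * s))%C.

Lemma hol_joukowski (u : C) : u <> 0 -> hol joukowski u.
Proof.
intros H. apply (hol_mult (fun _ => / 2)%C (fun w => w + / w)%C); [apply hol_const|].
apply hol_plus; [apply hol_id|]. apply hol_inv; [apply hol_id|exact H].
Qed.

Lemma hol_sum_n (f : nat -> C -> C) (n : nat) (u : C) : (forall k, hol (f k) u) ->
  hol (fun w => Csum_n (fun k => f k w) n) u.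
Proof.
intros H. induction n as [|n IH].
- apply hol_ext_loc with (f O); [|apply H]. apply filter_forall. intros w. now rewrite sum_O.
- apply hol_ext_loc with (fun w => Csum_n (fun k => f k w) n + f (S n) w)%C.
  + apply filter_forall. intros w. now rewrite sum_Sn.
  + apply hol_plus; [exact IH|apply H].
Qed.

Lemma hol_cheb_tail (n s : nat) (u : C) : u <> 0 -> hol (cheb_tail n s) u.
Proof.
intros H. apply (hol_sum_n (fun k w => RtoC (Binomial.C (2 * s + 1) k) *
   / w ^ ((2 * s + 1 - 2 * k) * n))%C).
intros k. apply (hol_mult (fun _ => RtoC (Binomial.C (2 * s + 1) k))); [apply hol_const|].
apply (hol_inv (fun w => w ^ _)%C); [apply hol_pow, hol_id|now apply Cpow_nz].
Qed.

Lemma hol_cheb_weight (n s : nat) (u : C) : (1 <= n)%nat -> 1 < Cmod u ->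
  hol (fun u => cheb_tail n s u / chebTC n (joukowski u) ^ (2 * s))%C u.
Proof.
intros Hn Hu. assert (H0 := Cmod_gt_1_neq_0 u Hu).
apply (hol_div (cheb_tail n s) (fun u => chebTC n (joukowski u) ^ (2 * s))%C).
- now apply hol_cheb_tail.
- apply (hol_pow (fun u => chebTC n (joukowski u))).
  apply (hol_comp (chebTC n) joukowski); [apply hol_chebTC|now apply hol_joukowski].
- now apply Cpow_nz, chebTC_joukowski_neq_0.
Qed.

Lemma continuous_Phi (n s : nat) (r t : R) : (1 <= n)%nat -> 1 < r -> continuous (Phi n s r) t.
Proof.
intros Hn Hr. apply continuous_Cmod.
apply (continuous_comp (polar r) (fun u => cheb_tail n s u / chebTC n (joukowski u) ^ (2 * s))%C);
 [apply continuous_polar|].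
apply hol_continuous, hol_cheb_weight; [exact Hn|]. rewrite Cmod_polar; lra.
Qed.

Lemma ellipse_speed (r t : R) : 1 < r ->
  Cmod (Derive (fun x => Re (ellipse_point r x)) t, Derive (fun x => Im (ellipse_point r x)) t)
  = / 2 * Cmod (polar r t - / polar r t).
Proof.
intros Hr.
assert (D1 : Derive (fun x => Re (ellipse_point r x)) t = (r + / r) / 2 * - sin t).
{ apply is_derive_unique. apply is_derive_ext with (f := fun x => (r + / r) / 2 * cos x).
  - intros x. rewrite ellipse_point_eq by lra. reflexivity.
  - auto_derive; [easy|ring]. }
assert (D2 : Derive (fun x => Im (ellipse_point r x)) t = (r - / r) / 2 * cos t).
{ apply is_derive_unique. apply is_derive_ext with (f := fun x => (r - / r) / 2 * sin x).
  - intros x. rewrite ellipse_point_eq by lra. reflexivity.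
  - auto_derive; [easy|ring]. }
rewrite D1, D2.
rewrite polar_inv by lra. rewrite !polar_pair, cos_neg, sin_neg.
rewrite <- (Rabs_pos_eq (/ 2)) at 1 by lra. rewrite <- Cmod_R, <- Cmod_mult.
unfold Cmod. f_equal. simpl. field. lra.
Qed.

Lemma L_ns_eq (n s : nat) (rho : R) : (1 <= n)%nat -> 1 < rho ->
  L_ns n s rho = / (2 * 4 ^ s) * RInt (Phi n s rho) 0 (2 * PI).
Proof.
intros Hn Hr. unfold L_ns, arclength_int.
assert (H4 : 0 < 4 ^ s) by (apply pow_lt; lra). assert (HPI := PI_RGT_0).
assert (E : RInt (fun t => Cmod (kernel n s (ellipse_point rho t)) *
  Cmod (Derive (fun x => Re (ellipse_point rho x)) t, Derive (fun x => Im (ellipse_point rho x)) t))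
  0 (2 * PI) = PI / 4 ^ s * RInt (Phi n s rho) 0 (2 * PI)).
{ change (PI / 4 ^ s * RInt (Phi n s rho) 0 (2 * PI))
    with (scal (PI / 4 ^ s) (RInt (Phi n s rho) 0 (2 * PI))).
  rewrite <- (RInt_scal (V := R_CompleteNormedModule)).
  2: { apply ex_RInt_cont. intros x. now apply continuous_Phi. }
  apply RInt_ext. intros t _. rewrite ellipse_speed by exact Hr.
  rewrite ellipse_point_joukowski. unfold kernel, Phi.
  assert (Hu : 1 < Cmod (polar rho t)) by (rewrite Cmod_polar; lra).
  rewrite rho_ns_joukowski by exact Hu. set (u := polar rho t) in *.
  assert (H0 := Cmod_gt_1_neq_0 u Hu). assert (H1 := Cmod_neq_1_sqr u Hu).
  assert (Nu : (u - / u)%C <> 0).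
  { intros Q. apply H1. replace (u * u - 1)%C with (u * (u - / u))%C by (field; exact H0).
    rewrite Q. ring. }
  assert (HT := Cpow_nz _ (2 * s) (chebTC_joukowski_neq_0 n u Hn Hu)).
  match goal with |- _ = scal ?x ?y => change (scal x y) with (x * y) end.
  rewrite !Cmod_div by assumption. rewrite !Cmod_mult, Cmod_div by assumption.
  assert (H4' := Rinv_0_lt_compat _ H4).
  rewrite Cmod_mult, !Cmod_R, (Rabs_pos_eq _ (Rlt_le _ _ H4')),
    (Rabs_pos_eq _ (Rlt_le _ _ Rlt_0_2)), (Rabs_pos_eq _ (Rlt_le _ _ HPI)).
  apply Cmod_gt_0 in Nu. apply Cmod_gt_0 in HT. R_eq. field. repeat split; lra. }
rewrite E. field. lra.
Qed.

Lemma Phi_sqr (n s : nat) (r t : R) : (1 <= n)%nat -> 1 < r ->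
  Phi n s r t ^ 2 = 4 ^ s / (r ^ ((2 * s + 1) * n)) ^ 2 *
   (square_sum (Binomial.C (2 * s + 1)) (r ^ (2 * n)) (2 * INR n * t) s /
     (a_coef r (2 * n) + cos (2 * INR n * t)) ^ (2 * s)).
Proof.
intros Hn Hr. unfold Phi.
assert (Hu : 1 < Cmod (polar r t)) by (rewrite Cmod_polar; lra).
rewrite Cmod_div by (now apply Cpow_nz, chebTC_joukowski_neq_0).
unfold Rdiv. rewrite Rpow_mult_distr, Cmod_cheb_tail_sqr by lra.
rewrite Cmod_pow.
assert (HT := chebTC_joukowski_neq_0 n _ Hn Hu). apply Cmod_gt_0 in HT.
assert (HT2 := Cmod_chebTC_sqr n r t ltac:(lra)).
set (T := Cmod (chebTC n (joukowski (polar r t)))) in *.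
assert (Hr1 : 0 < r ^ ((2 * s + 1) * n)) by (apply pow_lt; lra).
replace ((/ T ^ (2 * s)) ^ 2) with (/ (T ^ 2) ^ (2 * s)).
2: { rewrite pow_inv, <- !pow_mult. f_equal. f_equal. lia. }
rewrite HT2. rewrite Rpow_mult_distr.
replace ((/ 2) ^ (2 * s)) with (/ 4 ^ s).
2: { rewrite pow_inv, pow_mult. replace (2 ^ 2) with 4 by ring. reflexivity. }
assert (H4 : 0 < 4 ^ s) by (apply pow_lt; lra).
assert (HA : 0 < (a_coef r (2 * n) + cos (2 * INR n * t)) ^ (2 * s)).
{ apply pow_lt. apply den_pos. apply a_coef_gt_1; [exact Hr|lia]. }
field. lra.
Qed.

Definition err_sum (n s : nat) (rho : R) : R :=
  sum_n_m (fun k => Binomial.C (2 * s + 1) k ^ 2 * rho ^ (4 * n * k) * I_int n s rho 0) 0 s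
  + 2 * sum_n_m (fun l => rho ^ (2 * n * l) *
      sum_n_m (fun i => Binomial.C (2 * s + 1) i * Binomial.C (2 * s + 1) (i + l) *
                        rho ^ (4 * n * i) * I_int n s rho l) 0 (s - l)) 1 s.

Lemma is_RInt_I_int (n s : nat) (rho : R) (l : nat) : (1 <= n)%nat -> 1 < rho ->
  is_RInt (fun t => cos (INR l * (2 * INR n * t)) /
     (a_coef rho (2 * n) + cos (2 * INR n * t)) ^ (2 * s)) 0 PI (I_int n s rho l).
Proof.
intros Hn Hr. assert (Ha := a_coef_gt_1 rho (2 * n) Hr ltac:(lia)).
apply is_RInt_ext with (fun theta => cos (2 * INR n * INR l * theta) /
                     (a_coef rho (2 * n) + cos (2 * INR n * theta)) ^ (2 * s)).
{ intros x _. now replace (2 * INR n * INR l * x) with (INR l * (2 * INR n * x)) by ring. }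
apply (RInt_correct (V := R_CompleteNormedModule)), ex_RInt_cont. intros x.
apply (continuous_mult (K := R_AbsRing)); [apply continuous_cos_scal|].
apply (continuous_comp (fun x => 2 * INR n * x) (fun y => / (a_coef rho (2 * n) + cos y) ^ (2 * s))).
- apply (ex_derive_continuous (V := R_NormedModule)). generalize (INR n). intros. auto_derive. easy.
- now apply continuous_V_den.
Qed.

Lemma is_RInt_square_sum (n s : nat) (rho : R) : (1 <= n)%nat -> (1 <= s)%nat -> 1 < rho ->
  is_RInt (fun t => square_sum (Binomial.C (2 * s + 1)) (rho ^ (2 * n)) (2 * INR n * t) s /
     (a_coef rho (2 * n) + cos (2 * INR n * t)) ^ (2 * s)) 0 PI (err_sum n s rho).
Proof.
intros Hn Hs Hr.
set (c := Binomial.C (2 * s + 1)). set (q := rho ^ (2 * n)).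
set (h := fun l t => cos (INR l * (2 * INR n * t)) /
     (a_coef rho (2 * n) + cos (2 * INR n * t)) ^ (2 * s)).
assert (Hh : forall l, is_RInt (h l) 0 PI (I_int n s rho l)) by (intros; now apply is_RInt_I_int).
assert (H1 : is_RInt (fun t => sum_n_m (fun k => (c k ^ 2 * rho ^ (4 * n * k)) * h O t) 0 s) 0 PI
  (sum_n_m (fun k => c k ^ 2 * rho ^ (4 * n * k) * I_int n s rho 0) 0 s)).
{ apply (is_RInt_sum_n_m (V := R_NormedModule) (fun k t => (c k ^ 2 * rho ^ (4 * n * k)) * h O t)
    (fun k => c k ^ 2 * rho ^ (4 * n * k) * I_int n s rho 0)); [lia|].
  intros k _. apply (is_RInt_scal (V := R_NormedModule)), Hh. }
assert (H2 : is_RInt (fun t => sum_n_m (fun l => rho ^ (2 * n * l) * sum_n_m (fun i =>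
    (c i * c (i + l)%nat * rho ^ (4 * n * i)) * h l t) 0 (s - l)) 1 s) 0 PI
  (sum_n_m (fun l => rho ^ (2 * n * l) * sum_n_m (fun i =>
    (c i * c (i + l)%nat * rho ^ (4 * n * i)) * I_int n s rho l) 0 (s - l)) 1 s)).
{ apply (is_RInt_sum_n_m (V := R_NormedModule) (fun l t => rho ^ (2 * n * l) * sum_n_m (fun i =>
    (c i * c (i + l)%nat * rho ^ (4 * n * i)) * h l t) 0 (s - l))
   (fun l => rho ^ (2 * n * l) * sum_n_m (fun i =>
    (c i * c (i + l)%nat * rho ^ (4 * n * i)) * I_int n s rho l) 0 (s - l))); [lia|].
  intros l _. apply (is_RInt_scal (V := R_NormedModule)).
  apply (is_RInt_sum_n_m (V := R_NormedModule) (fun i t => (c i * c (i + l)%nat * rho ^ (4 * n * i)) * h l t)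
    (fun i => (c i * c (i + l)%nat * rho ^ (4 * n * i)) * I_int n s rho l)); [lia|].
  intros i _. apply (is_RInt_scal (V := R_NormedModule)), Hh. }
assert (H := is_RInt_plus (V := R_NormedModule) _ _ _ _ _ _ H1
  (is_RInt_scal (V := R_NormedModule) _ _ _ 2 _ H2)).
revert H. apply is_RInt_ext. intros t _.
match goal with |- plus ?x (scal 2 ?y) = _ => change (x + 2 * y =
  square_sum c q (2 * INR n * t) s / (a_coef rho (2 * n) + cos (2 * INR n * t)) ^ (2 * s)) end.
unfold square_sum, Rdiv. set (D := / (a_coef rho (2 * n) + cos (2 * INR n * t)) ^ (2 * s)).
assert (Mr : forall (f : nat -> R) i j y, sum_n_m f i j * y = sum_n_m (fun k => f k * y) i j).
{ intros f i j y. symmetry. apply (sum_n_m_mult_r (K := R_Ring)). }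
assert (Ml : forall (f : nat -> R) i j y, y * sum_n_m f i j = sum_n_m (fun k => y * f k) i j).
{ intros f i j y. symmetry. apply (sum_n_m_mult_l (K := R_Ring)). }
rewrite Rmult_plus_distr_r, Rmult_assoc, !Mr. f_equal.
- apply sum_n_m_ext. intros k. unfold h, Rdiv, q. fold D.
  rewrite Rmult_0_l, cos_0, <- pow_mult. replace (2 * n * (2 * k))%nat with (4 * n * k)%nat by lia.
  R_eq. ring.
- f_equal. apply sum_n_m_ext. intros l. rewrite !Mr, Ml. apply sum_n_m_ext. intros i.
  unfold h, Rdiv, q. fold D. rewrite <- pow_mult.
  replace (2 * n * (2 * i + l))%nat with (2 * n * l + 4 * n * i)%nat by lia.
  rewrite pow_add. R_eq. ring.
Qed.

Lemma L_ns_le_err_bound (n s : nat) (rho : R) :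
  (1 <= n)%nat -> (1 <= s)%nat -> 1 < rho -> L_ns n s rho <= err_bound n s rho.
Proof.
intros Hn Hs Hr. rewrite L_ns_eq by assumption.
assert (HPI := PI_RGT_0). assert (H4 : 0 < 4 ^ s) by (apply pow_lt; lra).
assert (H2 : 0 < 2 ^ s) by (apply pow_lt; lra).
assert (E42 : 4 ^ s = 2 ^ s * 2 ^ s).
{ rewrite <- Rpow_mult_distr. f_equal; ring. }
assert (HP : 0 < rho ^ ((2 * s + 1) * n)) by (apply pow_lt; lra).
set (P := rho ^ ((2 * s + 1) * n)) in *.
assert (CS := RInt_cauchy_schwarz (Phi n s rho) 0 (2 * PI) ltac:(lra)
  (fun x => continuous_Phi n s rho x Hn Hr)).
assert (H1 := is_RInt_scal (V := R_NormedModule) _ _ _ (4 ^ s / P ^ 2) _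
  (is_RInt_square_sum n s rho Hn Hs Hr)).
assert (E1 : RInt (fun x => Phi n s rho x ^ 2) 0 PI = 4 ^ s / P ^ 2 * err_sum n s rho).
{ apply is_RInt_unique. revert H1. apply is_RInt_ext. intros t _. now rewrite Phi_sqr. }
assert (E2 : RInt (fun x => Phi n s rho x ^ 2) 0 (2 * PI) = 2 * RInt (fun x => Phi n s rho x ^ 2) 0 PI).
(* Evenness and periodicity are read off [Phi_sqr], where t enters only through cosines of multiples
   of 2nt. *)
{ apply RInt_even_2PI.
  - intros x. apply continuous_ext with (fun x => Phi n s rho x * Phi n s rho x);
      [intros; simpl; ring|].
    apply (continuous_mult (K := R_AbsRing)); now apply continuous_Phi.
  - intros x. rewrite !Phi_sqr by assumption.
    replace (2 * INR n * - x) with (- (2 * INR n * x)) by ring.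
    unfold square_sum. rewrite cos_neg. do 4 f_equal.
    apply sum_n_m_ext. intros l. f_equal. rewrite Ropp_mult_distr_r_reverse. apply cos_neg.
  - intros x. rewrite !Phi_sqr by assumption.
    replace (2 * INR n * (x + 2 * PI)) with (2 * INR n * x + 2 * INR (2 * n) * PI)
      by (rewrite mult_INR; simpl; ring).
    unfold square_sum. rewrite cos_period. do 4 f_equal.
    apply sum_n_m_ext. intros l. f_equal.
    replace (INR l * (2 * INR n * x + 2 * INR (2 * n) * PI))
      with (INR l * (2 * INR n * x) + 2 * INR (l * (2 * n)) * PI) by (rewrite !mult_INR; ring).
    apply cos_period. }
rewrite E2, E1 in CS. rewrite Rminus_0_r in CS.
apply Rle_trans with (/ (2 * 4 ^ s) * sqrt (2 * PI * (2 * (4 ^ s / P ^ 2 * err_sum n s rho)))).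
{ apply Rmult_le_compat_l; [|exact CS]. left. apply Rinv_0_lt_compat. lra. }
(* Only constants are left: 2 pi from the Cauchy-Schwarz inequality and 2 from evenness give sqrt(4
   pi 4^s) = 2 2^s sqrt(pi), which is divided by the 2 4^s in front. *)
apply Req_le.
replace (2 * PI * (2 * (4 ^ s / P ^ 2 * err_sum n s rho)))
  with ((2 * 2 ^ s / P) ^ 2 * PI * err_sum n s rho) by (rewrite E42; field; lra).
assert (Hpos : 0 <= 2 * 2 ^ s / P) by (left; apply Rdiv_lt_0_compat; lra).
rewrite sqrt_mult_alt by (apply Rmult_le_pos; [apply pow2_ge_0|lra]).
rewrite sqrt_mult_alt by apply pow2_ge_0.
rewrite sqrt_pow2 by exact Hpos.
unfold err_bound. fold (err_sum n s rho). fold P. rewrite E42. field. lra.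
Qed.

(** * Analytic functions and Hermite interpolation *)

Definition analytic_at (F : C -> C) (z0 : C) : Prop :=
  exists (a : nat -> C) (r : R), 0 < r /\
    forall z, Cmod (z - z0) < r ->
      Cpseries a (z - z0)%C (F z).

Lemma analytic_at_hol (F : C -> C) (z0 : C) : analytic_at F z0 -> hol F z0.
Proof.
intros (a & r & Hr & H). apply (C_pseries_hol a r F z0 z0 H).
replace (z0 - z0)%C with (RtoC 0) by ring. now rewrite Cmod_0.
Qed.

Lemma analytic_at_C_derive_n (F : C -> C) (z0 : C) (i : nat) :
  analytic_at F z0 -> analytic_at (C_derive_n F i) z0.
Proof.
intros (a & r & Hr & H). eexists; exists r; split; [exact Hr|].
exact (C_derive_n_pseries a r F z0 i H).
Qed.

(** [C_derive] is additive only where both derivatives exist. Reading all derivatives at the centre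
    off the Taylor coefficients gives additivity at every order at once. *)
Lemma analytic_at_plus (F G : C -> C) (z0 : C) :
  analytic_at F z0 -> analytic_at G z0 ->
  analytic_at (fun z => F z + G z)%C z0 /\
  forall i, C_derive_n (fun z => F z + G z)%C i z0 = (C_derive_n F i z0 + C_derive_n G i z0)%C.
Proof.
intros (a & r & Hr & Ha) (b & r' & Hr' & Hb).
assert (Hm : 0 < Rmin r r') by now apply Rmin_pos.
assert (Ha' : forall z, Cmod (z - z0) < Rmin r r' ->
  Cpseries a (z - z0)%C (F z)).
{ intros z Hz. apply Ha. eapply Rlt_le_trans; [exact Hz|apply Rmin_l]. }
assert (Hb' : forall z, Cmod (z - z0) < Rmin r r' ->
  Cpseries b (z - z0)%C (G z)).
{ intros z Hz. apply Hb. eapply Rlt_le_trans; [exact Hz|apply Rmin_r]. }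
assert (Hs : forall z, Cmod (z - z0) < Rmin r r' ->
  Cpseries (fun k => (a k + b k)%C) (z - z0)%C (F z + G z)%C).
{ intros z Hz. exact (is_pseries_plus (V := C_NormedModule) _ _ _ _ _ (Ha' z Hz) (Hb' z Hz)). }
split.
- eexists; eexists; split; [exact Hm|exact Hs].
- intros i. rewrite (C_derive_n_center _ _ _ _ i Hs Hm), (C_derive_n_center _ _ _ _ i Ha' Hm),
    (C_derive_n_center _ _ _ _ i Hb' Hm). ring.
Qed.

Lemma analytic_at_scal (c : C) (F : C -> C) (z0 : C) :
  analytic_at F z0 ->
  analytic_at (fun z => c * F z)%C z0 /\
  forall i, C_derive_n (fun z => c * F z)%C i z0 = (c * C_derive_n F i z0)%C.
Proof.
intros (a & r & Hr & Ha).
assert (Hs : forall z, Cmod (z - z0) < r ->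
  Cpseries (fun k => (c * a k)%C) (z - z0)%C (c * F z)%C).
{ intros z Hz. apply (is_pseries_scal (V := C_NormedModule)); [apply Cmult_comm|now apply Ha]. }
split.
- eexists; eexists; split; [exact Hr|exact Hs].
- intros i. rewrite (C_derive_n_center _ _ _ _ i Hs Hr), (C_derive_n_center _ _ _ _ i Ha Hr). ring.
Qed.

Lemma analytic_at_sum_n_m (F : nat -> C -> C) (z0 : C) (m n : nat) :
  (m <= n)%nat -> (forall k, (m <= k <= n)%nat -> analytic_at (F k) z0) ->
  analytic_at (fun z => Csum_n_m (fun k => F k z) m n) z0 /\
  forall i, C_derive_n (fun z => Csum_n_m (fun k => F k z) m n) i z0 =
     Csum_n_m (fun k => C_derive_n (F k) i z0) m n.
Proof.
intros Hmn H. induction n as [|n IH].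
- replace m with O in * by lia.
  replace (fun z => Csum_n_m (fun k => F k z) 0 0) with (F O).
  + split; [apply H; lia|]. intros i. now rewrite sum_n_n.
  + apply functional_extensionality. intros z. now rewrite sum_n_n.
- destruct (Nat.eq_dec m (S n)) as [->|N].
  + replace (fun z => Csum_n_m (fun k => F k z) (S n) (S n)) with (F (S n)).
    * split; [apply H; lia|]. intros i. now rewrite sum_n_n.
    * apply functional_extensionality. intros z. now rewrite sum_n_n.
  + destruct IH as [H1 H2]; [lia|intros k Hk; apply H; lia|].
    replace (fun z => Csum_n_m (fun k => F k z) m (S n)) with
      (fun z => Csum_n_m (fun k => F k z) m n + F (S n) z)%C.
    * destruct (analytic_at_plus _ _ z0 H1 (H (S n) ltac:(lia))) as [H3 H4].
      split; [exact H3|]. intros i. rewrite H4, H2, sum_n_Sm by lia. reflexivity.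
    * apply functional_extensionality. intros z. now rewrite sum_n_Sm by lia.
Qed.

(** Horner form, for degree at most d: division by z - x, root counting and growth estimates all
    become inductions on d. *)
Fixpoint is_Cpoly (d : nat) (Q : C -> C) : Prop :=
  match d with
  | O => exists c, forall z, Q z = c
  | S d' => exists c Q', is_Cpoly d' Q' /\ forall z, Q z = (c + z * Q' z)%C
  end.

Lemma is_Cpoly_ext (d : nat) (P Q : C -> C) :
  (forall z, P z = Q z) -> is_Cpoly d P -> is_Cpoly d Q.
Proof.
intros E. destruct d as [|d]; simpl.
- intros [c Hc]. exists c. intros z. now rewrite <- E.
- intros (c & Q' & H1 & H2). exists c, Q'. split; [exact H1|]. intros z. now rewrite <- E.
Qed.

Lemma is_Cpoly_plus (d : nat) (P Q : C -> C) :
  is_Cpoly d P -> is_Cpoly d Q -> is_Cpoly d (fun z => P z + Q z)%C.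
Proof.
revert P Q. induction d as [|d IH]; intros P Q; simpl.
- intros [c Hc] [c' Hc']. exists (c + c')%C. intros z. now rewrite Hc, Hc'.
- intros (c & P' & H1 & H2) (c' & Q' & H1' & H2').
  exists (c + c')%C, (fun z => P' z + Q' z)%C. split; [now apply IH|].
  intros z. rewrite H2, H2'. ring.
Qed.

Lemma is_Cpoly_scal (d : nat) (k : C) (P : C -> C) :
  is_Cpoly d P -> is_Cpoly d (fun z => k * P z)%C.
Proof.
revert P. induction d as [|d IH]; intros P; simpl.
- intros [c Hc]. exists (k * c)%C. intros z. now rewrite Hc.
- intros (c & P' & H1 & H2). exists (k * c)%C, (fun z => k * P' z)%C. split; [now apply IH|].
  intros z. rewrite H2. ring.
Qed.

Lemma is_Cpoly_S (d : nat) (P : C -> C) : is_Cpoly d P -> is_Cpoly (S d) P.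
Proof.
revert P. induction d as [|d IH]; intros P.
- intros [c Hc]. exists c, (fun _ => RtoC 0). split; [now exists 0|]. intros z. rewrite Hc. ring.
- intros (c & P' & H1 & H2). exists c, P'. split; [now apply IH|exact H2].
Qed.

Lemma is_Cpoly_chebTC (n : nat) : is_Cpoly n (chebTC n).
Proof.
assert (H : is_Cpoly n (chebTC n) /\ is_Cpoly (S n) (chebTC (S n))).
{ induction n as [|n [IH1 IH2]].
  - split; [now exists 1|]. exists 0, (fun _ => RtoC 1). split; [now exists 1|].
    intros z. simpl. ring.
  - split; [exact IH2|].
    apply is_Cpoly_ext with (fun z => (0 + z * (2 * chebTC (S n) z)) + - (1) * chebTC n z)%C.
    { intros z. change (chebTC (S (S n)) z) with (RtoC 2 * z * chebTC (S n) z - chebTC n z)%C. ring. }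
    apply is_Cpoly_plus.
    + exists 0, (fun z => 2 * chebTC (S n) z)%C. split; [now apply is_Cpoly_scal|reflexivity].
    + apply is_Cpoly_scal. now do 2 apply is_Cpoly_S. }
exact (proj1 H).
Qed.

Lemma is_Cpoly_factor (d : nat) (Q : C -> C) (x : C) : is_Cpoly (S d) Q ->
  exists Q', is_Cpoly d Q' /\ forall z, Q z = (Q x + (z - x) * Q' z)%C.
Proof.
revert Q. induction d as [|d IH]; intros Q (c & Q1 & H1 & H2).
- destruct H1 as [c' Hc']. exists (fun _ => c'). split; [now exists c'|].
  intros z. rewrite !H2, !Hc'. ring.
- destruct (IH Q1 H1) as (Q2 & H3 & H4).
  exists (fun z => Q1 x + z * Q2 z)%C. split.
  + exists (Q1 x), Q2. now split.
  + intros z. rewrite !H2, (H4 z). ring.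
Qed.

Lemma is_Cpoly_roots (d : nat) (Q : C -> C) (x : nat -> C) : is_Cpoly d Q ->
  (forall k, (k <= d)%nat -> Q (x k) = 0) ->
  (forall j k, (j <= d)%nat -> (k <= d)%nat -> x j = x k -> j = k) ->
  forall z, Q z = 0.
Proof.
revert Q x. induction d as [|d IH]; intros Q x HQ Hx Hinj z.
- destruct HQ as [c Hc]. rewrite Hc, <- (Hc (x O)). now apply Hx.
- destruct (is_Cpoly_factor d Q (x O) HQ) as (Q' & HQ' & E).
  rewrite E, (Hx O) by lia.
  rewrite (IH Q' (fun k => x (S k))); [ring|exact HQ'| |].
  + intros k Hk. assert (E1 := Hx (S k) ltac:(lia)). rewrite E, (Hx O) in E1 by lia.
    assert (N : (x (S k) - x O)%C <> 0).
    { intros Z. apply Ceq_minus in Z. apply Hinj in Z; lia. }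
    replace (Q' (x (S k))) with ((0 + (x (S k) - x O) * Q' (x (S k))) / (x (S k) - x O))%C
      by (field; exact N).
    rewrite E1. field. exact N.
  + intros j k Hj Hk Ejk. apply Hinj in Ejk; lia.
Qed.

(** Repeated division by z - z0 expands the polynomial at z0; the successive remainders are the
    coefficients. *)
Lemma is_Cpoly_analytic (d : nat) (Q : C -> C) (z0 : C) : is_Cpoly d Q -> analytic_at Q z0.
Proof.
intros HQ.
assert (H : exists a, forall z, Cpseries a (z - z0)%C (Q z)).
{ revert Q HQ. induction d as [|d IH]; intros Q HQ.
  - destruct HQ as [c Hc]. exists (fun k => match k with O => c | S _ => RtoC 0 end). intros z.
    apply (filterlim_ext (fun _ : nat => c)).
    + intros n. induction n as [|n IHn].
      * rewrite sum_O. change (c = 1 * c)%C. ring.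
      * rewrite sum_Sn, <- IHn, C_scal_pow_n. change (c = c + (z - z0) ^ S n * 0)%C. ring.
    + rewrite Hc. apply filterlim_const.
  - destruct (is_Cpoly_factor d Q z0 HQ) as (Q' & HQ' & E).
    destruct (IH Q' HQ') as [a Ha].
    exists (fun k => match k with O => Q z0 | S k' => a k' end). intros z.
    apply (is_series_decr_1 (V := C_NormedModule)).
    assert (S1 := is_series_scal (V := C_NormedModule) ((z - z0)%C : C_AbsRing) _ _ (Ha z)).
    match goal with |- is_series _ ?l => replace l with (scal ((z - z0)%C : C_AbsRing) (Q' z : C_NormedModule)) end.
    + revert S1. apply is_series_ext. intros n. rewrite !C_scal_pow_n.
      change ((z - z0) * ((z - z0) ^ n * a n) = (z - z0) * (z - z0) ^ n * a n)%C. ring.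
    + rewrite (E z). change ((z - z0) * Q' z = Q z0 + (z - z0) * Q' z + - (1 * Q z0))%C. ring. }
destruct H as [a Ha]. exists a, 1. split; [lra|]. intros z _. apply Ha.
Qed.

Lemma is_Cpoly_hol (d : nat) (Q : C -> C) (z : C) : is_Cpoly d Q -> hol Q z.
Proof. intros H. now apply analytic_at_hol, is_Cpoly_analytic with d. Qed.

Lemma is_Cpoly_sum_n_m (d : nat) (F : nat -> C -> C) (m n : nat) :
  (m <= n)%nat -> (forall k, (m <= k <= n)%nat -> is_Cpoly d (F k)) ->
  is_Cpoly d (fun z => Csum_n_m (fun k => F k z) m n).
Proof.
intros Hmn H. induction n as [|n IH].
- replace m with O in * by lia. apply is_Cpoly_ext with (F O); [|apply H; lia].
  intros z. now rewrite sum_n_n.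
- destruct (Nat.eq_dec m (S n)) as [->|N].
  + apply is_Cpoly_ext with (F (S n)); [|apply H; lia]. intros z. now rewrite sum_n_n.
  + apply is_Cpoly_ext with (fun z => Csum_n_m (fun k => F k z) m n + F (S n) z)%C.
    * intros z. now rewrite sum_n_Sm by lia.
    * apply is_Cpoly_plus; [apply IH; [lia|intros; apply H; lia]|apply H; lia].
Qed.

(** On the real line -i G has real part 0, and the derivative of that real part is Im l; hence l is
    real, and its real part is the derivative of q. *)
Lemma C_derive_real (G : C -> C) (q : R -> R) (x : R) (l : C) :
  cdiff G l (RtoC x) -> (forall t, G (RtoC t) = RtoC (q t)) -> l = RtoC (Derive q x).
Proof.
intros HG E.
assert (D1 : is_derive (fun t : R => Re (RtoC t)) x (Re 1)) by exact (is_derive_id x).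
assert (D2 : is_derive (fun t : R => Im (RtoC t)) x (Im 1))
  by exact (is_derive_const (V := R_NormedModule) 0 x).
assert (H1 := is_derive_Re_curve G RtoC x l 1 HG D1 D2).
assert (HG' : cdiff (fun z => (0, -1) * G z)%C (0 * G (RtoC x) + (0, -1) * l)%C (RtoC x)).
{ apply (cdiff_mult (fun _ => (0, -1))); [apply cdiff_const|exact HG]. }
assert (H2 := is_derive_Re_curve _ RtoC x _ 1 HG' D1 D2).
assert (U1 : Derive q x = Re l).
{ apply is_derive_unique. replace (Re l) with (Re (l * 1)%C) by (f_equal; ring).
  revert H1. apply is_derive_ext. intros t. now rewrite E. }
assert (U2 : Im l = 0).
{ assert (Z : is_derive (fun _ : R => 0) x (Re ((0 * G (RtoC x) + (0, -1) * l) * 1)%C)).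
  { revert H2. apply is_derive_ext. intros t. rewrite E. simpl. R_eq. ring. }
  apply is_derive_unique in Z. rewrite Derive_const in Z. simpl in Z. unfold Im. lra. }
rewrite U1. destruct l as [u v]. simpl in U2. unfold RtoC. simpl. now rewrite U2.
Qed.

Lemma C_derive_n_real (F : C -> C) (p : R -> R) (i : nat) :
  (forall x : R, analytic_at F (RtoC x)) -> (forall t, F (RtoC t) = RtoC (p t)) ->
  forall x, C_derive_n F i (RtoC x) = RtoC (Derive_n p i x).
Proof.
intros HF E. induction i as [|i IH]; intros x; [apply E|].
change (C_derive (C_derive_n F i) (RtoC x) = RtoC (Derive (Derive_n p i) x)).
apply (C_derive_real (C_derive_n F i)); [|exact IH].
now apply hol_cdiff, analytic_at_hol, analytic_at_C_derive_n.
Qed.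

Lemma real_poly_complexify (d : nat) (p : R -> R) : is_poly_le d p ->
  exists L, is_Cpoly d L /\ forall t, L (RtoC t) = RtoC (p t).
Proof.
intros [a Ha].
assert (H : forall d a, exists L, is_Cpoly d L /\
  forall t, L (RtoC t) = RtoC (sum_n (fun k => a k * t ^ k) d)).
{ clear. induction d as [|d IH]; intros a.
  - exists (fun _ => RtoC (a O)). split; [now exists (RtoC (a O))|].
    intros t. rewrite sum_O. f_equal. simpl. ring.
  - destruct (IH (fun k => a (S k))) as (L & H1 & H2).
    exists (fun z => RtoC (a O) + z * L z)%C. split; [now exists (RtoC (a O)), L|].
    intros t. rewrite H2, sum_n_first, <- RtoC_mult, <- RtoC_plus. f_equal.
    rewrite <- sum_n_Rmult_l. simpl (t ^ 0). rewrite Rmult_1_r. f_equal.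
    apply sum_n_Rext. intros k _. simpl. ring. }
destruct (H d a) as (L & H1 & H2). exists L. split; [exact H1|].
intros t. now rewrite H2, Ha.
Qed.

Lemma sum_n_m_single (a : nat -> C) (m n j : nat) : (m <= j <= n)%nat ->
  (forall k, (m <= k <= n)%nat -> k <> j -> a k = 0) ->
  Csum_n_m a m n = a j.
Proof.
intros Hj H. induction n as [|n IH].
- replace m with O by lia. replace j with O by lia. apply sum_n_n.
- destruct (Nat.eq_dec m (S n)) as [->|N].
  + replace j with (S n) by lia. apply sum_n_n.
  + rewrite sum_n_Sm by lia. change plus with Cplus.
    destruct (Nat.eq_dec j (S n)) as [->|Nj].
    * replace (Csum_n_m a m n) with (RtoC 0); [C_eq; ring|].
      symmetry.
      rewrite (sum_n_m_ext_loc (G := C_AbelianGroup) a (fun _ => zero)).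
      -- apply (sum_n_m_const_zero (G := C_AbelianGroup)).
      -- intros k Hk. apply H; lia.
    * rewrite IH, (H (S n)); [C_eq; ring|lia|lia|lia|]. intros k Hk. apply H. lia.
Qed.

Lemma hermite_interpolant (n s : nat) (xi : nat -> R) (ell : nat -> nat -> R -> R)
    (v : nat -> nat -> C) :
  (1 <= n)%nat -> (1 <= s)%nat -> hermite_fundamental n s xi ell ->
  exists H : C -> C, is_Cpoly (2 * s * n - 1) H /\
   (forall t : R, H (RtoC t) = Csum_n_m (fun nu =>
      Csum_n_m (fun i => RtoC (ell i nu t) * v i nu)%C 0 (2 * s - 1)) 1 n) /\
   (forall j mu, (j <= 2 * s - 1)%nat -> (1 <= mu <= n)%nat ->
      C_derive_n H j (RtoC (xi mu)) = v j mu).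
Proof.
intros Hn Hs Hell.
set (d := (2 * s * n - 1)%nat).
(* [real_poly_complexify] extends each [ell i nu] to C separately; [epsilon] gathers the extensions
   into one family, arbitrary outside the range of indices. *)
set (L := fun i nu => epsilon (inhabits (fun _ : C => RtoC 0))
   (fun L => is_Cpoly d L /\ forall t, L (RtoC t) = RtoC (ell i nu t))).
assert (HL : forall i nu, (i <= 2 * s - 1)%nat -> (1 <= nu <= n)%nat ->
  is_Cpoly d (L i nu) /\ forall t, L i nu (RtoC t) = RtoC (ell i nu t)).
{ intros i nu Hi Hnu. apply epsilon_spec, real_poly_complexify, Hell; assumption. }
exists (fun z => Csum_n_m (fun nu =>
      Csum_n_m (fun i => v i nu * L i nu z)%C 0 (2 * s - 1)) 1 n).
split; [|split].
- apply (is_Cpoly_sum_n_m d (fun nu z =>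
    Csum_n_m (fun i => v i nu * L i nu z)%C 0 (2 * s - 1))); [exact Hn|].
  intros nu Hnu. apply (is_Cpoly_sum_n_m d (fun i z => v i nu * L i nu z)%C); [lia|].
  intros i Hi. apply is_Cpoly_scal, HL; lia.
- intros t. apply sum_n_m_ext_loc. intros nu Hnu. apply sum_n_m_ext_loc. intros i Hi.
  destruct (HL i nu) as [_ E]; [lia|lia|]. rewrite E. C_eq. ring.
- intros j mu Hj Hmu.
  assert (A : forall i nu z0, (i <= 2 * s - 1)%nat -> (1 <= nu <= n)%nat ->
    analytic_at (fun z => v i nu * L i nu z)%C z0).
  { intros i nu z0 Hi Hnu. apply is_Cpoly_analytic with d, is_Cpoly_scal, HL; assumption. }
  assert (A2 : forall nu, (1 <= nu <= n)%nat ->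
    analytic_at (fun z => Csum_n_m (fun i => v i nu * L i nu z)%C 0 (2 * s - 1))
      (RtoC (xi mu)) /\
    forall j, C_derive_n (fun z => Csum_n_m (fun i => v i nu * L i nu z)%C 0 (2 * s - 1))
      j (RtoC (xi mu)) = Csum_n_m
        (fun i => C_derive_n (fun z => v i nu * L i nu z)%C j (RtoC (xi mu))) 0 (2 * s - 1)).
  { intros nu Hnu. apply (analytic_at_sum_n_m (fun i z => v i nu * L i nu z)%C); [lia|].
    intros i Hi. apply A; lia. }
  destruct (analytic_at_sum_n_m (fun nu z => Csum_n_m
    (fun i => v i nu * L i nu z)%C 0 (2 * s - 1)) (RtoC (xi mu)) 1 n Hn) as [_ E].
  { intros nu Hnu. now apply A2. }
  rewrite E. clear E.
  assert (D : forall i nu, (i <= 2 * s - 1)%nat -> (1 <= nu <= n)%nat ->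
    C_derive_n (fun z => v i nu * L i nu z)%C j (RtoC (xi mu)) =
    (v i nu * RtoC (if andb (Nat.eqb j i) (Nat.eqb mu nu) then 1 else 0))%C).
  { intros i nu Hi Hnu. destruct (HL i nu Hi Hnu) as [P E].
    rewrite (proj2 (analytic_at_scal (v i nu) (L i nu) (RtoC (xi mu)) (is_Cpoly_analytic d _ _ P))).
    rewrite (C_derive_n_real (L i nu) (ell i nu)); [|intros; now apply is_Cpoly_analytic with d|exact E].
    destruct (Hell i nu Hi Hnu) as [_ Hd]. now rewrite Hd. }
  rewrite (sum_n_m_single _ 1 n mu Hmu).
  + rewrite (proj2 (A2 mu Hmu)). rewrite (sum_n_m_single _ 0 (2 * s - 1) j ltac:(lia)).
    * rewrite D by assumption. rewrite !Nat.eqb_refl. simpl. ring.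
    * intros i Hi Nij. rewrite D by (assumption || lia).
      replace (Nat.eqb j i) with false by (symmetry; apply Nat.eqb_neq; auto). simpl. ring.
  + intros nu Hnu Nn. rewrite (proj2 (A2 nu Hnu)).
    rewrite (sum_n_m_ext_loc (G := C_AbelianGroup) _ (fun _ => zero)).
    * apply (sum_n_m_const_zero (G := C_AbelianGroup)).
    * intros i Hi. rewrite D by (assumption || lia).
      replace (Nat.eqb mu nu) with false by (symmetry; apply Nat.eqb_neq; auto).
      rewrite Bool.andb_false_r. change (v i nu * 0 = 0)%C. ring.
Qed.

(** * Division by a power of T_n *)

(** The zeros are simple. If U vanished at [xi mu] too, it would have n distinct roots with degree
    at most n - 1, so U and T_n would be identically 0, against T_n(1) = 1. *)
Lemma cheb_zero_factor (n : nat) (xi : nat -> R) (mu : nat) :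
  (1 <= n)%nat -> cheb_zeros n xi -> (1 <= mu <= n)%nat ->
  exists U, is_Cpoly (n - 1) U /\ U (RtoC (xi mu)) <> 0 /\
    forall z, chebTC n z = ((z - RtoC (xi mu)) * U z)%C.
Proof.
intros Hn [Hz Hinj] Hmu.
destruct n as [|n]; [lia|]. replace (S n - 1)%nat with n by lia.
assert (T0 : forall nu, (1 <= nu <= S n)%nat -> chebTC (S n) (RtoC (xi nu)) = 0).
{ intros nu Hnu. now rewrite chebTC_RtoC, (proj2 (Hz nu Hnu)). }
destruct (is_Cpoly_factor n _ (RtoC (xi mu)) (is_Cpoly_chebTC (S n))) as (U & HU & E).
assert (E' : forall z, chebTC (S n) z = ((z - RtoC (xi mu)) * U z)%C).
{ intros z. rewrite E, T0 by exact Hmu. ring. }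
exists U. split; [exact HU|]. split; [|exact E'].
intros U0.
assert (UZ : forall z, U z = 0).
{ apply (is_Cpoly_roots n U (fun k => RtoC (xi (S k))) HU).
  - intros k Hk. destruct (Nat.eq_dec (S k) mu) as [->|N]; [exact U0|].
    assert (N' : (RtoC (xi (S k)) - RtoC (xi mu))%C <> 0).
    { intros Z. apply Ceq_minus, RtoC_inj, Hinj in Z; lia. }
    assert (E1 := E' (RtoC (xi (S k)))). rewrite T0 in E1 by lia.
    replace (U (RtoC (xi (S k)))) with
     (((RtoC (xi (S k)) - RtoC (xi mu)) * U (RtoC (xi (S k)))) / (RtoC (xi (S k)) - RtoC (xi mu)))%C
      by (field; exact N').
    rewrite <- E1. field. exact N'.
  - intros j k Hj Hk Ejk. apply RtoC_inj, Hinj in Ejk; lia. }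
assert (T1 : chebTC (S n) (RtoC 1) = RtoC 1).
{ rewrite chebTC_RtoC. f_equal. rewrite <- cos_0, chebT_cos, Rmult_0_r. reflexivity. }
rewrite E', UZ, Cmult_0_r in T1. apply RtoC_inj in T1. lra.
Qed.

(** One more complex zero, placed at index 0 of the list, would give T_n as many as n + 1 distinct
    roots, again against T_n(1) = 1. *)
Lemma cheb_zeros_all (n : nat) (xi : nat -> R) (z : C) :
  (1 <= n)%nat -> cheb_zeros n xi -> chebTC n z = 0 ->
  exists mu, (1 <= mu <= n)%nat /\ z = RtoC (xi mu).
Proof.
intros Hn [Hz Hinj] Ez.
destruct (Classical_Prop.classic (exists mu, (1 <= mu <= n)%nat /\ z = RtoC (xi mu))) as [H|H];
  [exact H|exfalso].
assert (TZ : forall w, chebTC n w = 0).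
{ apply (is_Cpoly_roots n _ (fun k => match k with O => z | S _ => RtoC (xi k) end) (is_Cpoly_chebTC n)).
  - intros [|k] Hk; [exact Ez|]. now rewrite chebTC_RtoC, (proj2 (Hz (S k) ltac:(lia))).
  - intros [|j] [|k] Hj Hk E; try reflexivity.
    + exfalso. apply H. exists (S k). split; [lia|exact E].
    + exfalso. apply H. exists (S j). split; [lia|now symmetry].
    + apply RtoC_inj, Hinj in E; lia. }
assert (T1 : chebTC n (RtoC 1) = RtoC 1).
{ rewrite chebTC_RtoC. f_equal. rewrite <- cos_0, chebT_cos, Rmult_0_r. reflexivity. }
rewrite TZ in T1. apply RtoC_inj in T1. lra.
Qed.

(** The first N Taylor coefficients vanish, so the series shifted by N converges on the same disc to
    the quotient, and its constant term fills in the value at the centre. *)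
Lemma analytic_at_divide (e : C -> C) (z0 : C) (N : nat) :
  (0 < N)%nat -> analytic_at e z0 ->
  (forall j, (j < N)%nat -> C_derive_n e j z0 = 0) ->
  exists p, hol p z0 /\ p z0 = (C_derive_n e N z0 / INR (fact N))%C /\
    Clocally z0 (fun z => e z = (z - z0) ^ N * p z)%C.
Proof.
intros HN (b & r & Hr & Hb) H0.
assert (B : forall j, C_derive_n e j z0 = (INR (fact j) * b j)%C).
{ intros j. exact (C_derive_n_center b r e z0 j Hb Hr). }
assert (Fn : forall j, RtoC (INR (fact j)) <> 0) by (intros; apply RtoC_neq_0, INR_fact_neq_0).
assert (B0 : forall j, (j < N)%nat -> b j = 0).
{ intros j Hj. specialize (H0 j Hj). rewrite B in H0.
  replace (b j) with (/ INR (fact j) * (INR (fact j) * b j))%C by (field; apply Fn).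
  rewrite H0. ring. }
assert (Z0 : Cmod (z0 - z0) < r) by (replace (z0 - z0)%C with (RtoC 0) by ring; now rewrite Cmod_0).
assert (e0 : e z0 = 0).
{ change (e z0) with (C_derive_n e 0 z0). now apply H0. }
set (p := fun z => if Ceq_dec z z0 then b N else (e z / (z - z0) ^ N)%C).
assert (Hp : forall z, Cmod (z - z0) < r ->
  Cpseries (fun k => b (N + k)%nat) (z - z0)%C (p z)).
{ intros z Hz. unfold p. destruct (Ceq_dec z z0) as [->|Nz].
  - replace (b N) with (b (N + 0)%nat) by (f_equal; lia).
    replace (z0 - z0)%C with (@zero C_AbsRing) by (change (RtoC 0 = z0 - z0)%C; ring).
    apply (is_pseries_0 (K := C_AbsRing) (V := C_NormedModule) (fun k => b (N + k)%nat)).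
  - assert (Nz' : (z - z0)%C <> 0) by (intros Q; apply Nz; now apply Ceq_minus).
    assert (D := is_pseries_decr_n (V := C_NormedModule) b N (z - z0)%C (/ (z - z0))%C (e z)
       (Cinv_l _ Nz') HN (Hb z Hz)).
    replace (e z / (z - z0) ^ N)%C with
      (scal (pow_n (/ (z - z0))%C N : C_AbsRing) (plus (e z : C_NormedModule)
        (opp (sum_n (fun k => scal (pow_n (z - z0)%C k : C_AbsRing) (b k : C_NormedModule)) (N - 1))))).
    + exact D.
    + rewrite C_scal_pow_n.
      replace (sum_n (fun k => scal (pow_n (z - z0)%C k : C_AbsRing) (b k : C_NormedModule)) (N - 1))
        with (RtoC 0).
      * change ((/ (z - z0)) ^ N * (e z + - 0) = e z / (z - z0) ^ N)%C.
        rewrite Cpow_inv by exact Nz'. field. now apply Cpow_nz.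
      * symmetry. unfold sum_n.
        rewrite (sum_n_m_ext_loc _ (fun _ => zero)).
        -- apply (sum_n_m_const_zero (G := C_AbelianGroup)).
        -- intros k Hk. rewrite C_scal_pow_n, B0 by lia. change ((z - z0) ^ k * 0 = 0)%C. ring. }
exists p. split; [|split].
- exact (C_pseries_hol _ r p z0 z0 Hp Z0).
- rewrite B. unfold p. destruct (Ceq_dec z0 z0) as [_|Q]; [|now contradict Q]. field. apply Fn.
- apply filter_forall. intros z. unfold p. destruct (Ceq_dec z z0) as [E|Nz].
  + assert (K : forall w, w = z0 -> e w = ((w - z0) ^ N * b N)%C); [|now apply K].
    intros w ->. rewrite e0. destruct N as [|N]; [lia|]. simpl. ring.
  + assert (K : forall w, w <> z0 -> e w = ((w - z0) ^ N * (e w / (w - z0) ^ N))%C); [|now apply K].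
    intros w Nw. field. apply Cpow_nz. intros Q. apply Nw. now apply Ceq_minus.
Qed.

(* At a zero of T_n the value of the quotient is its limit, read off the first
   nonvanishing Taylor coefficients of numerator and denominator. *)
Definition cheb_quotient (n s : nat) (e : C -> C) (z : C) : C :=
  if Ceq_dec (chebTC n z) 0
  then (C_derive_n e (2 * s) z / (INR (fact (2 * s)) * C_derive (chebTC n) z ^ (2 * s)))%C
  else (e z / chebTC n z ^ (2 * s))%C.

(** Near a node e is (z - xi)^(2s) p and T_n is (z - xi) U with U nonzero, so the quotient is
    p/U^(2s). The value prescribed at the node agrees because U takes there the value of the
    derivative of T_n. *)
Lemma hol_cheb_quotient (n s : nat) (xi : nat -> R) (e : C -> C) (z : C) :
  (1 <= n)%nat -> (1 <= s)%nat -> cheb_zeros n xi -> analytic_at e z ->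
  (forall mu j, (1 <= mu <= n)%nat -> (j < 2 * s)%nat -> C_derive_n e j (RtoC (xi mu)) = 0) ->
  hol (cheb_quotient n s e) z.
Proof.
intros Hn Hs Hxi He Hd.
destruct (Ceq_dec (chebTC n z) 0) as [E|N].
- destruct (cheb_zeros_all n xi z Hn Hxi E) as (mu & Hmu & ->).
  destruct (cheb_zero_factor n xi mu Hn Hxi Hmu) as (U & HU & U0 & TU).
  destruct (analytic_at_divide e (RtoC (xi mu)) (2 * s) ltac:(lia) He) as (p & Hp & p0 & Ep).
  { intros j Hj. now apply Hd. }
  assert (HolU := is_Cpoly_hol _ U (RtoC (xi mu)) HU).
  apply hol_ext_loc with (fun w => p w / U w ^ (2 * s))%C.
  + assert (NU := continuous_C_neq0 U _ (hol_continuous _ _ HolU) U0).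
    generalize (filter_and _ _ Ep NU). apply filter_imp. intros w [Ew Nw].
    unfold cheb_quotient. destruct (Ceq_dec (chebTC n w) 0) as [Tw|Tw].
    * assert (Ew2 : w = RtoC (xi mu)).
      { rewrite TU in Tw. apply Ceq_minus.
        destruct (Ceq_dec (w - RtoC (xi mu))%C 0) as [Q|Q]; [exact Q|].
        now destruct (Cmult_neq_0 _ _ Q Nw). }
      assert (K : forall v, v = RtoC (xi mu) -> (p v / U v ^ (2 * s) =
        C_derive_n e (2 * s) v / (INR (fact (2 * s)) * C_derive (chebTC n) v ^ (2 * s)))%C);
        [|now apply K].
      intros v ->. rewrite p0.
      rewrite (cdiff_C_derive (chebTC n) (U (RtoC (xi mu))) (RtoC (xi mu))).
      -- field. split; [now apply Cpow_nz|apply RtoC_neq_0, INR_fact_neq_0].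
      (* The cofactor U is itself the Caratheodory quotient of T_n at the node, so its value there
         is the derivative. *)
      -- exists U. split; [now apply hol_continuous|]. split; [reflexivity|].
         apply filter_forall. intros v. rewrite E, TU.
         assert (K : forall x : C, x = (0 + x)%C) by (intros; ring). apply K.
    * rewrite Ew, TU in *.
      assert (N1 : (w - RtoC (xi mu))%C <> 0).
      { intros Q. apply Tw. rewrite Q. ring. }
      assert (K : forall a b c : C, a <> 0 -> b <> 0 ->
         (c / b ^ (2 * s) = a ^ (2 * s) * c / (a * b) ^ (2 * s))%C); [|now apply K].
      intros a b c Ha Hb. rewrite Cpow_mult_l. field. split; now apply Cpow_nz.
  + apply (hol_div p (fun w => U w ^ (2 * s))%C); [exact Hp|now apply hol_pow|now apply Cpow_nz].
- apply hol_ext_loc with (fun w => e w / chebTC n w ^ (2 * s))%C.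
  + generalize (continuous_C_neq0 (chebTC n) z (hol_continuous _ _ (hol_chebTC n z)) N).
    apply filter_imp. intros w Nw. unfold cheb_quotient.
    destruct (Ceq_dec (chebTC n w) 0) as [Q|_]; [now contradict Nw|reflexivity].
  + apply (hol_div e (fun w => chebTC n w ^ (2 * s))%C).
    * now apply analytic_at_hol.
    * apply hol_pow, hol_chebTC.
    * now apply Cpow_nz.
Qed.

Lemma cheb_quotient_eq (n s : nat) (xi : nat -> R) (e : C -> C) (z : C) :
  (1 <= n)%nat -> (1 <= s)%nat -> cheb_zeros n xi ->
  (forall mu, (1 <= mu <= n)%nat -> e (RtoC (xi mu)) = 0) ->
  e z = (cheb_quotient n s e z * chebTC n z ^ (2 * s))%C.
Proof.
intros Hn Hs Hxi He. unfold cheb_quotient. destruct (Ceq_dec (chebTC n z) 0) as [E|N].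
- destruct (cheb_zeros_all n xi z Hn Hxi E) as (mu & Hmu & ->).
  rewrite He by exact Hmu. rewrite E.
  assert (Z : (RtoC 0 ^ (2 * s) = 0)%C).
  { replace (2 * s)%nat with (S (2 * s - 1)) by lia. rewrite Cpow_S. ring. }
  rewrite Z. ring.
- field. now apply Cpow_nz.
Qed.

(** * The ellipse as the image of a circle *)

Lemma polar_surj (u : C) : u <> 0 -> exists t, u = polar (Cmod u) t.
Proof.
intros Hu. assert (P := proj1 (Cmod_gt_0 u) Hu). assert (S := Cmod_sqr u).
destruct u as [x y]. simpl in S. set (r := Cmod (x, y)) in *.
assert (Hc : -1 <= x / r <= 1).
{ assert (x ^ 2 <= r ^ 2) by (simpl; nra).
  assert (Hx : - r <= x <= r) by (split; nra).
  split; apply Rmult_le_reg_r with r; try exact P; field_simplify; lra. }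
assert (HC := cos_acos _ Hc). assert (HS := sin_acos _ Hc).
assert (E : (y / r)² = 1 - (x / r)²).
{ unfold Rsqr. apply Rmult_eq_reg_r with (r * r); [field_simplify; [lra|lra|lra]|nra]. }
destruct (Rle_dec 0 y) as [Hy|Hy].
- exists (acos (x / r)). rewrite polar_pair, HC, HS, <- E, sqrt_Rsqr.
  + f_equal; field; lra.
  + apply Rmult_le_pos; [exact Hy|]. left. now apply Rinv_0_lt_compat.
- exists (- acos (x / r)). rewrite polar_pair, cos_neg, sin_neg, HC, HS, <- E, sqrt_Rsqr_abs.
  rewrite Rabs_left.
  + f_equal; field; lra.
  + apply Rmult_lt_reg_r with r; [exact P|]. field_simplify; lra.
Qed.

Lemma joukowski_polar (r t : R) : 0 < r ->
  joukowski (polar r t) = ((r + / r) / 2 * cos t, (r - / r) / 2 * sin t).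
Proof. intros H. now rewrite <- ellipse_point_joukowski, ellipse_point_eq. Qed.

Lemma joukowski_interior_polar (rho r t : R) :
  1 < rho -> / rho < r < rho -> ellipse_interior rho (joukowski (polar r t)).
Proof.
intros Hrho Hr.
assert (Hi : 0 < / rho < 1).
{ split; [apply Rinv_0_lt_compat; lra|]. rewrite <- Rinv_1. apply Rinv_lt_contravar; lra. }
assert (Hr0 : 0 < r) by lra.
assert (Hr1 : / r < rho).
{ rewrite <- (Rinv_inv rho). apply Rinv_lt_contravar; [nra|lra]. }
assert (Hri : 0 < / r) by now apply Rinv_0_lt_compat.
assert (E1 : r * / r = 1) by (field; lra). assert (E2 : rho * / rho = 1) by (field; lra).
rewrite joukowski_polar by exact Hr0. unfold ellipse_interior, ellipse_form. simpl Re. simpl Im.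
set (A := (r + / r) / 2). set (B := (r - / r) / 2).
set (a := (rho + / rho) / 2). set (b := (rho - / rho) / 2).
assert (Hb : 0 < b) by (unfold b; lra). assert (Ha : 0 < a) by (unfold a; lra).
assert (HA : 0 < A < a).
{ split; [unfold A; lra|]. unfold A, a.
  (* This product is 2 rho (a - A), so its sign compares the major semi-axes. *)
  assert (0 < (rho - r) * (rho - / r)) by (apply Rmult_lt_0_compat; lra).
  apply Rmult_lt_reg_r with rho; [lra|]. nra. }
assert (HB : - b < B < b).
{ split; [unfold B, b; lra|]. unfold B, b.
  assert (/ rho < / r) by (apply Rinv_lt_contravar; nra). lra. }
assert (T := sin2_cos2 t). unfold Rsqr in T.
replace (A * cos t / a) with (A / a * cos t) by (field; lra).
replace (B * sin t / b) with (B / b * sin t) by (field; lra).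
rewrite !Rpow_mult_distr.
assert (HA2 : (A / a) ^ 2 < 1).
{
  assert (A / a < 1) by (apply Rmult_lt_reg_r with a; [lra|]; field_simplify; lra).
  assert (0 < A / a) by (apply Rdiv_lt_0_compat; lra). simpl. nra. }
assert (HB2 : (B / b) ^ 2 < 1).
{ assert (B / b < 1) by (apply Rmult_lt_reg_r with b; [lra|]; field_simplify; lra).
  assert (-1 < B / b) by (apply Rmult_lt_reg_r with b; [lra|]; field_simplify; lra). simpl. nra. }
simpl (cos t ^ 2). simpl (sin t ^ 2). rewrite !Rmult_1_r.
(* Strictness has to come from a term with nonzero weight: the second one if cos t = 0, the first
   one otherwise. *)
destruct (Req_dec (cos t) 0) as [C0|C0].
- rewrite C0 in *. nra.
- assert (0 < cos t * cos t) by nra. assert (0 <= sin t * sin t) by nra. nra.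
Qed.

Lemma joukowski_interior (rho : R) (u : C) :
  1 < rho -> / rho < Cmod u < rho -> ellipse_interior rho (joukowski u).
Proof.
intros Hrho Hu. assert (0 < / rho) by (apply Rinv_0_lt_compat; lra).
destruct (polar_surj u) as [t E].
{ intros Q. rewrite Q, Cmod_0 in Hu. lra. }
rewrite E. now apply joukowski_interior_polar.
Qed.

Lemma polar_1 (p : R) : polar 1 p = cis p.
Proof. unfold polar. ring. Qed.

Lemma segment_interior (rho t : R) : 1 < rho -> -1 <= t <= 1 -> ellipse_interior rho (RtoC t).
Proof.
intros Hrho Ht. rewrite <- (cos_acos t Ht), <- joukowski_cis, <- polar_1.
apply joukowski_interior_polar; [exact Hrho|].
split; [rewrite <- Rinv_1; apply Rinv_lt_contravar; lra|lra].
Qed.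

(** * Cosine integrals over [0, pi] as integrals over the unit circle *)

Lemma CRInt_fold (h : R -> C) : (forall t, continuousC h t) ->
  CRInt h 0 (2 * PI) = CRInt (fun p => h p + h (2 * PI - p)%R)%C 0 PI.
Proof.
intros Hh.
assert (Hh' : forall t, continuousC (fun p => h (2 * PI - p)) t).
{ intros t. apply (continuous_comp (fun p => 2 * PI - p) h); [|apply Hh].
  apply (continuous_minus (V := R_NormedModule)); [apply continuous_const|apply continuous_id]. }
rewrite CRInt_plus by assumption.
assert (L := is_RInt_comp_lin (V := C_R_NormedModule) h (-1) (2 * PI) PI 0 (CRInt h PI (2 * PI))).
replace (-1 * PI + 2 * PI) with PI in L by ring.
replace (-1 * 0 + 2 * PI) with (2 * PI) in L by ring.
specialize (L (is_CRInt_correct h _ _ Hh)).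
apply (is_RInt_swap (V := C_R_NormedModule)), (is_RInt_opp (V := C_R_NormedModule)) in L.
rewrite opp_opp in L.
rewrite (is_CRInt_unique (fun p => h (2 * PI - p)) 0 PI (CRInt h PI (2 * PI))).
- rewrite <- (RInt_Chasles (V := C_R_CompleteNormedModule) h 0 PI (2 * PI)).
  + reflexivity.
  + eexists. now apply is_CRInt_correct.
  + eexists. now apply is_CRInt_correct.
- revert L. apply is_RInt_ext. intros x _.
  replace (-1 * x + 2 * PI) with (2 * PI - x) by ring.
  destruct (h (2 * PI - x)) as [y z].
  unfold opp, scal; simpl. unfold prod_opp, prod_scal, opp, scal; simpl. unfold mult; simpl.
  f_equal; ring.
Qed.

Lemma cis_inv_pow (p : R) (m : nat) :
  (/ polar 1 p ^ m)%C = (cos (INR m * p), - sin (INR m * p)).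
Proof.
rewrite polar_pow, pow1, polar_inv by lra. rewrite Rinv_1, polar_pair, cos_neg, sin_neg.
f_equal; ring.
Qed.

(** The reflection p -> 2 pi - p inverts u on the unit circle and fixes the value of the Joukowski
    map, so the imaginary part of u^(-m) cancels and twice the cosine remains. *)
Lemma CRInt_cos_circle (g : C -> C) (m : nat) :
  (forall t, -1 <= t <= 1 -> CcontinuousC g (RtoC t)) ->
  CRInt (fun p => g (RtoC (cos p)) * RtoC (cos (INR m * p)))%C 0 PI =
  (/ 2 * CRInt (fun p => g (joukowski (polar 1 p)) * / polar 1 p ^ m)%C 0 (2 * PI))%C.
Proof.
intros Hg.
assert (Cg : forall t, continuousC (fun p => g (RtoC (cos p))) t).
{ intros t. apply (continuous_comp (fun p => RtoC (cos p)) g).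
  - apply continuous_RtoC, continuous_cos.
  - apply Hg, COS_bound. }
assert (Cc : forall t, continuousC (fun p => RtoC (cos (INR m * p))) t).
{ intros t. apply continuous_RtoC, continuous_cos_scal. }
set (h := fun p => (g (joukowski (polar 1 p)) * / polar 1 p ^ m)%C).
assert (Ch : forall t, continuousC h t).
{ intros t. apply continuous_ext with (fun p => g (RtoC (cos p)) * / polar 1 p ^ m)%C.
  { intros p. unfold h. now rewrite polar_1, joukowski_cis. }
  apply continuous_Cmult; [apply Cg|]. apply continuous_Cinv.
  - apply continuous_Cpow, continuous_polar.
  - apply Cpow_nz, polar_neq_0. lra. }
assert (E : forall p, (h p + h (2 * PI - p)%R =
  2 * (g (RtoC (cos p)) * RtoC (cos (INR m * p))))%C).
{ intros p. unfold h. rewrite !cis_inv_pow, !polar_1, !joukowski_cis.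
  replace (cos (2 * PI - p)) with (cos p).
  2: { rewrite cos_minus, cos_2PI, sin_2PI. ring. }
  replace (INR m * (2 * PI - p)) with (- (INR m * p) + 2 * INR m * PI) by ring.
  rewrite cos_period, sin_period, cos_neg, sin_neg, Ropp_involutive.
  rewrite <- Cmult_plus_distr_l.
  replace (Cplus (cos (INR m * p), - sin (INR m * p)) (cos (INR m * p), sin (INR m * p)))
    with (2 * RtoC (cos (INR m * p)))%C.
  - ring.
  - unfold Cplus, Cmult, RtoC; simpl. f_equal; ring. }
rewrite (CRInt_fold h Ch), (CRInt_ext _ _ _ _ E), CRInt_Cmult.
- assert (K : forall x : C, (x = / 2 * (2 * x))%C) by (intros; field). apply K.
- intros t. now apply continuous_Cmult.
Qed.

(** * Growth at infinity and the vanishing of the polynomial contribution *)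

Lemma is_Cpoly_bound (d : nat) (Q : C -> C) : is_Cpoly d Q ->
  exists K, 0 <= K /\ forall u, 1 <= Cmod u -> Cmod (Q (joukowski u)) <= K * Cmod u ^ d.
Proof.
revert Q. induction d as [|d IH]; intros Q HQ.
- destruct HQ as [c Hc]. exists (Cmod c). split; [apply Cmod_ge_0|].
  intros u _. rewrite Hc. simpl. lra.
- destruct HQ as (c & Q' & HQ' & E). destruct (IH Q' HQ') as (K & HK & B).
  exists (Cmod c + K). assert (Hc := Cmod_ge_0 c). split; [lra|]. intros u Hu.
  assert (u0 : u <> 0) by (intros Z; rewrite Z, Cmod_0 in Hu; lra).
  rewrite E. eapply Rle_trans; [apply Cmod_triangle|]. rewrite Cmod_mult.
  assert (J : Cmod (joukowski u) <= Cmod u).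
  { unfold joukowski. rewrite Cmod_mult, <- RtoC_inv, Cmod_R, Rabs_pos_eq by lra.
    assert (T := Cmod_triangle u (/ u)). rewrite Cmod_inv in T by exact u0.
    assert (/ Cmod u <= 1) by (rewrite <- Rinv_1; apply Rinv_le_contravar; lra). lra. }
  assert (P1 : 1 <= Cmod u ^ S d) by (apply pow_R1_Rle; exact Hu).
  assert (P2 : Cmod (joukowski u) * Cmod (Q' (joukowski u)) <= Cmod u * (K * Cmod u ^ d)).
  { apply Rmult_le_compat; try apply Cmod_ge_0; [exact J|now apply B]. }
  rewrite Rmult_plus_distr_r. apply Rplus_le_compat.
  + rewrite <- (Rmult_1_r (Cmod c)) at 1. now apply Rmult_le_compat_l.
  + simpl. lra.
Qed.

Lemma cheb_tail_bound (n s : nat) :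
  exists B, 0 <= B /\ forall u, 1 <= Cmod u -> Cmod (cheb_tail n s u) <= B.
Proof.
(* The coefficients and exponents of [cheb_tail] depend on s; the number of terms is separated from
   them so that an induction on it is possible. *)
assert (H : forall (c : nat -> C) (e : nat -> nat) N, exists B, 0 <= B /\ forall u, 1 <= Cmod u ->
  Cmod (Csum_n (fun k => c k * / u ^ e k)%C N) <= B).
{ intros c e.
  assert (T : forall k u, 1 <= Cmod u -> Cmod (c k * / u ^ e k) <= Cmod (c k)).
  { intros k u Hu.
    assert (u0 : u <> 0) by (intros Z; rewrite Z, Cmod_0 in Hu; lra).
    rewrite Cmod_mult, Cmod_inv, Cmod_pow by (now apply Cpow_nz).
    rewrite <- (Rmult_1_r (Cmod (c k))) at 2. apply Rmult_le_compat_l; [apply Cmod_ge_0|].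
    assert (1 <= Cmod u ^ e k) by (now apply pow_R1_Rle).
    rewrite <- Rinv_1. apply Rinv_le_contravar; lra. }
  induction N as [|N (B & HB & IH)].
  - exists (Cmod (c O)). split; [apply Cmod_ge_0|]. intros u Hu. rewrite sum_O. now apply T.
  - exists (B + Cmod (c (S N))). assert (Hc := Cmod_ge_0 (c (S N))). split; [lra|].
    intros u Hu. rewrite sum_Sn. eapply Rle_trans; [apply Cmod_triangle|].
    apply Rplus_le_compat; [now apply IH|now apply T]. }
apply H.
Qed.

Lemma chebTC_lower_bound (n : nat) (u : C) : (1 <= n)%nat -> 2 <= Cmod u ->
  Cmod u ^ n / 4 <= Cmod (chebTC n (joukowski u)).
Proof.
intros Hn Hu.
assert (u0 : u <> 0) by (intros Z; rewrite Z, Cmod_0 in Hu; lra).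
rewrite chebTC_joukowski by exact u0.
rewrite Cmod_mult, <- RtoC_inv, Cmod_R, Rabs_pos_eq by lra.
assert (P : 2 <= Cmod u ^ n).
{ apply Rle_trans with (Cmod u ^ 1); [simpl; lra|]. apply Rle_pow; [lra|lia]. }
assert (T := Cmod_triangle (u ^ n + / u ^ n) (- / u ^ n)).
replace (u ^ n + / u ^ n + - / u ^ n)%C with (u ^ n)%C in T by ring.
rewrite Cmod_opp, Cmod_inv, Cmod_pow in T by (now apply Cpow_nz).
assert (/ Cmod u ^ n <= / 2) by (apply Rinv_le_contravar; lra). lra.
Qed.

(* The integrand is holomorphic outside the unit disc and O(1/|u|) at infinity. *)
Lemma poly_circle_integral_0 (n s : nat) (H : C -> C) (r : R) :
  (1 <= n)%nat -> (1 <= s)%nat -> is_Cpoly (2 * s * n - 1) H -> 1 < r ->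
  CRInt (fun t => H (joukowski (polar r t)) *
    (cheb_tail n s (polar r t) / chebTC n (joukowski (polar r t)) ^ (2 * s)))%C 0 (2 * PI) = RtoC 0.
Proof.
intros Hn Hs HH Hr.
set (F := fun u => (H (joukowski u) * (cheb_tail n s u / chebTC n (joukowski u) ^ (2 * s)))%C).
change (@eq C (CRInt (fun t => F (polar r t)) 0 (2 * PI)) 0).
assert (HolF : forall u, 1 < Cmod u -> hol F u).
{ intros u Hu. apply (hol_mult (fun u => H (joukowski u))).
  - apply (hol_comp H joukowski); [now apply is_Cpoly_hol with (2 * s * n - 1)%nat|].
    now apply hol_joukowski, Cmod_gt_1_neq_0.
  - now apply hol_cheb_weight. }
destruct (is_Cpoly_bound _ _ HH) as (K & HK & BK).
destruct (cheb_tail_bound n s) as (B & HB & BB).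
set (M := 2 * PI * (K * B * 4 ^ (2 * s))).
assert (HPI := PI_RGT_0).
assert (HM : 0 <= M).
{ apply Rmult_le_pos; [lra|]. apply Rmult_le_pos; [now apply Rmult_le_pos|]. apply pow_le; lra. }
set (I := CRInt (fun t => F (polar r t)) 0 (2 * PI)).
assert (Bd : forall x, 2 <= x -> r < x -> Cmod I * x <= M).
{ intros x Hx Hrx.
  assert (E : I = CRInt (fun t => F (polar x t)) 0 (2 * PI)).
  { apply (circle_mean_const F 1 (x + 1)); try lra. intros u Hu. apply HolF. lra. }
  assert (Cx : forall t, continuousC (fun t => F (polar x t)) t).
  { intros t. apply (continuous_comp (polar x) F); [apply continuous_polar|].
    apply hol_continuous, HolF. rewrite Cmod_polar; lra. }
  assert (L : Cmod I <= RInt (fun _ => K * B * 4 ^ (2 * s) / x) 0 (2 * PI)).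
  { rewrite E. eapply Rle_trans; [apply Cmod_CRInt_le; [lra|exact Cx]|].
    apply RInt_le; [lra| | |].
    - apply ex_RInt_cont. intros t. apply continuous_Cmod, Cx.
    - apply ex_RInt_cont. intros t. apply continuous_const.
    - intros t _. unfold F.
      assert (Hu : Cmod (polar x t) = x) by (apply Cmod_polar; lra).
      set (u := polar x t) in *.
      assert (HT0 := chebTC_joukowski_neq_0 n u Hn ltac:(lra)).
      rewrite Cmod_mult, Cmod_div, Cmod_pow by (now apply Cpow_nz).
      assert (B1 := BK u ltac:(lra)). assert (B2 := BB u ltac:(lra)).
      assert (B3 := chebTC_lower_bound n u Hn ltac:(lra)). rewrite Hu in *.
      assert (Hxn : 0 < x ^ n) by (apply pow_lt; lra).
      assert (B4 : (x ^ n / 4) ^ (2 * s) <= Cmod (chebTC n (joukowski u)) ^ (2 * s)).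
      { apply pow_incr. lra. }
      assert (Hp : 0 < (x ^ n / 4) ^ (2 * s)) by (apply pow_lt; lra).
      assert (H4 : 0 < 4 ^ (2 * s)) by (apply pow_lt; lra).
      assert (Hd : 0 < x ^ (2 * s * n - 1)) by (apply pow_lt; lra).
      apply Rle_trans with ((K * x ^ (2 * s * n - 1)) * (B / (x ^ n / 4) ^ (2 * s))).
      + apply Rmult_le_compat.
        * apply Cmod_ge_0.
        * apply Rmult_le_pos; [apply Cmod_ge_0|]. left. apply Rinv_0_lt_compat. lra.
        * exact B1.
        * apply Rmult_le_compat; [apply Cmod_ge_0| |exact B2|].
          -- left. apply Rinv_0_lt_compat. lra.
          -- apply Rinv_le_contravar; lra.
      + apply Req_le. unfold Rdiv at 2. rewrite Rpow_mult_distr, pow_inv, <- pow_mult.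
        replace (n * (2 * s))%nat with (S (2 * s * n - 1)) by nia.
        rewrite <- tech_pow_Rmult. field. lra. }
  rewrite RInt_const in L. unfold scal in L; simpl in L; unfold mult in L; simpl in L.
  rewrite Rminus_0_r in L. apply (Rmult_le_compat_r x) in L; [|lra].
  eapply Rle_trans; [exact L|]. apply Req_le. unfold M. simpl. field. lra. }
destruct (Ceq_dec I 0) as [Z|N]; [exact Z|exfalso].
assert (P := proj1 (Cmod_gt_0 _) N).
assert (HMI : 0 <= M / Cmod I) by (apply Rmult_le_pos; [exact HM|left; now apply Rinv_0_lt_compat]).
specialize (Bd (M / Cmod I + 2 + r) ltac:(lra) ltac:(lra)).
replace (Cmod I * (M / Cmod I + 2 + r)) with (M + Cmod I * (2 + r)) in Bd by (field; lra). nra.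
Qed.

(** * The remainder as a circle integral *)

Lemma continuous_real_restriction (G : C -> C) (t : R) :
  hol G (RtoC t) -> continuousC (fun t => G (RtoC t)) t.
Proof.
intros H. apply (continuous_comp RtoC G); [apply continuous_RtoC, continuous_id|].
now apply hol_continuous.
Qed.

Lemma CRInt_sum_n_m (f : nat -> R -> C) (a b : R) (m n : nat) : (m <= n)%nat ->
  (forall k t, (m <= k <= n)%nat -> continuousC (f k) t) ->
  CRInt (fun t => Csum_n_m (fun k => f k t) m n) a b =
  Csum_n_m (fun k => CRInt (f k) a b) m n.
Proof.
intros Hmn H. apply is_CRInt_unique.
apply (is_RInt_sum_n_m (V := C_R_NormedModule) f (fun k => CRInt (f k) a b)); [exact Hmn|].
intros k Hk. apply is_CRInt_correct. intros t. now apply H.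
Qed.

Lemma continuous_sum_n_m_C {T : UniformSpace} (f : nat -> T -> C) (m n : nat) (x : T) :
  (m <= n)%nat -> (forall k, (m <= k <= n)%nat -> continuousC (f k) x) ->
  continuousC (fun t => Csum_n_m (fun k => f k t) m n) x.
Proof.
intros Hmn H. induction n as [|n IH].
- replace m with O in * by lia.
  apply continuous_ext with (f O); [intros t; now rewrite sum_n_n|apply H; lia].
- destruct (Nat.eq_dec m (S n)) as [->|N].
  + apply continuous_ext with (f (S n)); [intros t; now rewrite sum_n_n|apply H; lia].
  + apply continuous_ext with
      (fun t => Csum_n_m (fun k => f k t) m n + f (S n) t)%C.
    * intros t. now rewrite sum_n_Sm by lia.
    * apply continuous_Cplus; [apply IH; [lia|intros; apply H; lia]|apply H; lia].
Qed.

(** By linearity the quadrature sum is the weighted integral of H T_n, because on the real line H is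
    the combination of the [ell i nu] whose coefficients are the derivatives of f at the nodes. *)
Lemma remainder_integral (n s : nat) (xi : nat -> R) (ell : nat -> nat -> R -> R) (f H : C -> C) :
  (1 <= n)%nat -> (1 <= s)%nat -> hermite_fundamental n s xi ell ->
  (forall t, -1 <= t <= 1 -> hol f (RtoC t)) ->
  (forall t, hol H (RtoC t)) ->
  (forall t : R, H (RtoC t) = Csum_n_m (fun nu =>
      Csum_n_m (fun i => RtoC (ell i nu t) * C_derive_n f i (RtoC (xi nu)))%C
        0 (2 * s - 1)) 1 n) ->
  remainder n s xi ell f =
  CRInt (fun p => (f (RtoC (cos p)) - H (RtoC (cos p))) * RtoC (chebT n (cos p)))%C 0 PI.
Proof.
intros Hn Hs Hell Hf HH EH. unfold remainder.
assert (CT : forall t, continuousC (fun p => RtoC (chebT n (cos p))) t).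
{ intros t. apply continuous_RtoC. apply (continuous_comp cos (chebT n));
    [apply continuous_cos|apply continuous_chebT]. }
assert (Cf : forall t, continuousC (fun p => f (RtoC (cos p))) t).
{ intros t. apply (continuous_comp cos (fun t => f (RtoC t))); [apply continuous_cos|].
  apply continuous_real_restriction, Hf, COS_bound. }
assert (CH : forall t, continuousC (fun p => H (RtoC (cos p))) t).
{ intros t. apply (continuous_comp cos (fun t => H (RtoC t))); [apply continuous_cos|].
  apply continuous_real_restriction, HH. }
assert (Cell : forall i nu t, (i <= 2 * s - 1)%nat -> (1 <= nu <= n)%nat -> continuous (ell i nu) t).
{ intros i nu t Hi Hnu.
  destruct (real_poly_complexify _ _ (proj1 (Hell i nu Hi Hnu))) as (L & HL & EL).
  apply continuous_ext with (fun t => Re (L (RtoC t))).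
  - intros x. now rewrite EL.
  - apply continuous_Re, continuous_real_restriction. now apply is_Cpoly_hol with (2 * s * n - 1)%nat. }
assert (E1 : CRInt (fun p => (f (RtoC (cos p)) - H (RtoC (cos p))) * RtoC (chebT n (cos p)))%C 0 PI
  = (CRInt (fun p => f (RtoC (cos p)) * RtoC (chebT n (cos p)))%C 0 PI -
     CRInt (fun p => H (RtoC (cos p)) * RtoC (chebT n (cos p)))%C 0 PI)%C).
{ rewrite <- CRInt_minus by (intros t; now apply continuous_Cmult).
  apply CRInt_ext. intros p. C_eq. ring. }
rewrite E1. f_equal.
- apply (wintC_cos (fun t => f (RtoC t) * RtoC (chebT n t))%C). intros t Ht.
  apply continuous_Cmult; [now apply continuous_real_restriction, Hf|].
  apply continuous_RtoC, continuous_chebT.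
- f_equal. symmetry.
  assert (Ct : forall i nu t, (i <= 2 * s - 1)%nat -> (1 <= nu <= n)%nat ->
    continuousC (fun p => C_derive_n f i (RtoC (xi nu)) *
      RtoC (ell i nu (cos p) * chebT n (cos p)))%C t).
  { intros i nu t Hi Hnu. apply continuous_Cmult; [apply continuous_const|].
    apply continuous_RtoC. apply (continuous_comp cos (fun x => ell i nu x * chebT n x));
      [apply continuous_cos|].
    apply (continuous_mult (K := R_AbsRing)); [now apply Cell|apply continuous_chebT]. }
  transitivity (CRInt (fun p => Csum_n_m (fun nu =>
      Csum_n_m (fun i => C_derive_n f i (RtoC (xi nu)) *
      RtoC (ell i nu (cos p) * chebT n (cos p)))%C 0 (2 * s - 1)) 1 n) 0 PI).
  + apply CRInt_ext. intros p. rewrite EH.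
    assert (Mr : forall (a : nat -> C) i j y, (Csum_n_m a i j * y)%C =
      Csum_n_m (fun k => a k * y)%C i j).
    { intros a i j y. symmetry. apply (sum_n_m_mult_r (K := C_Ring)). }
    rewrite Mr. apply sum_n_m_ext. intros nu. rewrite Mr. apply sum_n_m_ext. intros i.
    rewrite RtoC_mult. C_eq. ring.
  + rewrite (CRInt_sum_n_m (fun nu p => Csum_n_m (fun i =>
      C_derive_n f i (RtoC (xi nu)) * RtoC (ell i nu (cos p) * chebT n (cos p)))%C 0 (2 * s - 1)));
      [|exact Hn|].
    2: { intros nu t Hnu. apply (continuous_sum_n_m_C (fun i p =>
          C_derive_n f i (RtoC (xi nu)) * RtoC (ell i nu (cos p) * chebT n (cos p)))%C); [lia|].
         intros i Hi. apply Ct; [lia|exact Hnu]. }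
    apply sum_n_m_ext_loc. intros nu Hnu.
    rewrite (CRInt_sum_n_m (fun i p =>
          C_derive_n f i (RtoC (xi nu)) * RtoC (ell i nu (cos p) * chebT n (cos p)))%C); [|lia|].
    2: { intros i t Hi. apply Ct; [lia|exact Hnu]. }
    apply sum_n_m_ext_loc. intros i Hi.
    assert (Cr : forall t, continuous (fun x => ell i nu x * chebT n x) t).
    { intros t. apply (continuous_mult (K := R_AbsRing)); [apply Cell; lia|apply continuous_chebT]. }
    assert (Cr' : forall t, continuous (fun p => ell i nu (cos p) * chebT n (cos p)) t).
    { intros t. apply (continuous_comp cos (fun x => ell i nu x * chebT n x));
        [apply continuous_cos|apply Cr]. }
    rewrite CRInt_Cmult by (intros t; now apply continuous_RtoC).
    rewrite CRInt_RtoC by exact Cr'. unfold quad_coef.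
    rewrite wint_cos by (intros t _; apply Cr). C_eq. ring.
Qed.

Lemma cheb_power_integral (n s : nat) (g : C -> C) :
  (forall t, -1 <= t <= 1 -> CcontinuousC g (RtoC t)) ->
  CRInt (fun p => g (RtoC (cos p)) * RtoC (chebT n (cos p) ^ (2 * s + 1)))%C 0 PI =
  (RtoC (/ (2 * 4 ^ s)) *
     CRInt (fun p => g (joukowski (polar 1 p)) * cheb_tail n s (polar 1 p))%C 0 (2 * PI))%C.
Proof.
intros Hg.
assert (H4 : 0 < 4 ^ s) by (apply pow_lt; lra).
assert (Cg : forall t, continuousC (fun p => g (RtoC (cos p))) t).
{ intros t. apply (continuous_comp (fun p => RtoC (cos p)) g).
  - apply continuous_RtoC, continuous_cos.
  - apply Hg, COS_bound. }
assert (C1 : forall m t, continuousC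
  (fun p => g (RtoC (cos p)) * RtoC (cos (INR m * p)))%C t).
{ intros m t. apply continuous_Cmult; [apply Cg|]. apply continuous_RtoC, continuous_cos_scal. }
assert (C2 : forall m t, continuousC
  (fun p => g (joukowski (polar 1 p)) * / polar 1 p ^ m)%C t).
{ intros m t. apply continuous_ext with (fun p => g (RtoC (cos p)) * / polar 1 p ^ m)%C.
  { intros p. now rewrite polar_1, joukowski_cis. }
  apply continuous_Cmult; [apply Cg|]. apply continuous_Cinv.
  - apply continuous_Cpow, continuous_polar.
  - apply Cpow_nz, polar_neq_0. lra. }
set (m := fun k => ((2 * s + 1 - 2 * k) * n)%nat).
set (c := fun k => RtoC (Binomial.C (2 * s + 1) k)).
transitivity (CRInt (fun p => RtoC (/ 4 ^ s) * Csum_n (fun k =>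
   c k * (g (RtoC (cos p)) * RtoC (cos (INR (m k) * p)))) s)%C 0 PI).
{ apply CRInt_ext. intros p. rewrite cheb_pow_sum, RtoC_mult, RtoC_sum_n.
  rewrite Cmult_assoc, (Cmult_comm (g _)), <- Cmult_assoc. f_equal.
  rewrite <- sum_n_Cmult_l. apply sum_n_Cext. intros k _. rewrite RtoC_mult. unfold c, m. ring. }
assert (C3 : forall (k : nat) t, continuousC (fun p =>
   c k * (g (RtoC (cos p)) * RtoC (cos (INR (m k) * p))))%C t).
{ intros k t. apply continuous_Cmult; [apply continuous_const|apply C1]. }
rewrite CRInt_Cmult.
2: { intros t. apply (continuous_sum_n_C (fun k p =>
       c k * (g (RtoC (cos p)) * RtoC (cos (INR (m k) * p))))%C). intros k. apply C3. }
rewrite (CRInt_sum_n (fun k p => c k * (g (RtoC (cos p)) * RtoC (cos (INR (m k) * p))))%C) by exact C3.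
transitivity (RtoC (/ (2 * 4 ^ s)) * Csum_n (fun k =>
   c k * CRInt (fun p => g (joukowski (polar 1 p)) * / polar 1 p ^ m k)%C 0 (2 * PI))%C s)%C.
{ rewrite <- !sum_n_Cmult_l. apply sum_n_Cext. intros k _.
  rewrite CRInt_Cmult by apply C1. rewrite CRInt_cos_circle by exact Hg.
  rewrite Rinv_mult, RtoC_mult, (RtoC_inv 2) by lra. ring. }
f_equal.
rewrite (sum_n_Cext _ (fun k => CRInt (fun p => c k * (g (joukowski (polar 1 p)) * / polar 1 p ^ m k))%C
  0 (2 * PI))).
2: { intros k _. rewrite CRInt_Cmult by apply C2. reflexivity. }
rewrite <- (CRInt_sum_n (fun k p => c k * (g (joukowski (polar 1 p)) * / polar 1 p ^ m k))%C).
2: { intros k t. apply continuous_Cmult; [apply continuous_const|apply C2]. }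
apply CRInt_ext. intros p. unfold cheb_tail. rewrite <- sum_n_Cmult_l.
apply sum_n_Cext. intros k _. unfold c, m. ring.
Qed.

Lemma remainder_circle (n s : nat) (rho r : R) (xi : nat -> R) (ell : nat -> nat -> R -> R)
    (f : C -> C) :
  (1 <= n)%nat -> (1 <= s)%nat -> 1 < r < rho -> cheb_zeros n xi ->
  hermite_fundamental n s xi ell -> analytic_on (ellipse_interior rho) f ->
  remainder n s xi ell f = (RtoC (/ (2 * 4 ^ s)) *
    CRInt (fun t => f (joukowski (polar r t)) *
      (cheb_tail n s (polar r t) / chebTC n (joukowski (polar r t)) ^ (2 * s)))%C 0 (2 * PI))%C.
Proof.
intros Hn Hs Hr Hxi Hell Hf.
assert (Hrho : 1 < rho) by lra.
destruct (hermite_interpolant n s xi ell (fun i nu => C_derive_n f i (RtoC (xi nu))) Hn Hs Hell)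
  as (H & HH & EH & DH).
assert (HolH : forall z, hol H z) by (intros z; now apply is_Cpoly_hol with (2 * s * n - 1)%nat).
assert (Holf : forall z, ellipse_interior rho z -> hol f z).
{ intros z Hz. apply analytic_at_hol. exact (Hf z Hz). }
rewrite (remainder_integral n s xi ell f H Hn Hs Hell); [| |intros t; apply HolH|exact EH].
2: { intros t Ht. now apply Holf, segment_interior. }
set (e := fun z => (f z + - (1) * H z)%C).
assert (He : forall z, ellipse_interior rho z -> analytic_at e z /\
  forall i, C_derive_n e i z = (C_derive_n f i z + - (1) * C_derive_n H i z)%C).
{ intros z Hz.
  assert (AH := is_Cpoly_analytic _ H z HH).
  destruct (analytic_at_scal (- (1))%C H z AH) as [A1 A2].
  destruct (analytic_at_plus f (fun z => - (1) * H z)%C z (Hf z Hz) A1) as [A3 A4].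
  split; [exact A3|]. intros i. unfold e. now rewrite A4, A2. }
assert (Ixi : forall mu, (1 <= mu <= n)%nat -> ellipse_interior rho (RtoC (xi mu))).
{ intros mu Hmu. apply segment_interior; [exact Hrho|].
  destruct (proj1 Hxi mu Hmu) as [B _]. lra. }
assert (Hd : forall mu j, (1 <= mu <= n)%nat -> (j < 2 * s)%nat -> C_derive_n e j (RtoC (xi mu)) = 0).
{ intros mu j Hmu Hj. rewrite (proj2 (He _ (Ixi mu Hmu))), DH by lia. ring. }
set (g := cheb_quotient n s e).
assert (Holg : forall z, ellipse_interior rho z -> hol g z).
{ intros z Hz. apply (hol_cheb_quotient n s xi e z Hn Hs Hxi); [now apply He|exact Hd]. }
assert (Eg : forall z, e z = (g z * chebTC n z ^ (2 * s))%C).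
{ intros z. apply (cheb_quotient_eq n s xi e z Hn Hs Hxi). intros mu Hmu.
  exact (Hd mu O Hmu ltac:(lia)). }
transitivity (CRInt (fun p => g (RtoC (cos p)) * RtoC (chebT n (cos p) ^ (2 * s + 1)))%C 0 PI).
{ apply CRInt_ext. intros p.
  replace (f (RtoC (cos p)) - H (RtoC (cos p)))%C with (e (RtoC (cos p))) by (unfold e; ring).
  rewrite Eg, chebTC_RtoC, pow_add, RtoC_mult, RtoC_pow, pow_1. C_eq. ring. }
rewrite cheb_power_integral.
2: { intros t Ht. now apply hol_continuous, Holg, segment_interior. }
f_equal.
assert (Hinv : 0 < / rho < 1).
{ split; [apply Rinv_0_lt_compat; lra|]. rewrite <- Rinv_1. apply Rinv_lt_contravar; lra. }
(* On the annulus 1/rho < |u| < rho the factor [g] is holomorphic even over the nodes, and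
   [cheb_tail] has its only singularity at u = 0. *)
rewrite (circle_mean_const (fun u => g (joukowski u) * cheb_tail n s u)%C (/ rho) rho) with (r2 := r);
  try lra.
2: { intros u Hu. assert (u0 : u <> 0) by (intros Z; rewrite Z, Cmod_0 in Hu; lra).
     apply (hol_mult (fun u => g (joukowski u))); [|now apply hol_cheb_tail].
     apply (hol_comp g joukowski); [now apply Holg, joukowski_interior|now apply hol_joukowski]. }
assert (CW : forall t, continuousC (fun t =>
  cheb_tail n s (polar r t) / chebTC n (joukowski (polar r t)) ^ (2 * s))%C t).
{ intros t. apply (continuous_comp (polar r)
    (fun u => cheb_tail n s u / chebTC n (joukowski u) ^ (2 * s))%C); [apply continuous_polar|].
  apply hol_continuous, hol_cheb_weight; [exact Hn|]. rewrite Cmod_polar; lra. }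
assert (CJ : forall t, continuousC (fun t => joukowski (polar r t)) t).
{ intros t. apply (continuous_comp (polar r) joukowski); [apply continuous_polar|].
  apply hol_continuous, hol_joukowski, polar_neq_0. lra. }
assert (Z := poly_circle_integral_0 n s H r Hn Hs HH ltac:(lra)).
(* Subtracting the vanishing integral [Z] restores e = f - H under the integral; [Eg] then cancels
   T_n^(2s), which has no zero on |u| = r. *)
transitivity (CRInt (fun t => f (joukowski (polar r t)) *
      (cheb_tail n s (polar r t) / chebTC n (joukowski (polar r t)) ^ (2 * s)))%C 0 (2 * PI) -
  CRInt (fun t => H (joukowski (polar r t)) *
    (cheb_tail n s (polar r t) / chebTC n (joukowski (polar r t)) ^ (2 * s)))%C 0 (2 * PI))%C.
2: { rewrite Z. C_eq. ring. }
rewrite <- CRInt_minus.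
- apply CRInt_ext. intros t.
  assert (HT : chebTC n (joukowski (polar r t)) <> 0).
  { apply chebTC_joukowski_neq_0; [exact Hn|]. rewrite Cmod_polar; lra. }
  replace (f (joukowski (polar r t))) with (e (joukowski (polar r t)) + H (joukowski (polar r t)))%C
    by (unfold e; ring).
  rewrite Eg. field. now apply Cpow_nz.
- intros t. apply continuous_Cmult; [|apply CW].
  apply (continuous_comp (fun t => joukowski (polar r t)) f); [apply CJ|].
  apply hol_continuous, Holf, joukowski_interior; [exact Hrho|]. rewrite Cmod_polar; lra.
- intros t. apply continuous_Cmult; [|apply CW].
  apply (continuous_comp (fun t => joukowski (polar r t)) H); [apply CJ|].
  apply hol_continuous, HolH.
Qed.

(** * Passage to the boundary ellipse *)

Lemma joukowski_closure (rho r t : R) : 1 < rho -> 1 <= r <= rho ->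
  closure (ellipse_interior rho) (joukowski (polar r t)).
Proof.
intros Hrho Hr P HP.
assert (Cr : continuousC (fun x => joukowski (polar x t)) r).
{ apply (continuous_comp (fun x => polar x t) joukowski).
  - apply continuous_Cmult; [|apply continuous_const]. apply continuous_RtoC, continuous_id.
  - apply hol_continuous, hol_joukowski, polar_neq_0. lra. }
destruct (Cr P HP) as [d Hd].
assert (Hinv : 0 < / rho < 1).
{ split; [apply Rinv_0_lt_compat; lra|]. rewrite <- Rinv_1. apply Rinv_lt_contravar; lra. }
set (e := Rmin (d / 2) ((r - / rho) / 2)).
assert (Hd0 := cond_pos d).
assert (He : 0 < e) by (apply Rmin_pos; lra).
assert (He1 : e <= d / 2) by apply Rmin_l. assert (He2 : e <= (r - / rho) / 2) by apply Rmin_r.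
exists (joukowski (polar (r - e) t)). split.
- apply Hd. change (Rabs (r - e - r) < d). rewrite Rabs_left; lra.
- apply joukowski_interior_polar; lra.
Qed.

(** f is controlled only on the closed ellipse. Capping the radius at rho keeps the point in it, so
    that continuity at (t, rho) can be stated in a full two-sided neighbourhood, as uniform
    continuity in two variables requires. *)
Lemma continuous_polar_Rmin (rho t : R) :
  R2continuousC
    (fun p => polar (Rmin (snd p) rho) (fst p)) (t, rho).
Proof.
assert (CM : continuous (fun x => Rmin x rho) rho).
{ intros P [d Hd]. exists d. intros x Hx. apply Hd. rewrite (Rmin_left rho rho) by lra.
  apply Rle_lt_trans with (2 := Hx). change (Rabs (Rmin x rho - rho) <= Rabs (x - rho)).
  unfold Rmin. destruct (Rle_dec x rho); [lra|]. rewrite Rminus_diag, Rabs_R0. apply Rabs_pos. }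
apply continuous_Cmult.
- apply (continuous_RtoC (fun p : R2 => Rmin (snd p) rho)).
  apply (continuous_comp snd (fun x => Rmin x rho)); [apply continuous_snd|exact CM].
- apply (continuous_comp fst cis); [apply continuous_fst|apply continuous_cis].
Qed.

Lemma continuous_up_to_boundary (rho t : R) (f : C -> C) : 1 < rho ->
  continuous_on (closure (ellipse_interior rho)) f ->
  R2continuousC
    (fun p => f (joukowski (polar (Rmin (snd p) rho) (fst p)))) (t, rho).
Proof.
intros Hrho Hf.
set (G := fun p : R * R => joukowski (polar (Rmin (snd p) rho) (fst p))).
assert (Hmin : Rmin rho rho = rho) by (apply Rmin_left; lra).
assert (CG : R2continuousC G (t, rho)).
{ apply (continuous_comp (fun p : R * R => polar (Rmin (snd p) rho) (fst p)) joukowski).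
  - apply continuous_polar_Rmin.
  - apply hol_continuous, hol_joukowski, polar_neq_0. simpl. rewrite Hmin. lra. }
assert (Loc : locally (T := R2) (t, rho)
   (fun p => closure (ellipse_interior rho) (G p))).
{ assert (L : locally rho (fun x => 1 < x)) by (apply open_gt; exact Hrho).
  assert (Cs := continuous_snd (U := R_UniformSpace) (V := R_UniformSpace) t rho).
  assert (L2 := Cs _ L). unfold filtermap in L2. revert L2. apply filter_imp.
  intros [u v] Hv. simpl in Hv. apply joukowski_closure; [exact Hrho|]. simpl.
  split; [apply Rmin_glb; lra|apply Rmin_r]. }
intros P HP.
assert (Hw := Hf (G (t, rho)) (locally_singleton _ _ Loc) P HP).
assert (L3 := CG _ Hw). unfold filtermap in L3 |- *.
generalize (filter_and _ _ L3 Loc). apply filter_imp. intros p [A B]. exact (A B).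
Qed.

Lemma continuous_on_ellipse (rho t : R) (f : C -> C) : 1 < rho ->
  continuous_on (closure (ellipse_interior rho)) f ->
  continuousC (fun t => f (joukowski (polar rho t))) t.
Proof.
intros Hrho Hf.
apply continuous_ext with (fun t => f (joukowski (polar (Rmin rho rho) t))).
{ intros x. now rewrite Rmin_left by lra. }
apply (continuous_comp (fun x => (x, rho) : R2)
  (fun p => f (joukowski (polar (Rmin (snd p) rho) (fst p))))).
- intros P [d Hd]. exists d. intros x Hx. apply Hd. split; [exact Hx|apply ball_center].
- now apply continuous_up_to_boundary.
Qed.

Lemma ellipse_max_exists (rho : R) (f : C -> C) : 1 < rho ->
  continuous_on (closure (ellipse_interior rho)) f ->
  exists M, is_max_on (ellipse rho) (fun z => Cmod (f z)) M.
Proof.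
intros Hrho Hf. assert (HPI := PI_RGT_0).
destruct (continuity_ab_maj (fun t => Cmod (f (joukowski (polar rho t)))) 0 (2 * PI))
  as (m & Hm & Hm').
- lra.
- intros t _. apply continuity_pt_filterlim.
  exact (continuous_Cmod _ _ (continuous_on_ellipse rho t f Hrho Hf)).
- exists (Cmod (f (joukowski (polar rho m)))). split.
  + exists (ellipse_point rho m). split; [now exists m|]. now rewrite ellipse_point_joukowski.
  + intros z (t & Ht & ->). rewrite ellipse_point_joukowski. now apply Hm.
Qed.

(** Values of f inside the ellipse are never bounded by M directly. At each angle the integrand at
    radius r is compared with the one at radius rho by uniform continuity over [0, 2 pi], and only
    the latter is estimated through M. *)
Lemma remainder_le_L_ns (n s : nat) (rho M : R) (xi : nat -> R) (ell : nat -> nat -> R -> R)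
    (f : C -> C) :
  (1 <= n)%nat -> (1 <= s)%nat -> 1 < rho -> cheb_zeros n xi ->
  hermite_fundamental n s xi ell -> analytic_on (ellipse_interior rho) f ->
  continuous_on (closure (ellipse_interior rho)) f ->
  is_max_on (ellipse rho) (fun z => Cmod (f z)) M ->
  Cmod (remainder n s xi ell f) <= L_ns n s rho * M.
Proof.
intros Hn Hs Hrho Hxi Hell Hf Hc [_ HM].
assert (HPI := PI_RGT_0). assert (H4 : 0 < 4 ^ s) by (apply pow_lt; lra).
rewrite L_ns_eq by assumption.
set (W := fun u => (cheb_tail n s u / chebTC n (joukowski u) ^ (2 * s))%C).
assert (HW : forall u, 1 < Cmod u -> hol W u) by (intros; now apply hol_cheb_weight).
set (phi := fun t r => Cmod (f (joukowski (polar (Rmin r rho) t)) * W (polar (Rmin r rho) t))).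
assert (Cphi : forall t, continuity_2d_pt phi t rho).
{ intros t. apply continuity_2d_pt_filterlim.
  apply (continuous_Cmod (T := R2)
    (fun p => f (joukowski (polar (Rmin (snd p) rho) (fst p))) *
       W (polar (Rmin (snd p) rho) (fst p)))%C (t, rho)).
  apply continuous_Cmult; [now apply continuous_up_to_boundary|].
  apply (continuous_comp (fun p : R * R => polar (Rmin (snd p) rho) (fst p)) W).
  - apply continuous_polar_Rmin.
  - apply hol_continuous, HW. simpl. rewrite Rmin_left, Cmod_polar; lra. }
set (J := RInt (Phi n s rho) 0 (2 * PI)).
assert (Hbound : forall eps : posreal,
  Cmod (remainder n s xi ell f) <= / (2 * 4 ^ s) * (M * J + 2 * PI * eps)).
{ intros eps.
  destruct (uniform_continuity_2d_1d phi 0 (2 * PI) rho (fun t _ => Cphi t) eps) as [d Hd].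
  assert (Hd0 := cond_pos d).
  (* The first bound puts r within d of rho, the second keeps it above 1. *)
  set (r := Rmax (rho - d / 2) ((1 + rho) / 2)).
  assert (Hr1 : rho - d / 2 <= r) by apply Rmax_l.
  assert (Hr2 : (1 + rho) / 2 <= r) by apply Rmax_r.
  assert (Hr3 : r < rho) by (apply Rmax_lub_lt; lra).
  rewrite (remainder_circle n s rho r xi ell f Hn Hs ltac:(lra) Hxi Hell Hf).
  assert (Hp : 0 < / (2 * 4 ^ s)) by (apply Rinv_0_lt_compat; lra).
  rewrite Cmod_mult, Cmod_R, Rabs_pos_eq by lra.
  apply Rmult_le_compat_l; [lra|].
  assert (Cr : forall t, continuousC
    (fun t => f (joukowski (polar r t)) * W (polar r t))%C t).
  { intros t. apply (continuous_comp (polar r) (fun u => f (joukowski u) * W u)%C);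
      [apply continuous_polar|].
    assert (Hu : Cmod (polar r t) = r) by (apply Cmod_polar; lra).
    apply hol_continuous. apply (hol_mult (fun u => f (joukowski u))).
    - apply (hol_comp f joukowski).
      + apply analytic_at_hol. apply (Hf (joukowski (polar r t))), joukowski_interior; [exact Hrho|].
        rewrite Hu. split; [|exact Hr3].
        apply Rlt_trans with 1; [|lra]. rewrite <- Rinv_1. apply Rinv_lt_contravar; lra.
      + apply hol_joukowski, polar_neq_0. lra.
    - apply HW. lra. }
  eapply Rle_trans; [apply Cmod_CRInt_le; [lra|exact Cr]|].
  assert (I1 : is_RInt (fun t => M * Phi n s rho t + eps) 0 (2 * PI) (M * J + 2 * PI * eps)).
  { apply (is_RInt_plus (V := R_NormedModule) (fun t => M * Phi n s rho t) (fun _ => eps)).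
    - apply (is_RInt_scal (V := R_NormedModule)).
      apply (RInt_correct (V := R_CompleteNormedModule)), ex_RInt_cont.
      intros x. now apply continuous_Phi.
    - assert (K := is_RInt_const (V := R_NormedModule) 0 (2 * PI) (eps : R)).
      rewrite Rminus_0_r in K. exact K. }
  rewrite <- (is_RInt_unique _ _ _ _ I1).
  apply RInt_le; [lra| |eexists; exact I1|].
  - apply ex_RInt_cont. intros t. apply continuous_Cmod, Cr.
  - intros t Ht.
    assert (U := Hd t rho t r ltac:(lra) ltac:(lra) ltac:(lra) ltac:(lra)).
    rewrite Rminus_diag, Rabs_R0 in U. specialize (U Hd0). unfold phi in U.
    rewrite (Rmin_left r rho), (Rmin_left rho rho) in U by lra.
    apply Rabs_def2 in U. destruct U as [U _].
    assert (U2 : Cmod (f (joukowski (polar rho t)) * W (polar rho t)) <= M * Phi n s rho t).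
    { rewrite Cmod_mult. apply Rmult_le_compat_r; [apply Cmod_ge_0|].
      rewrite <- ellipse_point_joukowski. apply HM. exists t. split; [lra|reflexivity]. }
    change (Cmod (f (joukowski (polar r t)) * W (polar r t)) <= M * Phi n s rho t + eps). lra. }
replace (/ (2 * 4 ^ s) * J * M) with (/ (2 * 4 ^ s) * (M * J)) by ring.
apply le_epsilon. intros eps Heps.
assert (Hp : 0 < / (2 * 4 ^ s)) by (apply Rinv_0_lt_compat; lra).
(* The tolerance is scaled so that the error term of [Hbound] becomes exactly eps. *)
assert (He' : 0 < eps / (/ (2 * 4 ^ s) * (2 * PI))).
{ apply Rdiv_lt_0_compat; [exact Heps|]. apply Rmult_lt_0_compat; lra. }
generalize (Hbound (mkposreal _ He')). simpl. intros B.
eapply Rle_trans; [exact B|]. apply Req_le. field. lra.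
Qed.

Theorem mainTheorem3 :
  forall (n s : nat) (rho : R),
    (1 <= n)%nat -> (1 <= s)%nat -> 1 < rho ->
    L_ns n s rho <= err_bound n s rho /\
    (forall l : nat, (l <= s)%nat -> I_int n s rho l = I_closed n s rho l) /\
    (forall (xi : nat -> R) (ell : nat -> nat -> R -> R) (f : C -> C),
       cheb_zeros n xi ->
       hermite_fundamental n s xi ell ->
       analytic_on (ellipse_interior rho) f ->
       continuous_on (closure (ellipse_interior rho)) f ->
       exists M : R,
         is_max_on (ellipse rho) (fun z => Cmod (f z)) M /\
         Cmod (remainder n s xi ell f) <= err_bound n s rho * M).
Proof.
intros n s rho Hn Hs Hrho. split; [|split].
- now apply L_ns_le_err_bound.
- intros l _. now apply I_int_closed.
- intros xi ell f Hxi Hell Hf Hc.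
  destruct (ellipse_max_exists rho f Hrho Hc) as [M HM].
  exists M. split; [exact HM|].
  apply Rle_trans with (L_ns n s rho * M).
  + now apply remainder_le_L_ns.
  + apply Rmult_le_compat_r; [|now apply L_ns_le_err_bound].
    destruct HM as [(z & _ & <-) _]. apply Cmod_ge_0.
Qed.
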